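(* Let $k$ be a commutative ring with unity and let $q\in k$ be invertible. Then: (1) $\mathsf{MR}_q=(k\mathfrak{S},*,\Delta_q)$ and $\mathsf{MR}'_q=(k\mathfrak{S},*'_q,\Delta')$ are graded $q$-Hopf algebras that are graded dual to each other with respect to the canonical pairing $\langle\cdot,\cdot\rangle:\mathsf{MR}'_q\times\mathsf{MR}_q\to k$, $\langle w,w'\rangle=\delta_{w,w'}$ for permutations $w,w'$. (2) The linear map $\theta_q:\mathsf{MR}_q\to\mathsf{MR}'_q$, $\theta_q(w)=q^{\ell(w)}w^{-1}$, is an isomorphism of graded $q$-Hopf algebras. (3) The linear map $\pi'_q:\mathsf{MR}'_q\to\mathsf{QSym}_q$, $\pi'_q(w)=F_{c(w)}$ ($w\in\mathfrak{S}$), is a surjective homomorphism of graded $q$-Hopf algebras, and the linear map $\iota_q:\mathsf{NSym}\to\mathsf{MR}_q$, $\iota_q(H_\alpha)=D_{\preceq\alpha}$ ($\alpha\in C$), is an injective homomorphism of graded $q$-Hopf algebras; moreover $\langle\pi'_q(w),H\rangle=\langle w,\iota_q(H)\rangle$ for all $w\in\mathfrak{S}$, $H\in\mathsf{NSym}$. (4) The composition $\pi'_q\circ\theta_q\circ\iota_q:\mathsf{NSym}\to\mathsf{QSym}_q$ is the forgetful map $\phi$.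
   Context: **Graded $q$-Hopf algebras.** A graded $q$-Hopf algebra is a connected $\mathbb{N}$-graded unital associative $k$-algebra $H=\bigoplus_n H_n$ with a graded coassociative counital coproduct $\Delta$ such that $\Delta(xy)=\Delta(x)\Delta(y)$, where $H\otimes H$ carries the twisted product $(a\otimes b)(c\otimes d)=q^{|b||c|}ac\otimes bd$ for homogeneous elements (the antipode then exists automatically). Two such are graded dual with respect to a pairing if, in each degree, the pairing is perfect, different degrees are orthogonal, and the product of each is adjoint to the coproduct of the other (with $\langle a\otimes b,c\otimes d\rangle=\langle a,c\rangle\langle b,d\rangle$). **Compositions.** $C$ is the set of compositions (finite tuples of positive integers, including the empty one); $|\alpha|$ is the sum, $\ell(\alpha)$ the number of parts, $\alpha\vDash n$ means $|\alpha|=n$. For $\alpha=(\alpha_1,\dots,\alpha_r)$, $\mathrm{des}(\alpha)=\{\alpha_1,\alpha_1+\alpha_2,\dots,\alpha_1+\cdots+\alpha_{r-1}\}$; for $S\subseteq[n-1]$, $c(S)\vDash n$ is the composition with descent set $S$. $\alpha\preceq\beta$ means $\beta$ is a refinement of $\alpha$, i.e. $|\alpha|=|\beta|$ and $\mathrm{des}(\alpha)\subseteq\mathrm{des}(\beta)$. $\alpha\beta$ denotes concatenation. **$\mathsf{QSym}_q$.** Let $A_q=k\langle\langle x_1,x_2,\dots\rangle\rangle/(x_ix_j-qx_jx_i,\ i>j)$. Put $M_\alpha=\sum_{i_1<\cdots<i_r}x_{i_1}^{\alpha_1}\cdots x_{i_r}^{\alpha_r}$ and $F_\alpha=\sum_{\beta\succeq\alpha}M_\beta$.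 $\mathsf{QSym}_q$ is the subalgebra of $A_q$ with $k$-basis $\{M_\alpha\}_{\alpha\in C}$ ($M_\alpha$ in degree $|\alpha|$), with coproduct $\Delta'(M_\alpha)=\sum_{\beta\gamma=\alpha}M_\beta\otimes M_\gamma$; it is a graded $q$-Hopf algebra. $h_n=\sum_{i_1\le\cdots\le i_n}x_{i_1}\cdots x_{i_n}$. **$\mathsf{NSym}$.** The free associative $k$-algebra on $H_1,H_2,\dots$ ($\deg H_n=n$, $H_0=1$), $H_\alpha=H_{\alpha_1}\cdots H_{\alpha_r}$, made a graded $q$-Hopf algebra by $\Delta_q(H_n)=\sum_{i=0}^nH_i\otimes H_{n-i}$. Pairing $\langle\cdot,\cdot\rangle:\mathsf{QSym}_q\times\mathsf{NSym}\to k$, $\langle M_\alpha,H_\beta\rangle=\delta_{\alpha,\beta}$. The forgetful map $\phi:\mathsf{NSym}\to\mathsf{QSym}_q$ is the algebra homomorphism with $\phi(H_n)=h_n$. **Permutations.** $k\mathfrak{S}=\bigoplus_{n\ge0}k\mathfrak{S}_n$, with $w\in\mathfrak{S}_n$ viewed as a word $w_1\cdots w_n$ on $[n]=\{1,\dots,n\}$; $\ell(w)$ is its number of inversions; $\mathrm{des}(w)=\{i\in[n-1]:w(i)>w(i+1)\}$, $c(w)=c(\mathrm{des}(w))\vDash n$; $D_{\preceq\alpha}=\sum_{c(w)\preceq\alpha}w$ (sum over $w\in\mathfrak{S}_{|\alpha|}$). For a word $u$ of length $n$ on a totally ordered alphabet, $\mathrm{st}(u)\in\mathfrak{S}_n$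 is the permutation with $\mathrm{st}(u)(i)<\mathrm{st}(u)(j)$ iff $u_i<u_j$, or $u_i=u_j$ and $i<j$; $\mathrm{alph}(u)$ is its set of letters; $u|_I$ is the subword of letters in $I$. Operations, for $w\in\mathfrak{S}_n$, $w'\in\mathfrak{S}_m$: - $w*w'=\sum uv$ over words $u,v$ with $\mathrm{alph}(u)\cup\mathrm{alph}(v)=[n+m]$, $\mathrm{st}(u)=w$, $\mathrm{st}(v)=w'$ (lengths $n$ and $m$); - $\Delta_q(w)=\sum_{i=0}^nq^{\mathrm{inv}(i,w)}\,w|_{\{1,\dots,i\}}\otimes\mathrm{st}(w|_{\{i+1,\dots,n\}})$, where $\mathrm{inv}(i,w)$ is the number of pairs $(a,b)$ with $a>b$, $w_a\in\{1,\dots,i\}$, $w_b\in\{i+1,\dots,n\}$; - $w*'_qw'$ is the $q$-shuffle of $w$ with the word $\overline{w'}$ obtained by adding $n$ to each letter of $w'$; the $q$-shuffle $\sqcup_q$ of words is defined recursively by $\emptyset\sqcup_q u=u\sqcup_q\emptyset=u$ and $(au)\sqcup_q(bv)=a(u\sqcup_q bv)+q^{|au|}\,b(au\sqcup_q v)$ for letters $a,b$ and words $u,v$, with $|\cdot|$ the length; - $\Delta'(w)=\sum_{i=0}^n\mathrm{st}(w_1\cdots w_i)\otimes\mathrm{st}(w_{i+1}\cdots w_n)$. *)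

(* Defs.v *)
From HB Require Import structures.
From mathcomp Require Import all_boot all_order all_algebra all_fingroup.
From mathcomp Require Import finmap.
From mathcomp.multinomials Require Import monalg.

Set Implicit Arguments.
Unset Strict Implicit.
Unset Printing Implicit Defensive.

Import GRing.Theory.
Local Open Scope ring_scope.

(* {malg k[B]} carries its k-module structure only when k is nontrivial;      *)
(* fmod is the same free module, over an arbitrary commutative ring k.        *)
Definition fmod (k : comPzRingType) (B : choiceType) : Type := {malg k[B]}.

HB.instance Definition _ (k : comPzRingType) (B : choiceType) :=
  GRing.Zmodule.copy (fmod k B) {malg k[B]}.

Section FmodScale.
Variables (k : comPzRingType) (B : choiceType).
Implicit Types (c : k) (x : fmod k B) (b : B).

Definition fmod_scale c x : fmod k B := [malg b in msupp x => c * x@_b].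

Lemma fmod_scaleE c x b : (fmod_scale c x)@_b = c * x@_b.
Proof. by rewrite mcoeffE; case: msuppP; rewrite ?mulr0. Qed.

Fact fmod_scaleA c d x : fmod_scale c (fmod_scale d x) = fmod_scale (c * d) x.
Proof. by apply/malgP => b; rewrite !fmod_scaleE mulrA. Qed.
Fact fmod_scale1 : left_id 1 fmod_scale.
Proof. by move=> x; apply/malgP => b; rewrite fmod_scaleE mul1r. Qed.
Fact fmod_scaleDr : right_distributive fmod_scale +%R.
Proof.
by move=> c x y; apply/malgP => b; rewrite mcoeffD !fmod_scaleE mcoeffD mulrDr.
Qed.
Fact fmod_scaleDl x : {morph fmod_scale^~ x : c d / c + d}.
Proof.
by move=> c d; apply/malgP => b; rewrite mcoeffD !fmod_scaleE mulrDl.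
Qed.

HB.instance Definition _ := GRing.Zmodule_isLmodule.Build k (fmod k B)
  fmod_scaleA fmod_scale1 fmod_scaleDr fmod_scaleDl.

Definition fbas b : fmod k B := << 1 *g b >>.

Lemma fcoefZ c x b : (c *: x)@_b = c * x@_b.
Proof. exact: fmod_scaleE. Qed.

Lemma fcoefD x y b : (x + y)@_b = x@_b + y@_b.
Proof. exact: mcoeffD. Qed.

Lemma fcoef0 b : (0 : fmod k B)@_b = 0.
Proof. exact: mcoeff0. Qed.

Lemma fcoefU b b' : (fbas b)@_b' = (b == b')%:R.
Proof. by rewrite mcoeffU; case: eqP. Qed.

Lemma fcoef_sum (I : Type) (r : seq I) (P : pred I) (F : I -> fmod k B) b :
  (\sum_(i <- r | P i) F i)@_b = \sum_(i <- r | P i) (F i)@_b.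
Proof. exact: (raddf_sum (mcoeff b)). Qed.

End FmodScale.

Arguments fbas {k B} b.

Section Extension.
Variables (k : comPzRingType).

(* The linear extension of f : B -> V, and the bilinear one.                 *)
Definition lift (B : choiceType) (V : lmodType k) (f : B -> V)
  (x : fmod k B) : V := \sum_(b <- msupp x) x@_b *: f b.

Definition blift (B C : choiceType) (V : lmodType k) (f : B -> C -> V)
  (x : fmod k B) (y : fmod k C) : V := lift (fun b => lift (f b) y) x.

(* The tensor product of the free modules on B and C is the free module on   *)
(* B * C, with fbas (b, c) standing for b (x) c.                              *)
Definition tens (B C : choiceType) : fmod k B -> fmod k C -> fmod k (B * C)%type :=
  blift (fun b c => fbas (b, c)).

Definition tmap (B C B' C' : choiceType) (f : fmod k B -> fmod k B')
  (g : fmod k C -> fmod k C') : fmod k (B * C)%type -> fmod k (B' * C')%type :=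
  lift (fun p => tens (f (fbas p.1)) (g (fbas p.2))).

Definition tassoc (B C D : choiceType) :
    fmod k (B * (C * D))%type -> fmod k (B * C * D)%type :=
  lift (fun p => fbas (p.1, p.2.1, p.2.2)).

End Extension.

Section ExtensionTheory.
Variables (k : comPzRingType) (B : choiceType) (V : lmodType k).

Lemma lift_wide (f : B -> V) (d : {fset B}) (x : fmod k B) :
  {subset msupp x <= d} -> lift f x = \sum_(b <- d) x@_b *: f b.
Proof.
move=> /fsubsetP sub; apply: big_fset_incl => // b _ /mcoeff_outdom ->.
exact: scale0r.
Qed.

Lemma lift_linear (f : B -> V) : linear (lift f).
Proof.
move=> c x y; pose d := (msupp x `|` msupp y `|` msupp (c *: x + y))%fset.
rewrite !(@lift_wide f d); try by move=> b; rewrite !inE => ->; rewrite ?orbT.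
rewrite scaler_sumr -big_split; apply: eq_bigr => b _ /=.
by rewrite fcoefD fcoefZ scalerDl scalerA.
Qed.

Lemma lift_bas (f : B -> V) b : lift f (fbas b) = f b.
Proof.
rewrite (@lift_wide f [fset b]%fset) ?big_seq_fset1 ?fcoefU ?eqxx ?scale1r //.
move=> b'; rewrite -mcoeff_neq0 fcoefU inE (eq_sym b').
by case: (b == b') => //; rewrite eqxx.
Qed.
End ExtensionTheory.

(* A free graded module with a homogeneous basis hd_bas, a bilinear product  *)
(* and a linear coproduct, both given by their values on the basis.          *)
Record hopf_data (k : comPzRingType) := HopfData {
  hd_bas : choiceType;
  hd_deg : hd_bas -> nat;
  hd_one : fmod k hd_bas;
  hd_mul : hd_bas -> hd_bas -> fmod k hd_bas;
  hd_cop : hd_bas -> fmod k (hd_bas * hd_bas)%type }.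

Definition hd_mod (k : comPzRingType) (H : hopf_data k) := fmod k (hd_bas H).

Section GradedHopf.
Variables (k : comPzRingType) (q : k).
Implicit Types H K : hopf_data k.

Definition hmul H : hd_mod H -> hd_mod H -> hd_mod H := blift (@hd_mul k H).

Definition hcop H : hd_mod H -> fmod k (hd_bas H * hd_bas H)%type :=
  lift (@hd_cop k H).

Definition homog H (n : nat) (x : hd_mod H) : Prop :=
  forall b, b \in msupp x -> hd_deg b = n.

Definition thomog H (n : nat) (z : fmod k (hd_bas H * hd_bas H)%type) : Prop :=
  forall p, p \in msupp z -> (hd_deg p.1 + hd_deg p.2)%N = n.

(* (a (x) b) (c (x) d) = q^(|b||c|) ac (x) bd                                 *)
Definition tmul H : fmod k (hd_bas H * hd_bas H)%type ->
    fmod k (hd_bas H * hd_bas H)%type -> fmod k (hd_bas H * hd_bas H)%type :=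
  blift (fun p r => q ^+ (hd_deg p.2 * hd_deg r.1) *:
                    tens (hd_mul p.1 r.1) (hd_mul p.2 r.2)).

Definition is_counit H (e : {linear fmod k (hd_bas H) -> k^o}) : Prop :=
  [/\ forall n (x : hd_mod H), (0 < n)%N -> homog n x -> e x = 0,
      forall x : hd_mod H,
        lift (fun p => e (fbas p.1) *: fbas p.2) (hcop x) = x :> hd_mod H
    & forall x : hd_mod H,
        lift (fun p => e (fbas p.2) *: fbas p.1) (hcop x) = x :> hd_mod H].

Definition is_connected_graded_algebra H : Prop :=
  [/\ associative (@hmul H),
      left_id (hd_one H) (@hmul H) /\ right_id (hd_one H) (@hmul H),
      forall m n (x y : hd_mod H),
        homog m x -> homog n y -> homog (m + n) (hmul x y),
      homog 0 (hd_one H)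
    & forall x : hd_mod H, homog 0 x -> exists! c : k, x = c *: hd_one H].

Definition is_graded_coalgebra H : Prop :=
  [/\ forall n (x : hd_mod H), homog n x -> thomog n (hcop x),
      forall x : hd_mod H,
        tmap (@hcop H) id (hcop x) = tassoc (tmap id (@hcop H) (hcop x))
    & exists e, @is_counit H e].

Definition is_graded_qhopf H : Prop :=
  [/\ is_connected_graded_algebra H, is_graded_coalgebra H
    & forall x y : hd_mod H, hcop (hmul x y) = tmul (hcop x) (hcop y)].

Definition is_qhopf_hom H K (f : hd_mod H -> hd_mod K) : Prop :=
  [/\ linear f,
      f (hd_one H) = hd_one K /\ {morph f : x y / hmul x y},
      forall n x, homog n x -> homog n (f x),
      forall x, hcop (f x) = tmap f f (hcop x)
    & forall eH eK, is_counit eH -> is_counit eK -> forall x, eK (f x) = eH x].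

Definition is_qhopf_iso H K (f : hd_mod H -> hd_mod K) : Prop :=
  is_qhopf_hom f /\ bijective f.

(* The bilinear form with prescribed values on basis elements.               *)
Definition pairing (B C : choiceType) (f : B -> C -> k)
  (x : fmod k B) (y : fmod k C) : k := blift (V := k^o) f x y.

Definition is_graded_dual H K (f : hd_bas H -> hd_bas K -> k) : Prop :=
  let pr (x : hd_mod H) (y : hd_mod K) := pairing f x y in
  let pr2 := pairing (fun (a : hd_bas H * hd_bas H) (c : hd_bas K * hd_bas K) =>
                        f a.1 c.1 * f a.2 c.2) in
  [/\ (* A linear form on the component of degree n is the restriction of    *)
      (* one on the whole module, whence the quantification over phi.         *)
      forall n,
        (forall phi : {linear fmod k (hd_bas K) -> k^o}, exists! x : hd_mod H,
           homog n x /\ forall y, homog n y -> pr x y = phi y) /\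
        (forall phi : {linear fmod k (hd_bas H) -> k^o}, exists! y : hd_mod K,
           homog n y /\ forall x, homog n x -> pr x y = phi x),
      forall m n x y, m <> n -> homog m x -> homog n y -> pr x y = 0,
      forall x x' y, pr (hmul x x') y = pr2 (tens x x') (hcop y)
    & forall x y y', pr x (hmul y y') = pr2 (hcop x) (tens y y')].

End GradedHopf.

Section Compositions.
Local Open Scope nat_scope.

Definition comp := {a : seq nat | all (leq 1) a}.
HB.instance Definition _ := Choice.on comp.
Implicit Types a b : comp.

(* The empty composition if some entry of s is 0.                            *)
Definition mkcomp (s : seq nat) : comp := insubd (exist _ [::] isT : comp) s.

Definition cdeg a : nat := sumn (val a).

Definition ccat a b : comp := mkcomp (val a ++ val b).

Definition cdes a : seq nat :=
  [seq sumn (take i (val a)) | i <- iota 1 (size (val a)).-1].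

(* crefines a b: b is a refinement of a.                                      *)
Definition crefines a b : bool :=
  (cdeg a == cdeg b) && all (mem (cdes b)) (cdes a).

(* c(S), for a subset S of {1, .., n-1}; it lists the gaps between           *)
(* consecutive elements of 0 :: S :: n.                                       *)
Definition comp_of_des (n : nat) (S : pred nat) : comp :=
  mkcomp (if n == 0 then [::] else
    pairmap (fun i j => j - i) 0 (rcons [seq i <- iota 1 n.-1 | S i] n)).

Definition comps (n : nat) : seq comp :=
  [seq comp_of_des n [pred i | [exists j in D, i == (val j).+1]]
     | D : {set 'I_n.-1} <- enum {: {set 'I_n.-1}}].

End Compositions.

Section CompositionTheory.
Local Open Scope nat_scope.
Implicit Types a b : comp.

Lemma mkcompK (s : seq nat) : all (leq 1) s -> val (mkcomp s) = s.
Proof. by move=> s0; rewrite /mkcomp insubdK. Qed.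

Lemma scanl_sumn (x : nat) (s : seq nat) :
  scanl addn x s = [seq x + sumn (take i s) | i <- iota 1 (size s)].
Proof.
elim: s x => //= n s IH x; rewrite take0 /= addn0 IH; congr (_ :: _).
rewrite (iotaDl 1 1) -map_comp; apply: eq_map => i /=.
by rewrite addnA.
Qed.

Lemma scanl_cdes a : val a != [::] ->
  scanl addn 0 (val a) = rcons (cdes a) (cdeg a).
Proof.
move=> a0; rewrite scanl_sumn /cdes /cdeg.
have {a0} : 0 < size (val a) by case: (val a) a0.
case En: (size (val a)) => [//|n] _; rewrite -[n.+1]addn1 iotaD map_cat cats1 /=.
by rewrite addn1 /= add1n -En take_size.
Qed.

Lemma scanl_path x (s : seq nat) : all (leq 1) s -> path ltn x (scanl addn x s).
Proof.
elim: s x => //= n s IH x /andP[n0 s0].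
by rewrite -[X in X < _]addn0 ltn_add2l n0 IH.
Qed.

Lemma pairmap_pos x (s : seq nat) :
  path ltn x s -> all (leq 1) (pairmap (fun i j => j - i) x s).
Proof. by elim: s x => //= n s IH x /andP[xn /IH->]; rewrite subn_gt0 xn. Qed.

Lemma scanl_pairmap x (s : seq nat) :
  path ltn x s -> scanl addn x (pairmap (fun i j => j - i) x s) = s.
Proof. by elim: s x => //= n s IH x /andP[xn /IH]; rewrite subnKC ?(ltnW xn) // => ->. Qed.

Lemma cdes_cdeg_inj a b : cdes a = cdes b -> cdeg a = cdeg b -> a = b.
Proof.
have nil c : (val c == [::]) = (cdeg c == 0).
  by case: c => -[|[|n] s].
move=> eD eN; apply: val_inj; have := nil a; have := nil b; rewrite -eN.
case: eqP => [-> /esym -> /eqP->//|/eqP b0 <- /negbT a0].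
apply: (can_inj (scanlK addKn 0)).
by rewrite !scanl_cdes // eD eN.
Qed.

Lemma comp_of_desE n (S : pred nat) : 0 < n ->
  [/\ val (comp_of_des n S) != [::], cdeg (comp_of_des n S) = n
    & cdes (comp_of_des n S) = [seq i <- iota 1 n.-1 | S i]].
Proof.
case: n => // n _; rewrite /comp_of_des /=.
set s := filter _ _.
have ps : path ltn 0 (rcons s n.+1).
  have sz : {in s, forall i, 0 < i < n.+1}.
    by move=> i; rewrite mem_filter mem_iota add1n => /andP[].
  have ss : sorted ltn (0 :: s).
    rewrite /= path_min_sorted; last by apply/allP => i /sz/andP[].
    by apply: sorted_filter (iota_ltn_sorted _ _); exact: ltn_trans.
  rewrite rcons_path; apply/andP; split=> //.
  by have := mem_last 0 s; rewrite inE => /predU1P[->//|/sz/andP[]].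
have E := mkcompK (pairmap_pos ps).
have E0 : val (mkcomp (pairmap (fun i j => j - i) 0 (rcons s n.+1))) != [::].
  by rewrite E -size_eq0 size_pairmap size_rcons.
have := scanl_cdes E0; rewrite {1}E scanl_pairmap //.
by case/rcons_inj => e1 e2; split; rewrite -?e1 -?e2.
Qed.

Lemma cdeg_comp_of_des n (S : pred nat) : cdeg (comp_of_des n S) = n.
Proof. by case: n => [|n]; [rewrite /cdeg /comp_of_des mkcompK | case: (@comp_of_desE n.+1 S)]. Qed.

Lemma cdes_comp_of_des n (S : pred nat) :
  cdes (comp_of_des n S) = [seq i <- iota 1 n.-1 | S i].
Proof. by case: n => [|n]; [rewrite /cdes /comp_of_des mkcompK | case: (@comp_of_desE n.+1 S)]. Qed.

Lemma cdes_sorted a : sorted ltn (cdes a).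
Proof.
have [a0|a0] := eqVneq (val a) [::]; first by rewrite /cdes a0.
have := scanl_path 0 (valP a); rewrite scanl_cdes // rcons_path.
by case/andP => /path_sorted.
Qed.

Lemma mem_cdes a i : i \in cdes a -> 0 < i < cdeg a.
Proof.
have [a0|a0] := eqVneq (val a) [::]; first by rewrite /cdes a0.
have := scanl_path 0 (valP a); rewrite scanl_cdes //.
rewrite -[path _ _ _]/(sorted ltn (0 :: _)) (sorted_pairwise ltn_trans) /= pairwise_rcons all_rcons.
by move=> /and3P[/andP[_ /allP p1] /allP p2 _] ia; rewrite p1 // p2.
Qed.

Lemma comp_of_desK a : comp_of_des (cdeg a) (mem (cdes a)) = a.
Proof.
apply: cdes_cdeg_inj; rewrite ?cdeg_comp_of_des ?cdes_comp_of_des //.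
apply: (irr_sorted_eq ltn_trans ltnn); rewrite ?cdes_sorted //.
  by apply: sorted_filter (iota_ltn_sorted _ _); exact: ltn_trans.
move=> i; rewrite mem_filter mem_iota /=; case: (boolP (i \in _)) => //= /mem_cdes.
by case: (cdeg a) => [|n]; rewrite ?ltn0 ?andbF.
Qed.

Lemma mem_comps n a : (a \in comps n) = (cdeg a == n).
Proof.
apply/mapP/eqP => [[D _ ->]|an]; first exact: cdeg_comp_of_des.
exists [set j : 'I_n.-1 | j.+1 \in cdes a]; first by rewrite mem_enum.
rewrite -[LHS]comp_of_desK an.
apply: cdes_cdeg_inj; rewrite ?cdeg_comp_of_des ?cdes_comp_of_des //.
apply: eq_in_filter => i; rewrite mem_iota => /andP[i0 iN] /=.
apply/idP/existsP => [ia|[j]]; last by rewrite inE => /andP[ja /eqP->].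
have iN' : i.-1 < n.-1 by case: (i) i0 iN => //= j _; rewrite add1n ltnS.
by exists (Ordinal iN'); rewrite inE /= prednK // ia /=.
Qed.

Lemma comps_uniq n : uniq (comps n).
Proof.
rewrite map_inj_uniq ?enum_uniq // => D D' /(congr1 cdes).
rewrite !cdes_comp_of_des => eD; apply/setP => j.
have : (j.+1 \in [seq i <- iota 1 n.-1 | [exists j in D, i == (val j).+1]])
     = (j.+1 \in [seq i <- iota 1 n.-1 | [exists j in D', i == (val j).+1]]).
  by rewrite -eD.
rewrite !mem_filter !mem_iota !add1n !ltnS !ltn_ord !andbT.
have H (E : {set 'I_n.-1}) : [exists j0 in E, j.+1 == (val j0).+1] = (j \in E).
  apply/existsP/idP => [[i /andP[iE /eqP[/val_inj->]]]//|jE].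
  by exists j; rewrite jE /=.
by rewrite /= !H.
Qed.

End CompositionTheory.

Section Permutations.
Local Open Scope nat_scope.

Definition perms := {n : nat & 'S_n}.
HB.instance Definition _ := Choice.on perms.
Implicit Types (w : perms) (u : seq nat).

Definition mkperms n (s : 'S_n) : perms := Tagged (fun n => 'S_n) s.

(* Permutations act on 'I_n = {0, .., n-1}, so that the letters of the words *)
(* below are those of the literature shifted by -1.                           *)
Definition word w : seq nat := [seq val (tagged w i) | i <- enum 'I_(tag w)].

Definition st_fun u (i : 'I_(size u)) : nat :=
  #|[set j : 'I_(size u) | (nth 0 u j < nth 0 u i) ||
                           ((nth 0 u j == nth 0 u i) && (j < i))]|.

Lemma st_fun_lt u (i : 'I_(size u)) : (st_fun i < size u).
Proof.
rewrite -[X in (_ < X)]card_ord -cardsT; apply: proper_card.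
by rewrite properT; apply/eqP => /setP/(_ i); rewrite !inE !ltnn andbF.
Qed.

Lemma st_fun_mono u (i j : 'I_(size u)) : (st_fun i < st_fun j) =
  (nth 0 u i < nth 0 u j) || ((nth 0 u i == nth 0 u j) && (i < j)).
Proof.
have inc (a b : 'I_(size u)) :
    (nth 0 u a < nth 0 u b) || ((nth 0 u a == nth 0 u b) && (a < b)) ->
    (st_fun a < st_fun b).
  move=> ab; apply: proper_card; apply/properP; split; last first.
    by exists a; rewrite !inE ?ab // !ltnn andbF.
  apply/subsetP => c; rewrite !inE; move: ab.
  case: (ltngtP (nth 0 u a) (nth 0 u b)) => //= [ab _|ab ltab].
    by case: ltngtP => //= [ca|ca]; rewrite ?ca ?ab // (ltn_trans ca ab).
  by rewrite ab; case: ltngtP => //= _ ca; exact: ltn_trans ca ltab.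
have [/inc ->//|nij] := boolP (_ || _).
apply/negbTE; rewrite -leqNgt.
have [->//|nij'] := eqVneq i j.
apply/ltnW/inc; move: nij; case: ltngtP => //= _.
by rewrite -leqNgt leq_eqVlt => /orP[/eqP/val_inj/esym/eqP|//]; rewrite (negbTE nij').
Qed.

Lemma st_inj u : injective (fun i : 'I_(size u) => Ordinal (st_fun_lt i)).
Proof.
move=> i j [] eij.
have := st_fun_mono i j; have := st_fun_mono j i; rewrite eij ltnn.
by case: ltngtP => //= _; case: ltngtP => // ij _ _; apply: val_inj.
Qed.

Definition st u : perms := mkperms (perm (@st_inj u)).

(* The number of inversions of w.                                            *)
Definition plen w : nat :=
  #|[set p : 'I_(tag w) * 'I_(tag w) |
       (p.1 < p.2) && (tagged w p.2 < tagged w p.1)]|.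

Definition pinv w : perms := mkperms (tagged w)^-1%g.

Definition pcomp w : comp :=
  comp_of_des (tag w) (fun i => nth 0 (word w) i < nth 0 (word w) i.-1).

(* inv(i, w): with letters starting at 0, {1, .., i} becomes {0, .., i-1}.     *)
Definition inv_below (i : nat) w : nat :=
  #|[set p : 'I_(tag w) * 'I_(tag w) |
       [&& p.2 < p.1, tagged w p.1 < i & i <= tagged w p.2]]|.

End Permutations.

Section WordTheory.
Local Open Scope nat_scope.
Implicit Types (w : perms) (u : seq nat).

Lemma size_word w : size (word w) = tag w.
Proof. by rewrite size_map size_enum_ord. Qed.

Lemma nth_word w (i : 'I_(tag w)) : nth 0 (word w) i = tagged w i.
Proof. by rewrite (nth_map i) ?size_enum_ord // nth_ord_enum. Qed.

Lemma word_inj : injective word.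
Proof.
move=> [n s] [m t] eW; have eN : n = m by have := congr1 size eW; rewrite !size_word.
case: m / eN t eW => t eW; congr Tagged; apply/permP => i; apply: val_inj.
by have := congr1 (nth 0 ^~ i) eW; rewrite (nth_word (w := mkperms s)) (nth_word (w := mkperms t)).
Qed.

Lemma word_st u : perm_eq u (iota 0 (size u)) -> word (st u) = u.
Proof.
move=> pu; apply: (@eq_from_nth _ 0); rewrite size_word //= => i iu.
rewrite (nth_word (w := st u) (Ordinal iu)) permE /= /st_fun.
have uu : uniq u by rewrite (perm_uniq pu) iota_uniq.
have ltu : nth 0 u i < size u.
  by have := mem_nth 0 iu; rewrite (perm_mem pu) mem_iota.
transitivity (count (fun x => x < nth 0 u i) u); last first.
  rewrite (seq.permP pu) -[X in iota 0 X](subnKC (ltnW ltu)) iotaD count_cat.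
  rewrite [X in _ + X](_ : _ = 0) ?addn0; last first.
    apply/eqP; rewrite -leqn0 leqNgt -has_count; apply/hasPn => x.
    by rewrite mem_iota -leqNgt => /andP[].
  rewrite -[RHS](size_iota 0); apply/eqP; rewrite -all_count; apply/allP => x.
  by rewrite mem_iota.
rewrite -[u in RHS](mkseq_nth 0) count_map -[iota 0 _]val_enum_ord count_map.
rewrite -sum1_card -sum1_count big_enum_cond; apply: eq_bigl => j.
rewrite !inE /= nth_mkseq //; case: ltngtP => //= /eqP.
by rewrite nth_uniq // => /eqP->; rewrite ltnn.
Qed.

Lemma st_word w : st (word w) = w.
Proof.
apply: word_inj; apply: word_st; rewrite size_word.
apply: uniq_perm; rewrite ?iota_uniq //.
  by rewrite map_inj_uniq ?enum_uniq // => i j /val_inj/perm_inj.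
move=> x; rewrite mem_iota /= add0n; apply/mapP/idP => [[i _ ->]|xw].
  exact: ltn_ord.
by exists ((tagged w)^-1%g (Ordinal xw)); rewrite ?mem_enum // permKV.
Qed.
End WordTheory.

Section MalvenutoReutenauer.
Variables (k : comPzRingType) (q : k).
Implicit Types (w : perms) (u v : seq nat).

(* The concatenation u ++ v below is a word without repeated letters, i.e. a *)
(* permutation, of which it is the standardization; see st_word.             *)
Definition mr_mul w w' : fmod k perms :=
  let n := tag w in let m := tag w' in
  \sum_(u : n.-tuple 'I_(n + m)) \sum_(v : m.-tuple 'I_(n + m) |
      [&& [forall x, (x \in u) || (x \in v)],
          st (map val u) == w & st (map val v) == w'])
    fbas (st (map val u ++ map val v)).

Definition mr_cop w : fmod k (perms * perms)%type :=
  \sum_(i < (tag w).+1) q ^+ inv_below i w *: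
    fbas (st [seq x <- word w | (x < i)%N], st [seq x <- word w | (i <= x)%N]).

Definition lcons (a : nat) : fmod k (seq nat) -> fmod k (seq nat) :=
  lift (fun u => fbas (a :: u)).

Fixpoint qshuffle u : seq nat -> fmod k (seq nat) :=
  fix qshuffle_u v :=
    match u, v with
    | [::], _ => fbas v
    | _, [::] => fbas u
    | a :: u', b :: v' =>
        lcons a (qshuffle u' v) + q ^+ size u *: lcons b (qshuffle_u v')
    end.

Definition mr'_mul w w' : fmod k perms :=
  lift (fun u => fbas (st u))
    (qshuffle (word w) [seq (tag w + x)%N | x <- word w']).

Definition mr'_cop w : fmod k (perms * perms)%type :=
  \sum_(i < (tag w).+1) fbas (st (take i (word w)), st (drop i (word w))).

Definition MR : hopf_data k :=
  @HopfData k perms (fun w => tag w) (fbas (st [::])) mr_mul mr_cop.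

Definition MR' : hopf_data k :=
  @HopfData k perms (fun w => tag w) (fbas (st [::])) mr'_mul mr'_cop.

Definition theta : hd_mod MR -> hd_mod MR' :=
  lift (fun w => q ^+ plen w *: fbas (pinv w)).

End MalvenutoReutenauer.

(* Formal power series in the noncommuting variables x_1, x_2, ..; the word  *)
(* i1 i2 .. of natural numbers stands for the monomial x_(i1+1) x_(i2+1) ..  *)
Section QuantumSeries.
Variables (k : comPzRingType) (q : k).
Implicit Types (f g : seq nat -> k) (w : seq nat).

Definition ncmul f g w : k :=
  \sum_(i < (size w).+1) f (take i w) * g (drop i w).

Definition ncrel (i j : nat) w : k :=
  (w == [:: i; j])%:R - q * (w == [:: j; i])%:R.

Definition in_ideal f : Prop :=
  exists s : seq ((seq nat -> k) * (nat * nat) * (seq nat -> k)),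
    all (fun t => t.1.2.2 < t.1.2.1)%N s /\
    forall w, f w =
      \sum_(t <- s) ncmul (ncmul t.1.1 (ncrel t.1.2.1 t.1.2.2)) t.2 w.

(* A_q is the quotient by the closure of that ideal: the product of two M's  *)
(* needs infinitely many relations to be brought back to a sum of M's.        *)
Definition Aq_eq f g : Prop := forall W : seq (seq nat),
  exists h, in_ideal h /\ {in W, forall w, f w - g w = h w}.

Definition Mseries (a : comp) w : k :=
  (sorted leq w && ([seq count_mem i w | i <- undup w] == val a))%:R.

Definition hseries (n : nat) w : k := (sorted leq w && (size w == n))%:R.

(* Modulo the relations, x_w = q^(winv w) x_(sort w).                         *)
Fixpoint winv w : nat :=
  if w is a :: w' then (count (fun b => b < a) w' + winv w')%N else 0%N.

Definition nform f (w : seq nat) : k :=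
  \sum_(v <- permutations w) q ^+ winv v * f v.

Definition rle (c s : seq nat) : seq nat :=
  flatten [seq nseq p.1 p.2 | p <- zip c s].

(* The word x_1^(a_1) x_2^(a_2) ..                                            *)
Definition packed (a : comp) : seq nat :=
  rle (val a) (iota 0 (size (val a))).

(* QSym_q, on its basis M. The coefficient of M_c in an element of QSym_q is *)
(* that of packed c in its normally ordered form; see qs_eval_inj and         *)
(* qs_evalM for the fact that this is a subalgebra of A_q.                    *)
Definition qs_mul (a b : comp) : fmod k comp :=
  \sum_(c <- comps (cdeg a + cdeg b))
     nform (ncmul (Mseries a) (Mseries b)) (packed c) *: fbas c.

Definition qs_cop (a : comp) : fmod k (comp * comp)%type :=
  \sum_(i < (size (val a)).+1)
     fbas (mkcomp (take i (val a)), mkcomp (drop i (val a))).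

Definition QSym : hopf_data k :=
  @HopfData k comp cdeg (fbas (mkcomp [::])) qs_mul qs_cop.

Definition qs_eval (x : fmod k comp) w : k :=
  \sum_(a <- msupp x) x@_a * Mseries a w.

Definition qs_F (a : comp) : hd_mod QSym :=
  \sum_(b <- comps (cdeg a) | crefines a b) fbas b.

Definition qs_h (n : nat) : hd_mod QSym := \sum_(a <- comps n) fbas a.

Definition ns_H (n : nat) : comp := mkcomp (if n == 0%N then [::] else [:: n]).

(* On the basis H, the free algebra on the H_n is the algebra of the monoid  *)
(* of compositions; its coproduct is the multiplicative extension, for the   *)
(* twisted product, of H_n |-> sum_i H_i (x) H_(n-i).                         *)
Definition NSym_alg (cop : comp -> fmod k (comp * comp)%type) : hopf_data k :=
  @HopfData k comp cdeg (fbas (mkcomp [::])) (fun a b => fbas (ccat a b)) cop.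

Definition ns_cop (a : comp) : fmod k (comp * comp)%type :=
  foldr (fun n z => tmul q (H := NSym_alg (fun=> 0))
           (\sum_(i < n.+1) fbas (ns_H i, ns_H (n - i))) z)
    (fbas (mkcomp [::], mkcomp [::])) (val a).

Definition NSym : hopf_data k := NSym_alg ns_cop.

(* The algebra homomorphism NSym -> QSym_q mapping H_n to h_n.                *)
Definition forgetful : hd_mod NSym -> hd_mod QSym :=
  lift (fun a : comp =>
    foldr (fun n x => hmul (qs_h n) x) (hd_one QSym) (val a)).

Definition qs_ns_pairing : hd_mod QSym -> hd_mod NSym -> k :=
  pairing (fun a b : comp => (a == b)%:R).

Definition mr_form (w w' : perms) : k := (w == w')%:R.

Definition mr_pairing : hd_mod (MR' q) -> hd_mod (MR q) -> k :=
  pairing mr_form.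

Definition pi' : hd_mod (MR' q) -> hd_mod QSym := 
  lift (fun s : perms => qs_F (pcomp s)).

Definition D_below (a : comp) : hd_mod (MR q) :=
  \sum_(s : 'S_(cdeg a) | crefines (pcomp (mkperms s)) a) fbas (mkperms s).

Definition iota_q : hd_mod NSym -> hd_mod (MR q) := lift D_below.

End QuantumSeries.

Arguments theta {k} q x.
Arguments pi' {k} q x.
Arguments iota_q {k} q x.
Arguments forgetful {k} q x.
Arguments qs_ns_pairing {k} q x y.
Arguments mr_pairing {k} q x y.

Section RunLengths.
Local Open Scope nat_scope.
Implicit Types (w s : seq nat) (a : comp).

Lemma size_rle c s : size c = size s -> size (rle c s) = sumn c.
Proof.
rewrite /rle; elim: c s => [|n c IH] [|i s] //= [/IH]; rewrite size_cat size_nseq.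
by move=> ->.
Qed.

Lemma rle_sub c s : {subset rle c s <= s}.
Proof.
rewrite /rle; elim: c s => [|n c IH] [|j s] //= i.
by rewrite mem_cat mem_nseq inE => /orP[/andP[_ ->]|/IH->]; rewrite ?orbT.
Qed.

Lemma rle_map (f : nat -> nat) s :
  rle (map f s) s = flatten [seq nseq (f i) i | i <- s].
Proof. by rewrite /rle; congr flatten; elim: s => //= i s ->. Qed.

Lemma count_rle (f : nat -> nat) s i : uniq s ->
  count_mem i (rle (map f s) s) = if i \in s then f i else 0.
Proof.
rewrite rle_map; elim: s => //= j s IH /andP[js us].
rewrite count_cat count_nseq IH // in_cons /= (eq_sym j).
by case: (eqVneq i j) => [->|_] /=; rewrite ?(negbTE js) ?mul1n ?addn0.
Qed.

Lemma mem_rle (f : nat -> nat) s i : (i \in rle (map f s) s) = (i \in s) && (0 < f i).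
Proof.
rewrite rle_map; elim: s => //= j s IH; rewrite mem_cat mem_nseq IH inE.
by case: (eqVneq i j) => [->|_]; rewrite ?andbT ?andbF //=; case: (0 < f j); rewrite ?andbF.
Qed.

Lemma sorted_rle (f : nat -> nat) s : sorted ltn s -> sorted leq (rle (map f s) s).
Proof.
rewrite rle_map (sorted_pairwise leq_trans) (sorted_pairwise ltn_trans).
elim: s => //= j s IH /andP[/allP js /IH ps]; rewrite pairwise_cat ps andbT.
apply/andP; split; last first.
  by elim: (f j) => //= n ->; rewrite andbT; apply/allP => x /nseqP[->].
apply/allrelP => x y /nseqP[-> _]; rewrite -rle_map mem_rle => /andP[/js/ltnW].
by [].
Qed.

Lemma sorted_undup_ltn w : sorted leq w -> sorted ltn (undup w).
Proof.
move=> sw; rewrite ltn_sorted_uniq_leq undup_uniq /=.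
by apply: (subseq_sorted leq_trans (undup_subseq w)).
Qed.

Lemma rle_undup w : sorted leq w ->
  rle [seq count_mem i w | i <- undup w] (undup w) = w.
Proof.
move=> sw; apply: (sorted_eq leq_trans anti_leq) => //.
  exact/sorted_rle/sorted_undup_ltn.
apply/allP => i _ /=; rewrite (count_rle (fun i => count_mem i w)) ?undup_uniq //.
rewrite mem_undup; case: ifPn => // /count_memPn ->; exact: eqxx.
Qed.

Lemma undup_rle (f : nat -> nat) s : sorted ltn s -> all (fun i => 0 < f i) s ->
  undup (rle (map f s) s) = s.
Proof.
move=> ss /allP fs; apply: (irr_sorted_eq ltn_trans ltnn) => //.
  exact/sorted_undup_ltn/sorted_rle.
by move=> i; rewrite mem_undup mem_rle; case: (boolP (i \in s)) => //= /fs.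
Qed.

(* Mseries a is the sum of the x_(i_1)^(a_1) .. x_(i_r)^(a_r), i_1 < .. < i_r *)
Lemma monomialP a w :
  reflect (exists s, [/\ sorted ltn s, size s = size (val a) & w = rle (val a) s])
          (sorted leq w && ([seq count_mem i w | i <- undup w] == val a)).
Proof.
apply: (iffP andP) => [[sw /eqP aw]|[s [ss sa ->]]].
  by exists (undup w); rewrite sorted_undup_ltn // -aw size_map rle_undup.
pose f i := nth 0 (val a) (index i s).
have us : uniq s by rewrite (sorted_uniq ltn_trans ltnn).
have fE : val a = map f s.
  apply: (@eq_from_nth _ 0); rewrite ?size_map // => i ia.
  by rewrite (nth_map 0) ?sa // /f index_uniq ?sa.
have fs : all (fun i => 0 < f i) s.
  apply/allP => i si; apply: (allP (valP a)); rewrite mem_nth //.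
  by rewrite -sa index_mem.
rewrite fE sorted_rle // undup_rle //; split=> //; apply/eqP/eq_in_map => i si.
by rewrite count_rle // si.
Qed.

Lemma rle_counts_pos w : all (leq 1) [seq count_mem i w | i <- undup w].
Proof.
by apply/allP => c /mapP[i]; rewrite mem_undup => iw ->; rewrite -has_count has_pred1.
Qed.

Definition content w : comp := mkcomp [seq count_mem i w | i <- undup w].

Lemma val_content w : val (content w) = [seq count_mem i w | i <- undup w].
Proof. exact/mkcompK/rle_counts_pos. Qed.

Lemma cdeg_content w : sorted leq w -> cdeg (content w) = size w.
Proof.
by move=> sw; rewrite -[in RHS](rle_undup sw) size_rle ?size_map // /cdeg val_content.
Qed.

Lemma rle_packed a s : size s = size (val a) ->
  rle (val a) s = map (nth 0 s) (packed a).
Proof.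
move=> sa; rewrite /packed -sa map_flatten -map_comp.
rewrite -{1}[s](mkseq_nth 0) /mkseq /rle; congr flatten.
elim: (val a) (iota _ _) => [|c cs IH] [|i t] //=.
by rewrite IH map_nseq.
Qed.

Lemma packed_content a : sorted leq (packed a) /\ content (packed a) = a.
Proof.
have /andP[s1 /eqP c1] :
    sorted leq (packed a) && ([seq count_mem i (packed a) | i <- undup (packed a)] == val a).
  apply/monomialP; exists (iota 0 (size (val a))).
  by rewrite iota_ltn_sorted size_iota.
by split=> //; apply: val_inj; rewrite val_content.
Qed.

(* Every sorted word is a strictly increasing relabelling of a packed one.   *)
Lemma sorted_packed w : sorted leq w ->
  exists2 phi : nat -> nat, {mono phi : i j / i < j} & w = map phi (packed (content w)).
Proof.
move=> sw; set s := undup w.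
have ss : sorted ltn s by exact: sorted_undup_ltn.
have mem_le x : x \in s -> x <= sumn s.
  elim: (s) => //= y t IH; rewrite inE => /predU1P[->|/IH xt]; first exact: leq_addr.
  exact: leq_trans xt (leq_addl _ _).
exists (fun i => nth (i + sumn s).+1 s i); last first.
  rewrite -{1}(rle_undup sw) -val_content rle_packed ?val_content ?size_map //.
  apply/eq_in_map => i /rle_sub; rewrite mem_iota val_content size_map => /andP[_ ilt].
  exact: set_nth_default.
apply/leqW_mono/leq_mono => i j ij.
case: (ltnP j (size s)) => js.
  have is_ := ltn_trans ij js.
  rewrite (set_nth_default 0) // [X in _ < X](set_nth_default 0) //.
  by rewrite (sorted_ltn_nth ltn_trans 0 ss) // inE.
rewrite [X in _ < X]nth_default // ltnS.
case: (ltnP i (size s)) => is_.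
  by apply: leq_trans (leq_addl _ _); apply: mem_le; rewrite mem_nth.
by rewrite nth_default // -addSn leq_add2r.
Qed.
End RunLengths.

Section QuantumSeriesTheory.
Variables (k : comPzRingType) (q : k).
Implicit Types (f g h : seq nat -> k) (w u v m : seq nat) (a : comp).
Local Notation nform := (nform q).

Lemma ncmulE f g w : ncmul f g w = \sum_(0 <= i < (size w).+1) f (take i w) * g (drop i w).
Proof. by rewrite big_mkord. Qed.

Lemma winv_sorted w : sorted leq w -> winv w = 0%N.
Proof.
elim: w => //= i w IH; rewrite (path_sortedE leq_trans) => /andP[iw /IH->].
rewrite addn0; apply/eqP; rewrite -leqn0 leqNgt -has_count; apply/hasPn => j jw.
by rewrite -leqNgt (allP iw).
Qed.

Lemma winv_map (phi : nat -> nat) w : {mono phi : i j / (i < j)%N} ->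
  winv (map phi w) = winv w.
Proof.
move=> mo; elim: w => //= i w ->; rewrite count_map; congr (_ + _)%N.
by apply: eq_count => j /=; rewrite mo.
Qed.

Lemma mono_leq (phi : nat -> nat) :
  {mono phi : i j / (i < j)%N} -> {mono phi : i j / (i <= j)%N}.
Proof. by move=> mo i j; rewrite leqNgt mo -leqNgt. Qed.

Lemma mono_inj_nat (phi : nat -> nat) : {mono phi : i j / (i < j)%N} -> injective phi.
Proof.
move=> /mono_leq mo i j eij; apply: anti_leq.
by rewrite -(mo i j) -(mo j i) eij leqnn.
Qed.

Lemma Mseries_map (phi : nat -> nat) a w : {mono phi : i j / (i < j)%N} ->
  Mseries k a (map phi w) = Mseries k a w.
Proof.
move=> mo; have inj := mono_inj_nat mo.
rewrite /Mseries sorted_map (eq_sorted (e' := leq)); last exact: mono_leq.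
rewrite undup_map_inj // -map_comp; congr (_ && (_ == _))%:R.
by apply: eq_map => i /=; rewrite count_map; apply: eq_count => j /=; rewrite inj_eq.
Qed.

Lemma ncmul_map (phi : nat -> nat) f g w :
  (forall v, f (map phi v) = f v) -> (forall v, g (map phi v) = g v) ->
  ncmul f g (map phi w) = ncmul f g w.
Proof.
move=> fphi gphi; rewrite !ncmulE size_map; apply: eq_bigr => i _.
by rewrite -map_take -map_drop fphi gphi.
Qed.

Lemma nform_map (phi : nat -> nat) f m : {mono phi : i j / (i < j)%N} ->
  (forall v, f (map phi v) = f v) -> nform f (map phi m) = nform f m.
Proof.
move=> mo fphi; have inj := mono_inj_nat mo.
rewrite /nform (perm_big (map (map phi) (permutations m))); last first.
  apply: uniq_perm; rewrite ?permutations_uniq //.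
    by rewrite map_inj_uniq ?permutations_uniq //; exact: inj_map.
  move=> v; rewrite mem_permutations; apply/idP/mapP => [vm|[u um ->]]; last first.
    by rewrite perm_map // -mem_permutations.
  pose u := [seq nth 0%N m (index x (map phi m)) | x <- v].
  have uv : v = map phi u.
    rewrite -map_comp -[LHS]map_id; apply/eq_in_map => x.
    rewrite (perm_mem vm) => xm /=.
    by rewrite -(nth_map 0%N 0%N) ?nth_index // -(size_map phi) index_mem.
  by exists u => //; rewrite mem_permutations; apply: (perm_map_inj inj); rewrite -uv.
by rewrite big_map; apply: eq_bigr => v _; rewrite winv_map // fphi.
Qed.

Lemma nform_perm f m m' : perm_eq m m' -> nform f m = nform f m'.
Proof.
move=> mm'; apply: perm_big; apply: uniq_perm; rewrite ?permutations_uniq // => v.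
by rewrite !mem_permutations (permPr mm').
Qed.

Lemma nform_sorted f m : sorted leq m -> (forall v, ~~ sorted leq v -> f v = 0) ->
  nform f m = f m.
Proof.
move=> sm f0; rewrite /nform (bigD1_seq m) ?permutations_uniq ?mem_permutations //=.
rewrite winv_sorted // mul1r big1_seq ?addr0 // => v /andP[vm].
rewrite mem_permutations => pv; rewrite f0 ?mulr0 //.
by apply: contra vm => sv; apply/eqP/(sorted_eq leq_trans anti_leq sv sm pv).
Qed.

Lemma nform_sum (I : Type) (r : seq I) (c : I -> k) (F : I -> seq nat -> k) f m :
  (forall v, perm_eq v m -> f v = \sum_(i <- r) c i * F i v) ->
  nform f m = \sum_(i <- r) c i * nform (F i) m.
Proof.
move=> fE; rewrite /nform.
under [RHS]eq_bigr do rewrite mulr_sumr.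
rewrite exchange_big; apply: eq_big_seq => v; rewrite mem_permutations => /fE->.
by rewrite mulr_sumr; apply: eq_bigr => i _; rewrite mulrCA.
Qed.

Definition swap_at (p : nat) w : seq nat :=
  take p w ++ (if drop p w is x :: y :: t then y :: x :: t else drop p w).

Lemma perm_swap_at p w : perm_eq (swap_at p w) w.
Proof.
rewrite -[X in perm_eq _ X](cat_take_drop p) perm_cat2l.
case: (drop p w) => [|x [|y t]] //.
exact/permPl/(perm_catCA [:: y] [:: x] t).
Qed.

Lemma swap_atK p w : swap_at p (swap_at p w) = w.
Proof.
rewrite /swap_at; case: (leqP p (size w)) => pw; last first.
  by rewrite !(take_oversize, drop_oversize, cats0) // ltnW.
rewrite take_size_cat ?size_takel // drop_size_cat ?size_takel //.
rewrite -[RHS](cat_take_drop p); congr (_ ++ _).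
by case: (drop p w) => [|x [|y t]].
Qed.

Lemma winv_cat_swap u i j v : (j < i)%N ->
  winv (u ++ [:: i, j & v]) = (winv (u ++ [:: j, i & v])).+1.
Proof.
move=> ji; elim: u => [|x u IH] /=.
  by rewrite ji (ltnNge i) (ltnW ji) /= add0n add1n addSn addnCA.
by rewrite IH !count_cat /= addnS (addnCA (i < x)%N).
Qed.

Lemma ncmul3E f g h w : ncmul (ncmul f g) h w =
  \sum_(0 <= s < (size w).+1) \sum_(0 <= p < s.+1)
     f (take p w) * g (drop p (take s w)) * h (drop s w).
Proof.
rewrite ncmulE; apply: eq_big_nat => s; rewrite ltnS => /andP[_ sw].
rewrite ncmulE size_takel // mulr_suml; apply: eq_big_nat => p.
by rewrite ltnS => /andP[_ ps]; rewrite take_takel.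
Qed.

Lemma drop_take_cat2 (p s : nat) w x y : (p <= s <= size w)%N ->
  drop p (take s w) = [:: x; y] -> w = take p w ++ [:: x, y & drop s w] /\ s = p.+2.
Proof.
move=> /andP[ps sw] E; split.
  rewrite -[LHS](cat_take_drop s) -[take s w in LHS](cat_take_drop p) E take_takel //.
  by rewrite -catA.
have := congr1 size E; rewrite size_drop size_takel //= => e.
by rewrite -(subnK ps) e.
Qed.

Lemma nform_rel f h i j m : (j < i)%N -> nform (ncmul (ncmul f (ncrel q i j)) h) m = 0.
Proof.
move=> ji; pose F (x y p s : nat) w := q ^+ winv w *
  (f (take p w) * (drop p (take s w) == [:: x; y])%:R * h (drop s w)).
have swapE p s : (p <= s <= size m)%N ->
    \sum_(w <- permutations m) F i j p s w =
    \sum_(w <- permutations m) q * F j i p s w.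
  move=> psm; rewrite (perm_big (map (swap_at p) (permutations m))); last first.
    apply: uniq_perm; rewrite ?permutations_uniq //.
      by rewrite map_inj_uniq ?permutations_uniq //; exact: can_inj (swap_atK p).
    move=> w; apply/idP/mapP => [wm|[v vm ->]].
      exists (swap_at p w); last by rewrite swap_atK.
      by move: wm; rewrite !mem_permutations; apply: perm_trans; exact: perm_swap_at.
    by move: vm; rewrite !mem_permutations; apply: perm_trans; exact: perm_swap_at.
  rewrite big_map; apply: eq_big_seq => w; rewrite mem_permutations => /perm_size wm.
  have pw : (p <= size w)%N by rewrite wm; case/andP: psm => /leq_trans; apply.
  have psw : (p <= s <= size (swap_at p w))%N by rewrite (perm_size (perm_swap_at _ _)) wm.
  have pm x y v : s = p.+2 -> w = take p w ++ [:: x, y & v] ->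
      swap_at p w = take p w ++ [:: y, x & v] /\ drop s w = v.
    move=> -> wE; have dE : drop p w = [:: x, y & v].
      by rewrite {1}wE drop_size_cat // size_takel.
    by rewrite /swap_at dE -(addn2 p) addnC -drop_drop dE /= drop0.
  have ev x y v : s = p.+2 -> drop p (take s (take p w ++ [:: x, y & v])) = [:: x; y]
                  /\ drop s (take p w ++ [:: x, y & v]) = v.
    move=> ->; rewrite take_cat drop_cat size_takel // ltnNge -addn2 leq_addr /=.
    by rewrite addKn /= drop_size_cat ?size_takel // take0 drop0.
  have tk v : take p (take p w ++ v) = take p w by rewrite take_size_cat // size_takel.
  have [E|nE] := eqVneq (drop p (take s w)) [:: j; i].
    have [wE se] : w = take p w ++ [:: j, i & drop s w] /\ s = p.+2.
      by apply: drop_take_cat2 E; rewrite wm.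
    have [sE _] := pm _ _ _ se wE; have [e1 e2] := ev i j (drop s w) se.
    rewrite /F sE e1 e2 E !eqxx tk winv_cat_swap // -wE exprS.
    by rewrite -mulrA.
  rewrite /F (negbTE nE) !mulr0 !mul0r !mulr0.
  case: eqP => [E|_]; last by rewrite !mulr0 mul0r mulr0.
  have [swE se] := drop_take_cat2 psw E.
  case/eqP: nE.
  have tks : take p (swap_at p w) = take p w by rewrite /swap_at tk.
  have : w = take p w ++ [:: j, i & drop s (swap_at p w)].
    rewrite -[LHS](swap_atK p) {1}/swap_at tks; congr (_ ++ _).
    by rewrite {1}swE drop_size_cat // tks size_takel.
  by move=> ->; case: (ev j i (drop s (swap_at p w)) se).
transitivity (\sum_(0 <= s < (size m).+1) \sum_(0 <= p < s.+1)
    \sum_(w <- permutations m) (F i j p s w - q * F j i p s w)); last first.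
  rewrite big_nat big1 // => s; rewrite ltnS => /andP[_ sm].
  rewrite big_nat big1 // => p; rewrite ltnS => /andP[_ ps].
  by rewrite sumrB swapE ?ps // subrr.
rewrite /nform; under [RHS]eq_bigr do rewrite exchange_big.
rewrite [RHS]exchange_big; apply: eq_big_seq => w; rewrite mem_permutations => /perm_size wm.
rewrite ncmul3E wm mulr_sumr; apply: eq_bigr => s _.
rewrite mulr_sumr; apply: eq_bigr => p _.
rewrite /F /ncrel mulrBr mulrBl mulrBr; congr (_ - _).
by rewrite !mulrA [q * _]mulrC; congr (_ * _); rewrite -!mulrA; congr (_ * _); rewrite mulrCA.
Qed.

Lemma ideal_nform f m : in_ideal q f -> nform f m = 0.
Proof.
case=> s [s_gt fE].
rewrite (nform_sum (r := s) (c := fun=> 1)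
  (F := fun t => ncmul (ncmul t.1.1 (ncrel q t.1.2.1 t.1.2.2)) t.2)); last first.
  by move=> v _; rewrite fE; apply: eq_bigr => t _; rewrite mul1r.
elim: s s_gt {fE} => [|t s IH] /=; first by rewrite big_nil.
by case/andP => ts /IH; rewrite big_cons => ->; rewrite nform_rel // mulr0 addr0.
Qed.

Definition word_series u w : k := (w == u)%:R.

Lemma ncmul_word u v : ncmul (word_series u) (word_series v) =1 word_series (u ++ v).
Proof.
move=> w; rewrite ncmulE /word_series.
have [->|nw] := eqVneq w (u ++ v).
  rewrite (bigD1_seq (size u)) ?iota_uniq ?mem_index_iota //=; last first.
    by rewrite size_cat ltnS leq_addr.
  rewrite take_size_cat // drop_size_cat // !eqxx mulr1 big1_seq ?addr0 // => s.
  rewrite mem_index_iota ltnS => /and3P[su _ sw]; case: eqP => [E|]; rewrite ?mul0r //.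
  by case/eqP: su; rewrite -E size_takel.
rewrite big1 // => s _; case: eqP => [E1|]; rewrite ?mul0r //.
case: eqP => [E2|]; rewrite ?mulr0 //.
by case/eqP: nw; rewrite -E1 -E2 cat_take_drop.
Qed.

Lemma in_ideal_ext f g : f =1 g -> in_ideal q f -> in_ideal q g.
Proof. by move=> fg [s [s_gt fE]]; exists s; split=> // w; rewrite -fg. Qed.

Lemma in_idealD f g : in_ideal q f -> in_ideal q g -> in_ideal q (fun w => f w + g w).
Proof.
move=> [s [sg fE]] [t [tg gE]]; exists (s ++ t).
by rewrite all_cat sg tg; split=> // w; rewrite big_cat fE gE.
Qed.

Lemma in_ideal0 : in_ideal q (fun=> 0).
Proof. by exists [::]; split=> // w; rewrite big_nil. Qed.

Lemma in_idealZ c f : in_ideal q f -> in_ideal q (fun w => c * f w).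
Proof.
move=> [s [sg fE]].
exists [seq ((fun w => c * t.1.1 w), t.1.2, t.2) | t <- s]; split.
  by rewrite all_map; apply: sub_all sg.
move=> w; rewrite big_map fE mulr_sumr; apply: eq_bigr => t _ /=.
rewrite mulr_sumr; apply: eq_bigr => i _ /=; rewrite mulrA; congr (_ * _).
by rewrite mulr_sumr; apply: eq_bigr => p _; rewrite mulrA.
Qed.

Lemma in_ideal_sum (I : eqType) (r : seq I) (F : I -> seq nat -> k) :
  (forall i, in_ideal q (F i)) -> in_ideal q (fun w => \sum_(i <- r) F i w).
Proof.
move=> idF; elim: r => [|i r IH].
  by apply: in_ideal_ext in_ideal0 => w; rewrite big_nil.
by apply: in_ideal_ext (in_idealD (idF i) IH) => w; rewrite big_cons.
Qed.

Lemma in_ideal_word u i j v : (j < i)%N ->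
  in_ideal q (fun w => word_series (u ++ [:: i, j & v]) w
                       - q * word_series (u ++ [:: j, i & v]) w).
Proof.
move=> ji; exists [:: (word_series u, (i, j), word_series v)].
rewrite /= ji; split=> // w; rewrite big_seq1 /=.
pose S x y := ncmul (ncmul (word_series u) (word_series [:: x; y])) (word_series v) w.
have SE x y : S x y = word_series (u ++ [:: x, y & v]) w.
  rewrite /S -[[:: x, y & v]]/([:: x; y] ++ v) catA -ncmul_word.
  by apply: eq_bigr => s _; rewrite ncmul_word.
rewrite -!SE /S mulr_sumr -sumrB; apply: eq_bigr => s _.
rewrite mulrA -mulrBl; congr (_ * _); rewrite mulr_sumr -sumrB.
by apply: eq_bigr => p _; rewrite mulrCA -mulrBr.
Qed.

Lemma sorted_or_descent w :
  sorted leq w \/ exists u i j v, (j < i)%N /\ w = u ++ [:: i, j & v].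
Proof.
elim: w => [|i [|j w] IH]; [by left | by left |].
case: (leqP i j) => ij; last by right; exists [::], i, j, w.
case: IH => [sw|[u [x [y [v [xy ->]]]]]]; first by left; rewrite /= ij.
by right; exists (i :: u), x, y, v.
Qed.

Lemma in_ideal_sort w :
  in_ideal q (fun v => word_series w v - q ^+ winv w * word_series (sort leq w) v).
Proof.
move: {2}(winv w) (erefl (winv w)) => n; elim: n w => [|n IH] w wn;
    case: (sorted_or_descent w) => [sw|[u [i [j [v [ji wE]]]]]].
- apply: in_ideal_ext in_ideal0 => x.
  by rewrite wn mul1r (sorted_sort leq_trans) // subrr.
- by move: wn; rewrite wE winv_cat_swap.
- by rewrite winv_sorted in wn.
set w' := u ++ [:: j, i & v].
have wn' : winv w = (winv w').+1 by rewrite wE winv_cat_swap.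
have sE : sort leq w = sort leq w'.
  apply/(perm_sortP leq_total leq_trans anti_leq).
  by rewrite wE perm_cat2l; exact/permPl/(perm_catCA [:: i] [:: j] v).
have := in_idealD (in_ideal_word u v ji) (in_idealZ q (IH w' (_ : winv w' = n))).
rewrite -wE -/w' => H; apply: in_ideal_ext (H _); last by move: wn; rewrite wn' => -[].
by move=> x; rewrite sE wn' exprS mulrBr addrA subrK mulrA.
Qed.

(* Two series agree in A_q iff they have the same normally ordered form.     *)
Lemma Aq_eqP f g :
  Aq_eq q f g <-> (forall m, sorted leq m -> nform f m = nform g m).
Proof.
have nformB (x y : seq nat -> k) m : nform (fun w => x w - y w) m = nform x m - nform y m.
  by rewrite /nform -sumrB; apply: eq_bigr => v _; rewrite mulrBr.
split=> [fg m _|fg W].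
  have [h [hI hE]] := fg (permutations m).
  apply/eqP; rewrite -subr_eq0 -nformB -(ideal_nform m hI); apply/eqP.
  by apply: eq_big_seq => v /hE->.
pose W' := undup (flatten [seq permutations w | w <- W]).
pose d w := f w - g w.
exists (fun v => \sum_(w <- W') d w * (word_series w v - q ^+ winv w * word_series (sort leq w) v)).
split; first by apply: in_ideal_sum => w; exact/in_idealZ/in_ideal_sort.
move=> v vW; rewrite -/(d v).
have W'v u : perm_eq u v -> u \in W'.
  move=> uv; rewrite mem_undup; apply/flattenP; exists (permutations v).
    exact: map_f.
  by rewrite mem_permutations.
under eq_bigr do rewrite mulrBr.
rewrite sumrB [X in _ = X - _](bigD1_seq v) ?undup_uniq ?W'v //=.
rewrite /word_series eqxx mulr1 big1 ?addr0; last first.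
  by move=> w /negbTE; rewrite eq_sym => ->; rewrite mulr0.
have [vs|nvs] := eqVneq v (sort leq v); last first.
  rewrite big1 ?subr0 // => w _; case: eqP => [vw|]; rewrite ?mulr0 //.
  by case/eqP: nvs; rewrite vw [RHS](sorted_sort leq_trans) ?(sort_sorted leq_total).
have sv : sorted leq v by rewrite vs (sort_sorted leq_total).
have nd0 : nform d v = 0 by rewrite nformB fg // subrr.
rewrite [X in _ = _ - X](_ : _ = 0) ?subr0 //.
rewrite (bigID (fun w => w \in permutations v)) /= [X in _ + X]big1 ?addr0; last first.
  move=> w; rewrite mem_permutations => nwv; case: eqP => [vw|]; rewrite ?mulr0 //.
  by case/negP: nwv; rewrite vw perm_sym perm_sort.
rewrite -big_filter (perm_big (permutations v)); last first.
  apply: uniq_perm; rewrite ?filter_uniq ?undup_uniq ?permutations_uniq //.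
  by move=> w; rewrite mem_filter andb_idr // mem_permutations => /W'v.
rewrite -[RHS]nd0 /nform; apply: eq_big_seq => w; rewrite mem_permutations => wv.
have -> : sort leq w = v.
  by rewrite [RHS]vs; apply/(perm_sortP leq_total leq_trans anti_leq).
by rewrite eqxx mulr1 mulrC.
Qed.


Lemma qs_eval_wide (d : {fset comp}) (x : fmod k comp) w : {subset msupp x <= d} ->
  qs_eval x w = \sum_(a <- d) x@_a * Mseries k a w.
Proof.
move=> /fsubsetP sub; apply: big_fset_incl => // a _ /mcoeff_outdom ->.
exact: mul0r.
Qed.

Lemma Mseries_content a w : sorted leq w -> Mseries k a w = (a == content w)%:R.
Proof. by move=> sw; rewrite /Mseries sw -val_content eq_sym. Qed.

Lemma Mseries_unsorted a w : ~~ sorted leq w -> Mseries k a w = 0.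
Proof. by rewrite /Mseries => /negbTE->. Qed.

Lemma qs_eval_sorted (x : fmod k comp) w : sorted leq w -> qs_eval x w = x@_(content w).
Proof.
move=> sw; rewrite (qs_eval_wide (d := (msupp x `|` [fset content w])%fset)); last first.
  by move=> a ax; rewrite !inE ax.
rewrite (big_fsetD1 (content w)) ?inE ?eqxx ?orbT //= Mseries_content // eqxx mulr1.
rewrite big1_seq ?addr0 // => a; rewrite !inE => /and3P[_ aw _].
by rewrite Mseries_content // (negbTE aw) mulr0.
Qed.

Lemma nform_qs_eval (x : fmod k comp) m : sorted leq m -> nform (qs_eval x) m = x@_(content m).
Proof.
move=> sm; rewrite nform_sorted ?qs_eval_sorted // => v nsv.
by rewrite /qs_eval big1_seq // => a _; rewrite Mseries_unsorted // mulr0.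
Qed.

(* QSym_q embeds in A_q ... *)
Lemma qs_eval_inj (x y : fmod k comp) : Aq_eq q (qs_eval x) (qs_eval y) -> x = y.
Proof.
move/Aq_eqP => xy; apply/malgP => a; have [sa <-] := packed_content a.
by rewrite -!nform_qs_eval // xy.
Qed.

Lemma nform_MM a b m : sorted leq m ->
  nform (ncmul (Mseries k a) (Mseries k b)) m = (qs_mul q a b)@_(content m).
Proof.
move=> sm; rewrite /qs_mul fcoef_sum.
have nE : nform (ncmul (Mseries k a) (Mseries k b)) m =
          nform (ncmul (Mseries k a) (Mseries k b)) (packed (content m)).
  have [phi mo mE] := sorted_packed sm.
  by rewrite {1}mE nform_map // => v; apply: ncmul_map => u; exact: Mseries_map.
rewrite nE; have [nm|nm] := boolP (content m \in comps (cdeg a + cdeg b)).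
  rewrite (bigD1_seq (content m)) ?comps_uniq //= fcoefZ fcoefU eqxx mulr1.
  by rewrite big1 ?addr0 // => c /negbTE cm; rewrite fcoefZ fcoefU cm mulr0.
rewrite [RHS]big1_seq; last first.
  move=> c /= cab; rewrite fcoefZ fcoefU; case: eqP => [cm|]; rewrite ?mulr0 //.
  by rewrite -cm cab in nm.
rewrite -nE /nform big1_seq // => w; rewrite mem_permutations => /= wm.
rewrite ncmulE big1_seq ?mulr0 // => i; rewrite mem_index_iota ltnS => /= iw.
have [s1|/Mseries_unsorted->] := boolP (sorted leq (take i w)); last by rewrite mul0r.
have [s2|/Mseries_unsorted->] := boolP (sorted leq (drop i w)); last by rewrite mulr0.
rewrite !Mseries_content //; case: eqP => [aE|]; rewrite ?mul0r //.
case: eqP => [bE|]; rewrite ?mulr0 //; case/negP: nm.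
rewrite mem_comps cdeg_content // aE bE !cdeg_content //.
by rewrite -(perm_size wm) -size_cat cat_take_drop.
Qed.

(* ... and its product is that of A_q.                                        *)
Lemma qs_evalM (x y : hd_mod (QSym q)) :
  Aq_eq q (qs_eval (hmul x y)) (ncmul (qs_eval x) (qs_eval y)).
Proof.
apply/Aq_eqP => m sm; rewrite nform_qs_eval //.
rewrite [RHS](nform_sum (r := msupp x) (c := fun a => x@_a)
    (F := fun a => ncmul (Mseries k a) (qs_eval y))); last first.
  move=> v _; rewrite /ncmul; under [RHS]eq_bigr do rewrite mulr_sumr.
  rewrite [RHS]exchange_big; apply: eq_bigr => i _.
  by rewrite /qs_eval mulr_suml; apply: eq_bigr => a _; rewrite mulrA.
rewrite /hmul /blift /lift fcoef_sum; apply: eq_bigr => a _; rewrite fcoefZ; congr (_ * _).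
rewrite [RHS](nform_sum (r := msupp y) (c := fun b => y@_b)
    (F := fun b => ncmul (Mseries k a) (Mseries k b))); last first.
  move=> v _; rewrite /ncmul; under [RHS]eq_bigr do rewrite mulr_sumr.
  rewrite [RHS]exchange_big; apply: eq_bigr => i _.
  by rewrite /qs_eval mulr_sumr; apply: eq_bigr => b _; rewrite mulrCA.
by rewrite fcoef_sum; apply: eq_bigr => b _; rewrite fcoefZ nform_MM.
Qed.

Lemma qs_eval_h n : qs_eval (qs_h q n) =1 hseries k n.
Proof.
move=> w; rewrite /hseries; have [sw|nsw] := boolP (sorted leq w); last first.
  by rewrite /qs_eval big1_seq // => a _; rewrite Mseries_unsorted // mulr0.
rewrite qs_eval_sorted // /qs_h fcoef_sum -(cdeg_content sw) -mem_comps.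
under eq_bigr do rewrite fcoefU.
have [nw|nw] := boolP (_ \in _).
  rewrite (bigD1_seq (content w)) ?comps_uniq //= eqxx big1 ?addr0 //.
  by move=> a /negbTE->.
rewrite big1_seq // => a /= an; case: eqP => [aw|//].
by rewrite -aw an in nw.
Qed.

End QuantumSeriesTheory.

(* Main.v *)
Require Import Defs.
From mathcomp Require Import all_boot all_algebra.
From HB Require Import structures.
From mathcomp Require Import all_fingroup finmap.
From mathcomp.multinomials Require Import monalg.
Import Defs.

(** MR' is the shuffle algebra of words, standardized. On words with letters of
    degree one, the recursion defining the q-shuffle gives associativity
    (qshuffleA) and the compatibility of shuffling with deconcatenation
    (hcop_qshuffle): a letter of the second word that moves into the prefix passes
    all the letters of the first word left in the suffix, which is the twist of the
    tensor square. Standardization only remembers the relative order of letters, so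
    it carries both facts over to permutations (mr'_qhopf).

    The structure constants of MR are those of MR', transposed (mr'_mul_coef,
    mr_mul_coef): a permutation is a shuffle of w and of the shifted w' in at most
    one way, with w its small letters and w' its large ones, and the weight
    q^inv counts the large letters which precede small ones; similarly u v is cut
    into u and v in one way. This is the graded duality.

    Inverting a permutation exchanges letters and positions, hence restriction to
    an interval of letters and factors of the word, and the inversions of w are
    those inside the two parts of a cut together with those counted by inv(i, w)
    (plen_split). So theta respects coproducts; as theta is self-adjoint, it
    respects products by duality. For q invertible it is bijective, and the axioms
    of MR follow from those of MR' by transport (transport_qhopf).

    The series F_c(w) enumerates the P-partitions for w, the words v which weakly
    increase, strictly where w descends; equivalently, the pairs (v_i, w_i)
    increase lexicographically. The product F_c(w) F_c(w') enumerates pairs of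
    P-partitions; sorting their concatenation, with equal values taken first from
    the first one, merges w and w' into a word of their shuffle, and the power of q
    by which the monomial is multiplied in A_q is the weight of that shuffle
    (lexpath_shuffle). Cutting P-partitions gives the compatibility with coproducts.

    Finally iota is the transpose of pi', both being given by the relation that a
    refines c(w). Surjectivity of pi' is a triangularity argument and makes iota
    injective. The same cutting of P-partitions shows that iota respects products;
    for coproducts it then suffices to look at the generators H_n, whose images are
    the identity permutations. On H_n, the composite of iota, theta and pi' is
    F_(n) = h_n, so it is the forgetful map. *)

Set Implicit Arguments.
Unset Strict Implicit.
Unset Printing Implicit Defensive.

Import GRing.Theory.
Local Open Scope ring_scope.

(** * Linear algebra on free modules *)

Section Linearity.
Variables (k : comPzRingType).
Implicit Types (B C D : choiceType) (U V W : lmodType k).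

Lemma coefP B (x y : fmod k B) : (forall b, x@_b = y@_b) -> x = y.
Proof. by move=> xy; apply/malgP. Qed.

Lemma lin0 U V (f : U -> V) : linear f -> f 0 = 0.
Proof. by move=> lf; have := lf (-1) 0 0; rewrite scaler0 addr0 scaleN1r addNr. Qed.

Lemma linZ U V (f : U -> V) c x : linear f -> f (c *: x) = c *: f x.
Proof. by move=> lf; have := lf c x 0; rewrite (lin0 lf) !addr0. Qed.

Lemma linD U V (f : U -> V) x y : linear f -> f (x + y) = f x + f y.
Proof. by move=> lf; have := lf 1 x y; rewrite !scale1r. Qed.

Lemma lin_sum U V (f : U -> V) (I : Type) (r : seq I) (P : pred I) F :
  linear f -> f (\sum_(i <- r | P i) F i) = \sum_(i <- r | P i) f (F i).
Proof.
move=> lf; apply: (big_morph f); last exact: lin0.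
by move=> x y; apply: linD.
Qed.

Lemma lin_id U : linear (fun x : U => x).
Proof. by []. Qed.

Lemma lin_const0 U V : linear (fun _ : U => 0 : V).
Proof. by move=> c x y; rewrite scaler0 addr0. Qed.

Lemma lin_add U V (f g : U -> V) : linear f -> linear g -> linear (fun x => f x + g x).
Proof. by move=> lf lg c x y; rewrite lf lg scalerDr addrACA. Qed.

Lemma lin_scale U V c (f : U -> V) : linear f -> linear (fun x => c *: f x).
Proof. by move=> lf d x y; rewrite lf scalerDr !scalerA mulrC. Qed.

Lemma lin_scalel U V (f : U -> k) (v : V) :
  linear (f : U -> k^o) -> linear (fun x => f x *: v).
Proof. by move=> lf d x y; rewrite lf scalerDl scalerA. Qed.

Lemma lin_mulr U (f : U -> k) c :
  linear (f : U -> k^o) -> linear ((fun x => f x * c) : U -> k^o).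
Proof. exact: (@lin_scalel U k^o). Qed.

Lemma lin_mull U c (f : U -> k) :
  linear (f : U -> k^o) -> linear ((fun x => c * f x) : U -> k^o).
Proof. exact: (@lin_scale U k^o). Qed.

Lemma lin_comp U V W (f : V -> W) (g : U -> V) :
  linear f -> linear g -> linear (fun x => f (g x)).
Proof. by move=> lf lg c x y; rewrite lg lf. Qed.

Lemma coef_linear B b : linear ((fun x : fmod k B => x@_b) : _ -> k^o).
Proof. by move=> c x y; rewrite fcoefD fcoefZ. Qed.

Lemma lift_fbas B (x : fmod k B) : lift fbas x = x.
Proof.
apply: coefP => b; rewrite /lift fcoef_sum.
under eq_bigr do rewrite fcoefZ fcoefU.
case: (msuppP x b) => [xb|bx]; last first.
  rewrite big1_seq // => c /andP[_ cx]; case: eqP => [cb|]; last by rewrite mulr0.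
  by rewrite -cb cx in bx.
rewrite (bigD1_seq b) //= eqxx mulr1 big1 ?addr0 // => c /negbTE->.
by rewrite mulr0.
Qed.

Lemma lift_sum B V (f : B -> V) (I : Type) (r : seq I) (P : pred I) F :
  lift f (\sum_(i <- r | P i) F i) = \sum_(i <- r | P i) lift f (F i).
Proof. exact: lin_sum (lift_linear f). Qed.

Lemma linear_lift B V (f : fmod k B -> V) x :
  linear f -> f x = lift (fun b => f (fbas b)) x.
Proof.
move=> lf; rewrite -{1}(lift_fbas x) /lift lin_sum //.
by apply: eq_bigr => b _; rewrite linZ.
Qed.

Lemma eq_in_lift B V (f g : B -> V) x :
  (forall b, b \in msupp x -> f b = g b) -> lift f x = lift g x.
Proof. by move=> fg; apply: eq_big_seq => b /fg->. Qed.

Lemma supp_ext B V (f g : fmod k B -> V) x : linear f -> linear g ->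
  (forall b, b \in msupp x -> f (fbas b) = g (fbas b)) -> f x = g x.
Proof.
by move=> lf lg fg; rewrite (linear_lift x lf) (linear_lift x lg); apply: eq_in_lift.
Qed.

Lemma bas_ext B V (f g : fmod k B -> V) :
  linear f -> linear g -> (forall b, f (fbas b) = g (fbas b)) -> forall x, f x = g x.
Proof. by move=> lf lg fg x; apply: supp_ext. Qed.

Lemma msupp_fbas B b b' : b' \in msupp (fbas b : fmod k B) -> b' = b.
Proof. by rewrite -mcoeff_neq0 fcoefU; case: (b =P b') => // _; rewrite eqxx. Qed.

Section Bilinear.
Variables (B C : choiceType) (V : lmodType k) (f : B -> C -> V).

Lemma blift_linl y : linear (fun x => blift f x y).
Proof. exact: lift_linear. Qed.

Lemma blift_linr x : linear (blift f x).
Proof.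
move=> c y z; move: x; apply: bas_ext => [||b]; try exact: blift_linl.
  by apply: lin_add; first apply: lin_scale; exact: blift_linl.
by rewrite /blift !lift_bas lift_linear.
Qed.

Lemma blift_bas b c : blift f (fbas b) (fbas c) = f b c.
Proof. by rewrite /blift !lift_bas. Qed.

End Bilinear.

Lemma pairing_linl B C (f : B -> C -> k) y : linear ((fun x => pairing f x y) : _ -> k^o).
Proof. exact: blift_linl. Qed.
Lemma pairing_linr B C (f : B -> C -> k) x : linear (pairing f x : _ -> k^o).
Proof. exact: blift_linr. Qed.
Lemma pairing_bas B C (f : B -> C -> k) b c : pairing f (fbas b) (fbas c) = f b c.
Proof. exact: (blift_bas (V := k^o)). Qed.

Lemma tens_linl B C (y : fmod k C) : linear (fun x : fmod k B => tens x y).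
Proof. exact: blift_linl. Qed.
Lemma tens_linr B C (x : fmod k B) : linear (fun y : fmod k C => tens x y).
Proof. exact: blift_linr. Qed.
Lemma tens_bas B C (b : B) (c : C) : tens (fbas b) (fbas c) = fbas (b, c) :> fmod k _.
Proof. exact: blift_bas. Qed.

Lemma tmap_linear B C B' C' f g : linear (@tmap k B C B' C' f g).
Proof. exact: lift_linear. Qed.
Lemma tmap_bas B C B' C' f g p :
  @tmap k B C B' C' f g (fbas p) = tens (f (fbas p.1)) (g (fbas p.2)).
Proof. exact: lift_bas. Qed.

Lemma tmapZ B C B' C' f g c z : @tmap k B C B' C' f g (c *: z) = c *: tmap f g z.
Proof. exact: linZ (tmap_linear f g). Qed.
Lemma tmap_sum B C B' C' f g (I : Type) (r : seq I) (P : pred I) F :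
  @tmap k B C B' C' f g (\sum_(i <- r | P i) F i) = \sum_(i <- r | P i) tmap f g (F i).
Proof. exact: lin_sum (tmap_linear f g). Qed.

Lemma tassoc_linear B C D : linear (@tassoc k B C D).
Proof. exact: lift_linear. Qed.
Lemma tassoc_bas B C D p : @tassoc k B C D (fbas p) = fbas (p.1, p.2.1, p.2.2).
Proof. exact: lift_bas. Qed.

End Linearity.

Section StructureMaps.
Variables (k : comPzRingType) (q : k).
Implicit Types H : hopf_data k.

Lemma hmul_linl H y : linear (fun x => @hmul k H x y).
Proof. exact: blift_linl. Qed.
Lemma hmul_linr H x : linear (@hmul k H x).
Proof. exact: blift_linr. Qed.
Lemma hmul_bas H a b : @hmul k H (fbas a) (fbas b) = hd_mul a b.
Proof. exact: blift_bas. Qed.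
Lemma hcop_linear H : linear (@hcop k H).
Proof. exact: lift_linear. Qed.
Lemma hcop_bas H a : @hcop k H (fbas a) = hd_cop a.
Proof. exact: lift_bas. Qed.
Lemma tmul_linl H y : linear (fun x => @tmul k q H x y).
Proof. exact: blift_linl. Qed.
Lemma tmul_linr H x : linear (@tmul k q H x).
Proof. exact: blift_linr. Qed.
Lemma tmul_bas H p r : @tmul k q H (fbas p) (fbas r) =
  q ^+ (hd_deg p.2 * hd_deg r.1) *: tens (hd_mul p.1 r.1) (hd_mul p.2 r.2).
Proof. exact: blift_bas. Qed.

Lemma lcons_linear a : linear (@lcons k a).
Proof. exact: lift_linear. Qed.
Lemma lcons_bas a u : lcons a (fbas u) = fbas (a :: u) :> fmod k _.
Proof. exact: lift_bas. Qed.

End StructureMaps.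

(** Linearity of a composite of the structure maps, in one of their arguments;
    maps assumed to be linear are recognized too. The match must backtrack, because a
    pattern variable for a fixed argument also accepts one in which x occurs. *)
Ltac lin := match goal with
  | |- GRing.linear_for _ (fun x => x) => exact: lin_id
  | |- GRing.linear_for _ (fun x => 0%R) => exact: lin_const0
  | |- GRing.linear_for _ (fun x => (@?f x + @?g x)%R) =>
      apply: (lin_add (f := f) (g := g)); lin
  | |- GRing.linear_for _ (fun x => ?c *: @?f x) => apply: (lin_scale c (f := f)); lin
  | |- GRing.linear_for _ (fun x => @?f x *: ?v) => apply: (lin_scalel (f := f) v); lin
  | |- GRing.linear_for _ (fun x => ?c * @?f x) => apply: (lin_mull c (f := f)); lin
  | |- GRing.linear_for _ (fun x => @?f x * ?c) => apply: (lin_mulr (f := f) c); lin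
  | |- GRing.linear_for _ (fun x => (@?f x)@_?b) =>
      apply: (lin_comp (g := f) (coef_linear b)); lin
  | |- GRing.linear_for _ (fun x => lift ?h (@?f x)) =>
      apply: (lin_comp (g := f) (lift_linear h)); lin
  | |- GRing.linear_for _ (fun x => pairing ?h (@?f x) ?y) =>
      apply: (lin_comp (g := f) (pairing_linl h y)); lin
  | |- GRing.linear_for _ (fun x => pairing ?h ?y (@?f x)) =>
      apply: (lin_comp (g := f) (pairing_linr h y)); lin
  | |- GRing.linear_for _ (fun x => tens (@?f x) ?y) =>
      apply: (lin_comp (g := f) (tens_linl y)); lin
  | |- GRing.linear_for _ (fun x => tens ?y (@?f x)) =>
      apply: (lin_comp (g := f) (tens_linr y)); lin
  | |- GRing.linear_for _ (fun x => tmap ?h ?h' (@?f x)) =>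
      apply: (lin_comp (g := f) (tmap_linear h h')); lin
  | |- GRing.linear_for _ (fun x => tassoc (@?f x)) =>
      apply: (lin_comp (g := f) (@tassoc_linear _ _ _ _)); lin
  | |- GRing.linear_for _ (fun x => @hmul _ ?H (@?f x) ?y) =>
      apply: (lin_comp (g := f) (@hmul_linl _ H y)); lin
  | |- GRing.linear_for _ (fun x => @hmul _ ?H ?y (@?f x)) =>
      apply: (lin_comp (g := f) (@hmul_linr _ H y)); lin
  | |- GRing.linear_for _ (fun x => @tmul _ ?q ?H (@?f x) ?y) =>
      apply: (lin_comp (g := f) (@tmul_linl _ q H y)); lin
  | |- GRing.linear_for _ (fun x => @tmul _ ?q ?H ?y (@?f x)) =>
      apply: (lin_comp (g := f) (@tmul_linr _ q H y)); lin
  | |- GRing.linear_for _ (fun x => @hcop _ ?H (@?f x)) =>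
      apply: (lin_comp (g := f) (@hcop_linear _ H)); lin
  | |- GRing.linear_for _ (fun x => lcons ?a (@?f x)) =>
      apply: (lin_comp (g := f) (lcons_linear a)); lin
  | lh : GRing.linear_for _ ?h |- GRing.linear_for _ (fun x => ?h (@?f x)) =>
      apply: (lin_comp (g := f) lh); lin
  | |- GRing.linear_for _ (fun x => _) => fail 1 "not recognized as linear"
  | |- GRing.linear_for _ (mcoeff ?b) => exact: (coef_linear b)
  | |- GRing.linear_for ?s ?h => match type of h with ?A -> _ =>
      change (GRing.linear_for s (fun x : A => h x)); cbv beta; lin end
  end.

(** To prove an equation linear in x, take x to be a basis element. *)
Ltac on_basis x := move: x; apply: bas_ext; [lin | lin | ].
(** For equations between scalars, where the module k^o cannot be inferred. *)
Ltac on_basis_scalar x :=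
  let T := type of x in
  match eval cbv delta [hd_mod] beta in T with fmod ?k ?B =>
    move: x; apply: (bas_ext (B := B) (V := k^o%type)); [lin | lin | ]
  end.

Section TensorMaps.
Variables (k : comPzRingType).
Implicit Types (B C D : choiceType).

Lemma tens_coef B C (x : fmod k B) (y : fmod k C) b c :
  (tens x y)@_(b, c) = x@_b * y@_c.
Proof.
on_basis_scalar x; move=> b'; on_basis_scalar y; move=> c'.
by rewrite tens_bas !fcoefU xpair_eqE; do 2 case: eqP; rewrite ?mulr0 ?mul0r ?mulr1.
Qed.

Lemma tmap_tens B C B' C' (f : fmod k B -> fmod k B') (g : fmod k C -> fmod k C') x y :
  linear f -> linear g -> tmap f g (tens x y) = tens (f x) (g y).
Proof.
move=> lf lg; on_basis x; move=> b; on_basis y; move=> c.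
by rewrite tens_bas tmap_bas.
Qed.

Lemma tmap_comp B C B' C' B2 C2 (f : fmod k B -> fmod k B') (g : fmod k C -> fmod k C')
    (f' : fmod k B' -> fmod k B2) (g' : fmod k C' -> fmod k C2) z :
  linear f' -> linear g' ->
  tmap f' g' (tmap f g z) = tmap (f' \o f) (g' \o g) z.
Proof. by move=> lf lg; on_basis z; move=> p; rewrite !tmap_bas tmap_tens. Qed.

Lemma eq_tmap B C B' C' (f f' : fmod k B -> fmod k B') (g g' : fmod k C -> fmod k C') :
  f =1 f' -> g =1 g' -> tmap f g =1 tmap f' g'.
Proof. by move=> ff gg z; on_basis z; move=> p; rewrite !tmap_bas ff gg. Qed.

Lemma tmap_id B C : @tmap k B C B C id id =1 id.
Proof. by move=> z; on_basis z; move=> [b c]; rewrite tmap_bas tens_bas. Qed.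

Lemma tmap_inj B C B' C' (f : fmod k B -> fmod k B') (g : fmod k C -> fmod k C') f' g' :
  linear f' -> linear g' -> cancel f f' -> cancel g g' -> injective (tmap f g).
Proof.
move=> lf lg fK gK; apply: (can_inj (g := tmap f' g')) => z.
rewrite tmap_comp // -[RHS]tmap_id; exact: eq_tmap.
Qed.

Lemma tassoc_tens B C D (x : fmod k B) (y : fmod k C) (z : fmod k D) :
  tassoc (tens x (tens y z)) = tens (tens x y) z.
Proof.
on_basis x; move=> b; on_basis y; move=> c; on_basis z; move=> d.
by rewrite !tens_bas tassoc_bas.
Qed.

Lemma tassoc_tmap B C D B' C' D' (f : fmod k B -> fmod k B') (g : fmod k C -> fmod k C')
    (h : fmod k D -> fmod k D') z :
  tassoc (tmap f (tmap g h) z) = tmap (tmap f g) h (tassoc z).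
Proof. by on_basis z; move=> p; rewrite tassoc_bas !tmap_bas /= tassoc_tens. Qed.

Lemma lift_counitl B C (e : fmod k B -> k) x (y : fmod k C) :
  linear (e : _ -> k^o) ->
  lift (fun p => e (fbas p.1) *: fbas p.2) (tens x y) = e x *: y.
Proof.
by move=> le; on_basis x; move=> b; on_basis y; move=> c; rewrite tens_bas lift_bas.
Qed.

Lemma lift_counitr B C (e : fmod k C -> k) (x : fmod k B) y :
  linear (e : _ -> k^o) ->
  lift (fun p => e (fbas p.2) *: fbas p.1) (tens x y) = e y *: x.
Proof.
by move=> le; on_basis x; move=> b; on_basis y; move=> c; rewrite tens_bas lift_bas.
Qed.

End TensorMaps.

(** * Graded q-Hopf algebras *)

Section QHopf.
Variables (k : comPzRingType) (q : k).
Implicit Types H K : hopf_data k.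

Lemma homogP H n (x : hd_mod H) :
  homog n x <-> forall b, hd_deg b <> n -> x@_b = 0.
Proof.
split=> [hx b nb|hx b]; first by apply: mcoeff_outdom; apply/negP => /hx.
by rewrite -mcoeff_neq0 => xb; apply/eqP; apply: contraNT xb => /eqP/hx->.
Qed.

Lemma homog_fbas H b n : hd_deg b = n -> homog n (fbas b : hd_mod H).
Proof. by move=> <- b' /msupp_fbas->. Qed.

Lemma homog_lin H n c (x y : hd_mod H) :
  homog n x -> homog n y -> homog n (c *: x + y).
Proof.
move=> /homogP hx /homogP hy; apply/homogP => b nb.
by rewrite fcoefD fcoefZ hx // hy // mulr0 addr0.
Qed.

Lemma homog0 H n : homog n (0 : hd_mod H).
Proof. by apply/homogP => b _; rewrite fcoef0. Qed.

Lemma homogZ H n c (x : hd_mod H) : homog n x -> homog n (c *: x).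
Proof. by move=> hx; rewrite -[_ *: _]addr0; apply: homog_lin => //; apply: homog0. Qed.

Lemma homog_sum H n (I : eqType) (r : seq I) (P : pred I) (F : I -> hd_mod H) :
  (forall i, i \in r -> P i -> homog n (F i)) -> homog n (\sum_(i <- r | P i) F i).
Proof.
move=> hF; rewrite big_seq_cond; elim/big_ind: _ => [|x y hx hy|i /andP[]].
- exact: homog0.
- by rewrite -[x]scale1r; apply: homog_lin.
- exact: hF.
Qed.

Lemma homog_map H K (f : hd_mod H -> hd_mod K) n x : linear f ->
  (forall b, homog (hd_deg b) (f (fbas b))) -> homog n x -> homog n (f x).
Proof.
move=> lf hf hx; rewrite (linear_lift x lf); apply: homog_sum => b bx _.
by apply: homogZ; rewrite -(hx b bx).
Qed.

Lemma homog_hmul H : (forall a b : hd_bas H, homog (hd_deg a + hd_deg b) (hd_mul a b)) ->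
  forall m n (x y : hd_mod H), homog m x -> homog n y -> homog (m + n) (hmul x y).
Proof.
move=> hm m n x y hx hy; apply: homog_sum => a ax _; apply: homogZ.
by apply: homog_sum => b bx _; apply: homogZ; rewrite -(hx a ax) -(hy b bx).
Qed.

(** The twist only sees degrees, so the rule that defines the twisted product on
    basis elements holds for all homogeneous ones. *)
Lemma tmul_tens H m n (x x' y y' : hd_mod H) : homog m x' -> homog n y ->
  tmul q (tens x x') (tens y y') = q ^+ (m * n) *: tens (hmul x y) (hmul x' y').
Proof.
move=> hx hy; on_basis x; move=> a; on_basis y'; move=> b.
apply: (supp_ext (f := fun x' => tmul q (tens _ x') _)
  (g := fun x' => _ *: tens _ (hmul x' _))) => [||a' aa]; [lin | lin |].
apply: (supp_ext (f := fun y => tmul q _ (tens y _))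
  (g := fun y => _ *: tens (hmul _ y) _)) => [||b' bb]; [lin | lin |].
by rewrite !tens_bas tmul_bas !hmul_bas /= (hx _ aa) (hy _ bb).
Qed.

Lemma tmap_tmul H K (f : hd_mod H -> hd_mod K) z z' : linear f ->
  {morph f : x y / hmul x y} -> (forall b, homog (hd_deg b) (f (fbas b))) ->
  tmap f f (tmul q z z') = tmul q (tmap f f z) (tmap f f z').
Proof.
move=> lf fM hf; on_basis z; move=> p; on_basis z'; move=> r.
rewrite tmul_bas linZ; last lin.
rewrite tmap_tens // !tmap_bas (tmul_tens (m := hd_deg p.2) (n := hd_deg r.1)) //.
by rewrite -!hmul_bas !fM.
Qed.

(** In a connected graded coalgebra with a grouplike unit b0, the counit can only
    be the coefficient of b0. *)
Definition pointed H (b0 : hd_bas H) :=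
  [/\ hd_one H = fbas b0, forall b : hd_bas H, hd_deg b = 0%N <-> b = b0
    & hd_cop b0 = fbas (b0, b0)].

Lemma counit_unique H (b0 : hd_bas H) (e : {linear fmod k (hd_bas H) -> k^o}) :
  pointed b0 -> is_counit e -> forall x, e x = x@_b0.
Proof.
move=> [_ degP cop0] [e0 e1 _]; apply: (bas_ext (linearP e) (coef_linear b0)) => b.
rewrite fcoefU; case: eqP => [->|bb].
  have := congr1 (mcoeff b0) (e1 (fbas b0 : hd_mod H)).
  by rewrite hcop_bas cop0 lift_bas /= fcoefZ fcoefU eqxx mulr1.
apply: (e0 (hd_deg b)); last exact: homog_fbas.
by rewrite lt0n; apply/eqP => /degP.
Qed.

(** The coefficient at b, valued in the regular module so as to be a linear form. *)
Definition coefl (B : choiceType) (b : B) (x : fmod k B) : k^o := x@_b.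

HB.instance Definition _ (B : choiceType) (b : B) :=
  GRing.isLinear.Build k (fmod k B) k^o _ (coefl b) (coef_linear b).

Lemma coef_counit H (b0 : hd_bas H) : pointed b0 ->
  (forall a : hd_bas H, lift (fun p => (p.1 == b0)%:R *: fbas p.2) (hd_cop a) = fbas a) ->
  (forall a : hd_bas H, lift (fun p => (p.2 == b0)%:R *: fbas p.1) (hd_cop a) = fbas a) ->
  @is_counit k H (coefl b0).
Proof.
move=> [_ degP _] c1 c2; split=> [n x n0 /homogP hx|x|x].
- by apply: hx => /= E; move/degP: (erefl b0) => E'; rewrite -E E' in n0.
- on_basis x; move=> a; rewrite hcop_bas -[RHS]c1.
  by apply: eq_in_lift => p _; rewrite /= /coefl fcoefU.
- on_basis x; move=> a; rewrite hcop_bas -[RHS]c2.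
  by apply: eq_in_lift => p _; rewrite /= /coefl fcoefU.
Qed.

Lemma pointed_connected H (b0 : hd_bas H) : pointed b0 ->
  homog 0 (hd_one H) /\ forall x : hd_mod H, homog 0 x -> exists! c : k, x = c *: hd_one H.
Proof.
move=> [-> degP _]; split=> [|x /homogP hx]; first by apply: homog_fbas; apply/degP.
exists x@_b0; split=> [|c ->]; last by rewrite fcoefZ fcoefU eqxx mulr1.
apply: coefP => b; rewrite fcoefZ fcoefU; case: eqP => [->|nb]; first by rewrite mulr1.
by rewrite mulr0 hx // => /degP/esym.
Qed.

Lemma basis_qhopf_hom H K (b0 : hd_bas H) (c0 : hd_bas K) (f : hd_mod H -> hd_mod K) :
  pointed b0 -> pointed c0 -> linear f -> f (fbas b0) = fbas c0 ->
  (forall a b, f (hd_mul a b) = hmul (f (fbas a)) (f (fbas b))) ->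
  (forall b, homog (hd_deg b) (f (fbas b))) ->
  (forall b, hcop (f (fbas b)) = tmap f f (hd_cop b)) -> is_qhopf_hom f.
Proof.
move=> pH pK lf f1 fM fh fC; split=> //.
- split; first by case: pH pK => -> _ _ [-> _ _].
  move=> x y; on_basis x; move=> a; on_basis y; move=> b.
  by rewrite hmul_bas fM.
- by move=> n x; apply: homog_map.
- by move=> x; on_basis x; move=> b; rewrite fC hcop_bas.
move=> eH eK cH cK x; rewrite (counit_unique pH cH) (counit_unique pK cK).
move: x; apply: (bas_ext (V := k^o) (f := fun x : hd_mod H => (f x)@_c0)
  (g := fun x : hd_mod H => x@_b0)) => [||b]; [lin | lin |].
rewrite fcoefU; case: eqP => [->|bb]; first by rewrite f1 fcoefU eqxx.
case: pH pK => _ degH _ [_ degK _]; have /homogP -> // := fh b.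
by move/degK: (erefl c0) => -> /esym/degH.
Qed.

(** The map induced on the tensor square or cube is injective as well, so every
    identity between structure maps can be checked in K. *)
Lemma transport_qhopf H K (b0 : hd_bas H) (c0 : hd_bas K) (f : hd_mod H -> hd_mod K) f' :
  pointed b0 -> pointed c0 ->
  is_qhopf_hom f -> linear f' -> cancel f f' -> cancel f' f ->
  (forall a b : hd_bas H, homog (hd_deg a + hd_deg b) (hd_mul a b)) ->
  (forall n (x : hd_mod H), homog n x -> thomog n (hcop x)) ->
  is_graded_qhopf q K -> is_graded_qhopf q H.
Proof.
move=> pH pK [lf [f1 fM] fh fC _] lf' fK f'K hm hc.
case=> -[mA [m1 m1'] _ _ _] [_ dA [e [e0 e1 e2]]] mC.
have fI := can_inj fK.
have ffI := tmap_inj lf' lf' fK fK.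
have lcop X : linear (@hcop k X) := @hcop_linear k X.
have f0b b : (f (fbas b))@_c0 = (b == b0)%:R.
  case: (pH) (pK) => o1 d1 _ [o2 d2 _]; case: eqP => [->|nb].
    by rewrite -o1 f1 o2 fcoefU eqxx.
  have /homogP -> // := fh _ _ (homog_fbas (erefl (hd_deg b))).
  by move/d2: (erefl c0) => -> /esym/d1.
split.
- have [? ?] := pointed_connected pH.
  split=> //; last exact: homog_hmul.
  + by move=> x y z; apply: fI; rewrite !fM mA.
  + by split=> x; apply: fI; rewrite fM f1 ?m1 ?m1'.
- split=> // [x|].
    apply: (tmap_inj (f' := tmap f' f') (g' := f') _ lf' _ fK (f := tmap f f)).
    + lin.
    + by move=> z; rewrite tmap_comp // -[RHS]tmap_id; apply: eq_tmap.
    rewrite -tassoc_tmap.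
    transitivity (tmap (@hcop k K) id (tmap f f (hcop x))).
      rewrite [LHS]tmap_comp; [|lin|exact: lf].
      rewrite [RHS]tmap_comp; [|exact: hcop_linear|exact: lin_id].
      by apply: eq_tmap => y //=; rewrite fC.
    rewrite -fC dA fC; congr tassoc.
    rewrite [LHS]tmap_comp; [|exact: lin_id|exact: hcop_linear].
    rewrite [RHS]tmap_comp; [|exact: lf|lin].
    by apply: eq_tmap => y //=; rewrite fC.
  have eE x : e x = x@_c0 by apply: (counit_unique pK).
  exists (coefl b0); apply: coef_counit => // a; apply: fI; rewrite -hcop_bas.
    rewrite -[RHS]e1 fC; move: (hcop _) => z; on_basis z; move=> p.
    by rewrite lift_bas linZ // tmap_bas -f0b -eE; exact/esym/lift_counitl/linearP.
  rewrite -[RHS]e2 fC; move: (hcop _) => z; on_basis z; move=> p.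
  by rewrite lift_bas linZ // tmap_bas -f0b -eE; exact/esym/lift_counitr/linearP.
- move=> x y; apply: ffI; rewrite -fC fM mC !fC tmap_tmul //.
  by move=> b; apply/fh/homog_fbas.
Qed.

End QHopf.

(** * Words and standardization *)

Section Standardization.
Local Open Scope nat_scope.
Implicit Types (u v : seq nat) (w : perms).

Definition pword (u : seq nat) : bool := perm_eq u (iota 0 (size u)).

Lemma pword_word w : pword (word w).
Proof.
rewrite /pword size_word; apply: uniq_perm; rewrite ?iota_uniq //.
  by rewrite map_inj_uniq ?enum_uniq // => i j /val_inj/perm_inj.
move=> x; rewrite mem_iota /= add0n; apply/mapP/idP => [[i _ ->]|xw].
  exact: ltn_ord.
by exists ((tagged w)^-1%g (Ordinal xw)); rewrite ?mem_enum // permKV.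
Qed.

Lemma pword_uniq u : pword u -> uniq u.
Proof. by move=> pu; rewrite (perm_uniq pu) iota_uniq. Qed.

Lemma mem_pword u x : pword u -> (x \in u) = (x < size u).
Proof. by move=> pu; rewrite (perm_mem pu) mem_iota. Qed.

Lemma nth_word_st u i : i < size u -> nth 0 (word (st u)) i =
  count (fun j => (nth 0 u j < nth 0 u i) || ((nth 0 u j == nth 0 u i) && (j < i)))
        (iota 0 (size u)).
Proof.
move=> iu; rewrite (nth_word (w := st u) (Ordinal iu)) permE /= /st_fun.
rewrite -val_enum_ord count_map -sum1_card -sum1_count big_enum_cond.
by apply: eq_bigl => j; rewrite !inE.
Qed.

Lemma tag_st u : tag (st u) = size u. Proof. by []. Qed.

Lemma word_st_lt u i j : i < j < size u ->
  (nth 0 (word (st u)) j < nth 0 (word (st u)) i) = (nth 0 u j < nth 0 u i).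
Proof.
case/andP => ij ju; have iu := ltn_trans ij ju.
rewrite (nth_word (w := st u) (Ordinal iu)) (nth_word (w := st u) (Ordinal ju)) !permE /=.
by rewrite st_fun_mono /= [j < i]ltnNge (ltnW ij) andbF orbF.
Qed.

(** The letter of st u in position i counts the positions that come before i in the
    standard order, and that order is given by the inverted pairs of u. *)
Lemma st_patt u v : size u = size v ->
  (forall i j, i < j < size u -> (nth 0 u j < nth 0 u i) = (nth 0 v j < nth 0 v i)) ->
  st u = st v.
Proof.
move=> uv patt; apply: word_inj; apply: (@eq_from_nth _ 0); rewrite !size_word //.
move=> i iu; rewrite !nth_word_st -?uv //; apply: eq_in_count => j.
rewrite mem_iota /= add0n => ju.
case: (ltngtP i j) => [ij|ji|<-]; last by rewrite !ltnn !andbF.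
  by rewrite !andbF !orbF patt // ij.
have le_or a b : (a < b) || (a == b) = (a <= b) by rewrite orbC -leq_eqVlt.
by rewrite !andbT !le_or leqNgt [RHS]leqNgt patt // ji.
Qed.

Lemma st_word_take i u : st (take i (word (st u))) = st (take i u).
Proof.
apply: st_patt; rewrite !size_take_min !size_word //= => a b.
rewrite leq_min => /and3P[ab bi bu].
by rewrite !nth_take ?(ltn_trans ab) // word_st_lt // ab.
Qed.

Lemma st_word_drop i u : st (drop i (word (st u))) = st (drop i u).
Proof.
apply: st_patt; rewrite !size_drop !size_word //= => a b /andP[ab bu].
by rewrite !nth_drop word_st_lt // ltn_add2l ab -ltn_subRL.
Qed.

Lemma st_map f u : {in u &, {mono f : x y / x < y}} -> st (map f u) = st u.
Proof.
move=> mo; apply: st_patt; rewrite size_map // => i j /andP[ij ju].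
have iu := ltn_trans ij ju.
by rewrite !(nth_map 0) // mo ?mem_nth.
Qed.

Lemma st_addn n u : st (map (addn n) u) = st u.
Proof. by apply: st_map => x y _ _; rewrite ltn_add2l. Qed.

(** No ties arise, so the rank of a letter is a function of the letter alone. *)
Lemma word_st_uniq u : uniq u -> word (st u) = map (fun x => count (ltn^~ x) u) u.
Proof.
move=> uu; apply: (@eq_from_nth _ 0); rewrite size_word ?size_map // => i iu.
rewrite nth_word_st // (nth_map 0) //; set x := nth 0 u i.
rewrite -[u in RHS](mkseq_nth 0) count_map.
apply: eq_in_count => j; rewrite mem_iota /= add0n => ju.
by case: ltngtP => //= /eqP; rewrite nth_uniq // => /eqP->; rewrite ltnn.
Qed.

Lemma st_eq_word u w : pword u -> (st u == w) = (u == word w).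
Proof.
move=> pu; apply/eqP/eqP => [<-|->]; first by rewrite word_st.
exact: st_word.
Qed.

Fixpoint npairs (r : rel nat) (u : seq nat) : nat :=
  if u is a :: u' then count (r a) u' + npairs r u' else 0.

(** This turns the cardinals that define plen and inv_below into recursive counts. *)
Lemma card_pairs (r : rel nat) u n : size u = n ->
  #|[set p : 'I_n * 'I_n | (p.1 < p.2) && r (nth 0 u p.1) (nth 0 u p.2)]| = npairs r u.
Proof.
move=> <- {n}; rewrite -sum1_card.
under eq_bigl do rewrite inE.
rewrite -(pair_big_dep xpredT (fun i j : 'I_(size u) => (i < j) && r (nth 0 u i) (nth 0 u j))
  (fun _ _ => 1)) /=.
transitivity (\sum_(0 <= i < size u) \sum_(0 <= j < size u |
   (i < j) && r (nth 0 u i) (nth 0 u j)) 1).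
  by rewrite big_mkord; apply: eq_bigr => i _; rewrite big_mkord.
elim: u => [|a u IH]; first by rewrite big_nil.
rewrite /= big_nat_recl // -[X in _ = _ + X]IH; congr (_ + _).
  rewrite big_mkcond big_nat_recl //= add0n -big_mkcond /=.
  rewrite -[u in RHS](mkseq_nth 0) count_map -sum1_count /index_iota subn0.
  by apply: eq_bigl => j.
apply: eq_bigr => i _; rewrite big_mkcond big_nat_recl //= add0n -big_mkcond /=.
by apply: eq_bigl => j; rewrite ltnS.
Qed.

Lemma winvE u : winv u = npairs (fun a b => b < a) u.
Proof. by elim: u => //= a u ->. Qed.

Lemma plenE w : plen w = winv (word w).
Proof.
rewrite winvE -(card_pairs _ (size_word w)); apply: eq_card => p.
by rewrite !inE !nth_word.
Qed.

Definition inv_across (P : pred nat) : seq nat -> nat :=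
  npairs (fun a b => ~~ P a && P b).

Lemma inv_belowE i w : inv_below i w = inv_across (ltn^~ i) (word w).
Proof.
have swK : involutive (fun p : 'I_(tag w) * 'I_(tag w) => (p.2, p.1)) by case.
rewrite /inv_across -(card_pairs _ (size_word w)) /inv_below.
rewrite -sum1_card -[RHS]sum1_card [RHS](reindex_inj (inv_inj swK)).
by apply: eq_bigl => p; rewrite !inE !nth_word /= -leqNgt [X in _ && X]andbC.
Qed.

End Standardization.

(** * The q-shuffle algebra of words *)

Section Shuffles.
Variables (k : comPzRingType) (q : k).
Implicit Types (u v x : seq nat).

Local Notation words := (fmod k (seq nat)).
Local Notation qsh := (qshuffle q).

Lemma qshuffle0l v : qsh [::] v = fbas v. Proof. by case: v. Qed.
Lemma qshuffle0r u : qsh u [::] = fbas u. Proof. by case: u. Qed.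
Lemma qshuffle_cons a u b v : qsh (a :: u) (b :: v) =
  lcons a (qsh u (b :: v)) + q ^+ (size u).+1 *: lcons b (qsh (a :: u) v).
Proof. by []. Qed.

Lemma lcons_coef a (X : words) x :
  (lcons a X)@_x = if x is b :: x' then (a == b)%:R * X@_x' else 0.
Proof.
case: x => [|b x]; on_basis_scalar X; move=> u; rewrite lcons_bas fcoefU //.
by rewrite fcoefU eqseq_cons; case: eqP; rewrite ?mul1r ?mul0r.
Qed.

Lemma lift_lcons (V : lmodType k) (F : seq nat -> V) a (X : words) :
  lift F (lcons a X) = lift (fun u => F (a :: u)) X.
Proof.
by on_basis X; move=> u; rewrite lcons_bas !lift_bas.
Qed.

Lemma qshuffle_ind (P : seq nat -> seq nat -> Prop) :
  (forall v, P [::] v) -> (forall u, P u [::]) ->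
  (forall a u b v, P u (b :: v) -> P (a :: u) v -> P (a :: u) (b :: v)) ->
  forall u v, P u v.
Proof.
move=> P0l P0r Pc; elim=> [|a u IHu] v; first exact: P0l.
by elim: v => [|b v IHv]; [exact: P0r | apply: Pc].
Qed.

Lemma qshuffle_perm u v x : x \in msupp (qsh u v) -> perm_eq x (u ++ v).
Proof.
rewrite -mcoeff_neq0; apply: contraNT => nx; apply/eqP.
move: u v x nx; apply: qshuffle_ind => [v|u|a u b v IHu IHv] x nx.
- by rewrite qshuffle0l fcoefU; case: eqP nx => // ->; rewrite perm_refl.
- by rewrite qshuffle0r fcoefU; case: eqP nx => // ->; rewrite cats0 perm_refl.
rewrite qshuffle_cons fcoefD fcoefZ !lcons_coef.
case: x nx => [|c x] nx; first by rewrite mulr0 addr0.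
have -> : (a == c)%:R * (qsh u (b :: v))@_x = 0.
  case: eqP nx => [->|]; last by rewrite mul0r.
  by rewrite /= perm_cons => /IHu->; rewrite mulr0.
have -> : (b == c)%:R * (qsh (a :: u) v)@_x = 0; last by rewrite mulr0 addr0.
case: eqP nx => [->|]; last by rewrite mul0r.
have /permPr -> : perm_eq ((a :: u) ++ c :: v) (c :: (a :: u) ++ v).
  by rewrite perm_catC /= -[_ :: v ++ _]cat1s perm_cons perm_catC.
by rewrite perm_cons => /IHv->; rewrite mulr0.
Qed.

Lemma qshuffle_map f u v :
  lift (fun x => fbas (map f x)) (qsh u v) = qsh (map f u) (map f v) :> words.
Proof.
move: u v; apply: qshuffle_ind => [v|u|a u b v IHu IHv].
- by rewrite !qshuffle0l lift_bas.
- by rewrite !qshuffle0r lift_bas.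
rewrite [map f (a :: u)]/= [map f (b :: v)]/= !qshuffle_cons.
rewrite (linD _ _ (lift_linear _)) (linZ _ _ (lift_linear _)) size_map !lift_lcons -[_ :: map f v]/(map f (b :: v)) -IHu.
rewrite -[_ :: map f u]/(map f (a :: u)) -IHv.
have lf c (X : words) : lift (fun u => fbas (map f (c :: u))) X =
    lcons (f c) (lift (fun x => fbas (map f x)) X).
  by on_basis X; move=> x; rewrite !lift_bas lcons_bas.
by rewrite !lf.
Qed.

(** When P tells the letters of u from those of v, a word is a shuffle of u and v in
    at most one way: separate the marked letters from the others. Each letter of v
    contributes q for every letter of u to its right. *)
Lemma qshuffle_coef (P : pred nat) u v x : all P u -> all (predC P) v ->
  (qsh u v)@_x = if (filter P x == u) && (filter (predC P) x == v)
                 then q ^+ inv_across P x else 0.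
Proof.
move=> Pu Pv; move: u v Pu Pv x; apply: qshuffle_ind => [v _ Pv x|u Pu _ x|a u b v IHu IHv].
- rewrite qshuffle0l fcoefU; case: eqP => [<-|xv].
    have /all_filterP -> := Pv; rewrite eqxx andbT.
    have -> : filter P v = [::] by apply/eqP; rewrite -[_ == _]negbK -has_filter -all_predC.
    rewrite eqxx; suff -> : inv_across P v = 0%N by [].
    rewrite /inv_across; elim: v Pv => //= c v IH /andP[Pc Pv]; rewrite IH // addn0.
    apply/eqP; rewrite -leqn0 leqNgt -has_count; apply/hasPn => d /(allP Pv) /= /negbTE->.
    by rewrite andbF.
  case: ifP => // /andP[/eqP fx0 /eqP fxv]; case: xv; rewrite -fxv.
  apply/all_filterP; rewrite all_predC has_filter fx0 //.
- rewrite qshuffle0r fcoefU; case: eqP => [<-|xu].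
    have /all_filterP -> := Pu; rewrite eqxx /=.
    have -> : filter (predC P) u = [::].
      apply/eqP; rewrite -[_ == _]negbK -has_filter -all_predC (eq_all (a2 := P)) // => c /=.
      by rewrite negbK.
    rewrite eqxx; suff -> : inv_across P u = 0%N by [].
    rewrite /inv_across; elim: u Pu => //= c u IH /andP[Pc Pu]; rewrite IH // addn0 Pc.
    exact: count_pred0.
  case: ifP => // /andP[/eqP fxu /eqP fx0]; case: xu; rewrite -fxu.
  apply/all_filterP; rewrite -[all _ _]negbK -has_predC has_filter fx0 //.
move=> /andP[Pa Pu] /andP[Pb Pv] x; have {}Pb : ~~ P b := Pb.
rewrite qshuffle_cons fcoefD fcoefZ !lcons_coef.
case: x => [|c x]; first by rewrite mulr0 addr0.
rewrite IHu //= ?Pb // IHv /= ?Pa // /inv_across /=.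
case: (boolP (P c)) => Pc /=.
  have /negbTE -> : b != c by apply: contraNneq Pb => ->.
  rewrite mul0r mulr0 addr0 eqseq_cons [c == a]eq_sym.
  case: eqP => _ /=; last by rewrite mul0r.
  by rewrite mul1r; congr (if _ then q ^+ _ else _); rewrite count_pred0.
have /negbTE -> : a != c by apply: contraNneq Pc => <-.
rewrite mul0r add0r eqseq_cons [c == b]eq_sym.
case: (b =P c) => _ /=; last by rewrite mul0r mulr0 andbF.
rewrite mul1r; case: ifP => [/andP[/eqP fx _]|]; last by rewrite mulr0.
by rewrite exprD -size_filter fx.
Qed.

End Shuffles.

Section ShuffleAlgebra.
Variables (k : comPzRingType) (q : k).
Implicit Types (u v w x : seq nat).

Local Notation qsh := (qshuffle q).

(** Letters have degree one. The products and coproducts of MR' are computed here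
    before standardizing. *)
Definition Words : hopf_data k :=
  @HopfData k (seq nat) size (fbas [::]) qsh
    (fun u => \sum_(i < (size u).+1) fbas (take i u, drop i u)).

Local Notation wmul := (@hmul k Words).

Lemma regroup_assoc (V : lmodType k) (A B C M N : V) (p r s t : k) : s = p * r -> t = p * r ->
  A + r *: C + s *: M + p *: (B + t *: N) = A + p *: B + r *: (C + p *: (M + p *: N)).
Proof.
move=> -> ->; rewrite !scalerDr !scalerA !addrA [r * p]mulrC [p * r * p]mulrC.
by rewrite [LHS](ACl (1*4*2*3*5)).
Qed.

Lemma regroup_cop (V : lmodType k) (A B P Q R S : V) (s : k) :
  A + s *: B + s *: R + (P + (Q + s *: S)) = A + (P + Q) + s *: (B + (R + S)).
Proof.
by rewrite !scalerDr !addrA [LHS](ACl (1*4*5*2*3*6)).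
Qed.

Lemma qshuffle_homog (u v : hd_bas Words) :
  homog (hd_deg u + hd_deg v) (hd_mul u v).
Proof. by move=> x /qshuffle_perm/perm_size; rewrite size_cat. Qed.

(** The recursion on first letters extends to linear combinations, as long as the
    words of the first factor have the same length. *)
Lemma hmul_lcons m a b (X Y : hd_mod Words) : homog m X ->
  wmul (lcons a X) (lcons b Y) =
  lcons a (wmul X (lcons b Y)) + q ^+ m.+1 *: lcons b (wmul (lcons a X) Y).
Proof.
move=> hX; on_basis Y; move=> v.
pose Y : hd_mod Words := lcons b (fbas v).
apply: (supp_ext (f := fun X => wmul (lcons a X) Y)
  (g := fun X => lcons a (wmul X Y)
                 + q ^+ m.+1 *: lcons b (wmul (lcons a X) (fbas v))))
  => [||u uX]; [lin | lin |].
by rewrite /Y !lcons_bas !hmul_bas -(hX u uX) -qshuffle_cons.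
Qed.

(** The first letter of a word in the shuffle of au, bv and cw is a, b or c. Placing c
    first costs a factor q for each letter of au and bv, in either bracketing. *)
Lemma qshuffleA u v w :
  wmul (qsh u v) (fbas w) = wmul (fbas u) (qsh v w).
Proof.
elim: u v w => [|a u IHu] v w.
  rewrite qshuffle0l hmul_bas /= [RHS](linear_lift _ (hmul_linr _)).
  rewrite -[LHS]lift_fbas; apply: eq_in_lift => x _.
  by rewrite hmul_bas; exact/esym/qshuffle0l.
elim: v w => [|b v IHv] w; first by rewrite qshuffle0r qshuffle0l !hmul_bas.
elim: w => [|c w IHw].
  rewrite qshuffle0r hmul_bas [LHS](linear_lift _ (hmul_linl _)).
  rewrite -[RHS]lift_fbas; apply: eq_in_lift => x _.
  by rewrite hmul_bas; exact: qshuffle0r.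
pose X := qsh u (b :: v) : hd_mod Words; pose Y := qsh (a :: u) v : hd_mod Words.
pose Z := qsh v (c :: w) : hd_mod Words; pose T := qsh (b :: v) w : hd_mod Words.
have hX : homog (size u + (size v).+1) X by exact: (@qshuffle_homog u (b :: v)).
have hY : homog ((size u).+1 + size v) Y by exact: (@qshuffle_homog (a :: u) v).
have hu : homog (size u) (fbas u : hd_mod Words) by exact: homog_fbas.
have lm (s t : hd_mod Words) (r : k) (y : hd_mod Words) :
  wmul (s + r *: t) y = wmul s y + r *: wmul t y.
  by rewrite (linD _ _ (hmul_linl _)) (linZ _ _ (hmul_linl _)).
have ml (s t : hd_mod Words) (r : k) (y : hd_mod Words) :
  wmul y (s + r *: t) = wmul y s + r *: wmul y t.
  by rewrite (linD _ _ (hmul_linr _)) (linZ _ _ (hmul_linr _)).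
rewrite !qshuffle_cons -/X -/Y -/Z -/T lm ml -(lcons_bas k c w) -(lcons_bas k a u).
rewrite (hmul_lcons _ _ _ hX) (hmul_lcons _ _ _ hY) !(hmul_lcons _ _ _ hu).
rewrite !lcons_bas (IHu (b :: v) (c :: w) : wmul X _ = _) qshuffle_cons -/Z -/T.
rewrite (IHv (c :: w) : wmul Y _ = _) -(IHw : _ = wmul _ T) qshuffle_cons -/X -/Y lm ml.
rewrite !(linD _ _ (lcons_linear _)) !(linZ _ _ (lcons_linear _)).
by apply: regroup_assoc; rewrite -exprD; congr (q ^+ _); rewrite addnS.
Qed.

Lemma wcop_cons a u :
  @hcop k Words (fbas (a :: u)) =
    fbas ([::], a :: u) + tmap (@lcons k a) id (@hcop k Words (fbas u)).
Proof.
rewrite !hcop_bas /= big_ord_recl /=; congr (_ + _).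
rewrite lin_sum; last lin.
by apply: eq_bigr => i _; rewrite tmap_bas lcons_bas tens_bas.
Qed.

Lemma hcop_lcons a (X : hd_mod Words) :
  @hcop k Words (lcons a X) =
    tens (fbas [::]) (lcons a X) + tmap (@lcons k a) id (@hcop k Words X).
Proof. by on_basis X; move=> u; rewrite lcons_bas tens_bas wcop_cons. Qed.

Local Notation wtmul := (@tmul k q Words).
Local Notation tcons a := (tmap (@lcons k a) id).

Lemma tcons_linear a : linear (tcons a : fmod k (seq nat * seq nat)%type -> _).
Proof. exact: tmap_linear. Qed.

Lemma tcons_tens a (X Y : hd_mod Words) : tcons a (tens X Y) = tens (lcons a X) Y.
Proof. by apply: tmap_tens; lin. Qed.

Lemma hcop_size u p : p \in msupp (@hcop k Words (fbas u)) ->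
  (size p.1 + size p.2)%N = size u.
Proof.
rewrite hcop_bas -mcoeff_neq0 fcoef_sum => nz.
apply/eqP; apply: contraNT nz => up; apply/eqP/big1 => i _.
by rewrite fcoefU; case: (_ =P p) up => // <-; rewrite /= -size_cat cat_take_drop eqxx.
Qed.

Lemma wtmul_pair (p1 p2 r1 r2 : seq nat) :
  wtmul (fbas (p1, p2)) (fbas (r1, r2)) =
    q ^+ (size p2 * size r1) *: tens (qsh p1 r1) (qsh p2 r2).
Proof. exact: tmul_bas. Qed.

(** A cut of a shuffle of u and v separates prefixes p1, r1 of u, v from suffixes
    p2, r2, and each letter of r1 passes each letter of p2: this is the twist. *)
Lemma hcop_qshuffle u v :
  @hcop k Words (qsh u v) = wtmul (@hcop k Words (fbas u)) (@hcop k Words (fbas v)).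
Proof.
have cop0 : @hcop k Words (fbas [::]) = fbas ([::], [::]).
  by rewrite hcop_bas /= big_ord_recl big_ord0 addr0.
have lt := tcons_linear.
move: u v; apply: qshuffle_ind => [v|u|a u b v IHu IHv].
- rewrite qshuffle0l cop0; move: (hcop _) => z; symmetry; on_basis z; move=> [v1 v2].
  by rewrite wtmul_pair !qshuffle0l tens_bas mul0n scale1r.
- rewrite qshuffle0r cop0; move: (hcop _) => z; symmetry; on_basis z; move=> [v1 v2].
  by rewrite wtmul_pair !qshuffle0r tens_bas muln0 scale1r.
pose c := @hcop k Words (fbas u); pose d := @hcop k Words (fbas v).
have K1 z : wtmul (fbas ([::], a :: u)) (tcons b z) =
    q ^+ (size u).+1 *: tcons b (wtmul (fbas ([::], a :: u)) z).
  on_basis z; move=> [r1 r2]; rewrite tmap_bas lcons_bas tens_bas !wtmul_pair.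
  by rewrite (linZ _ _ (lt _)) tcons_tens !scalerA -exprD mulnS !qshuffle0l lcons_bas.
have K2 z x : wtmul (tcons a z) (fbas ([::], x)) = tcons a (wtmul z (fbas ([::], x))).
  on_basis z; move=> [p1 p2]; rewrite tmap_bas lcons_bas tens_bas !wtmul_pair.
  by rewrite (linZ _ _ (lt _)) tcons_tens !qshuffle0r lcons_bas.
have K3 y z : (forall p, p \in msupp y -> (size p.1 + size p.2)%N = size u) ->
    wtmul (tcons a y) (tcons b z) =
    tcons a (wtmul y (tcons b z)) + q ^+ (size u).+1 *: tcons b (wtmul (tcons a y) z).
  move=> hy; on_basis z; move=> [r1 r2]; rewrite tmap_bas lcons_bas tens_bas.
  apply: (supp_ext (f := fun y => wtmul (tcons a y) _)
    (g := fun y => tcons a (wtmul y _) + q ^+ (size u).+1 *: tcons b (wtmul (tcons a y) _)))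
    => [||[p1 p2] py]; [lin | lin |].
  rewrite !tmap_bas !lcons_bas !tens_bas !wtmul_pair -(hy _ py) !(linZ _ _ (lt _)).
  rewrite !tcons_tens qshuffle_cons (linD _ _ (tens_linl _)) (linZ _ _ (tens_linl _)).
  rewrite !scalerDr !scalerA -!exprD /=; congr (_ + q ^+ _ *: _).
  by rewrite mulnS addnC addnA.
rewrite qshuffle_cons (linD _ _ (@hcop_linear _ _)) (linZ _ _ (@hcop_linear _ _)) !hcop_lcons.
rewrite IHu IHv !wcop_cons -/c -/d.
have tDr (x y z : fmod k (seq nat * seq nat)%type) : wtmul x (y + z) = wtmul x y + wtmul x z
  := linD _ _ (@tmul_linr _ _ _ _).
have tDl (x y z : fmod k (seq nat * seq nat)%type) : wtmul (x + y) z = wtmul x z + wtmul y z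
  := linD _ _ (@tmul_linl _ _ _ _).
rewrite !tDl !tDr K1 K2 K3; last exact: hcop_size.
rewrite !(linD _ _ (tmap_linear _ _)) wtmul_pair muln0 scale1r qshuffle0l qshuffle_cons.
have tE (X Y : hd_mod Words) r : tens (fbas [::] : hd_mod Words) (X + r *: Y) =
    tens (fbas [::] : hd_mod Words) X + r *: tens (fbas [::] : hd_mod Words) Y.
  by rewrite (linD _ _ (tens_linr _)) (linZ _ _ (tens_linr _)).
rewrite tE; exact/esym/regroup_cop.
Qed.

End ShuffleAlgebra.

(** * The q-Hopf algebra MR' *)

Section ShufflesOfPermutations.
Variables (k : comPzRingType) (q : k).
Implicit Types (u v x : seq nat) (w : perms).

Local Notation qsh := (qshuffle q).
Local Notation Wd := (hd_mod (Words q)).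

Definition lift_st : Wd -> hd_mod (MR' q) := lift (fun u => fbas (st u)).

Lemma lift_st_linear : linear lift_st. Proof. exact: lift_linear. Qed.
Lemma lift_st_bas u : lift_st (fbas u) = fbas (st u). Proof. exact: lift_bas. Qed.

Lemma count_lt_mono x : {in x &, {mono (fun a => count (ltn^~ a) x) : a b / (a < b)%N}}.
Proof.
have mono a b : a \in x -> (a < b)%N -> (count (ltn^~ a) x < count (ltn^~ b) x)%N.
  elim: x => //= c x IH; rewrite inE => /predU1P[<- ab|ax ab].
    rewrite ltnn ab add0n add1n ltnS; apply: sub_count => d /= da; exact: ltn_trans ab.
  rewrite -addnS leq_add ?IH //; case: (ltnP c a) => // ca.
  by rewrite (ltn_trans ca ab).
move=> a b ax bx; case: (ltnP a b) => [/mono->//|ba].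
apply/negbTE; rewrite -leqNgt; apply: sub_count => d /= db; exact: leq_trans ba.
Qed.

(** Only the relative order of the letters matters, so the product of two
    permutations can be computed on any two words standardizing to them, provided
    that the letters of the first are smaller than those of the second. *)
Lemma lift_st_qshuffle u v : uniq u -> uniq v -> allrel ltn u v ->
  lift_st (qsh u v) = mr'_mul q (st u) (st v).
Proof.
move=> uu uv /allrelP luv; pose g a := count (ltn^~ a) (u ++ v).
have gu : word (st u) = map g u.
  rewrite word_st_uniq //; apply/eq_in_map => a au; rewrite /g count_cat.
  rewrite [X in (_ + X)%N](_ : _ = 0%N) ?addn0 //; apply/eqP.
  rewrite -leqn0 leqNgt -has_count; apply/hasPn => b bv /=.
  by rewrite -leqNgt ltnW //; exact: luv.
have gv : [seq (tag (st u) + a)%N | a <- word (st v)] = map g v.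
  rewrite word_st_uniq // -map_comp; apply/eq_in_map => a av /=; rewrite /g count_cat.
  congr (_ + _)%N; apply/esym/eqP; rewrite -all_count; apply/allP => b bu.
  exact: luv.
rewrite /mr'_mul gu gv -qshuffle_map /lift_st.
move: (@qshuffle_perm k q u v); move: (qsh u v) => X hX; symmetry.
apply: (supp_ext (f := fun X => lift _ (lift _ X)) (g := lift _)) => [||y yX]; [lin | lin |].
rewrite !lift_bas st_map // => a b; rewrite !(perm_mem (hX y yX)).
exact: count_lt_mono.
Qed.

Lemma mr'_mulE w w' : mr'_mul q w w' = lift_st (qsh (word w) (map (addn (tag w)) (word w'))).
Proof. by []. Qed.

Lemma word_allrel w w' : allrel ltn (word w) (map (addn (tag w)) (word w')).
Proof.
apply/allrelP => a _ aw /mapP[b _ ->]; move: aw.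
by rewrite (mem_pword _ (pword_word w)) size_word => an; apply: leq_trans an _; exact: leq_addr.
Qed.

Lemma pword_cat_shift n u v : size u = n -> pword u -> pword v ->
  perm_eq (u ++ map (addn n) v) (iota 0 (n + size v)).
Proof.
rewrite /pword => un pu pv; rewrite iotaD; apply: perm_cat; first by rewrite -un.
by rewrite add0n -[X in iota X]addn0 iotaDl; exact: perm_map.
Qed.

Lemma qshuffle_pword w w' x :
  x \in msupp (qsh (word w) (map (addn (tag w)) (word w'))) ->
  pword x /\ size x = (tag w + tag w')%N.
Proof.
move=> /qshuffle_perm xp; have sx : size x = (tag w + tag w')%N.
  by rewrite (perm_size xp) size_cat (size_map (addn _)) !size_word.
split=> //; rewrite /pword sx -[X in iota _ (_ + X)](size_word w'); apply: perm_trans xp _.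
exact: pword_cat_shift (size_word _) (pword_word _) (pword_word _).
Qed.

Lemma mul_lift_stl n (X : Wd) w : (forall x, x \in msupp X -> pword x /\ size x = n) ->
  @hmul k (MR' q) (lift_st X) (fbas w) =
  lift_st (@hmul k (Words q) X (fbas (map (addn n) (word w)))).
Proof.
move=> hX; have ls := lift_st_linear.
apply: (supp_ext (f := fun X => @hmul k (MR' q) (lift_st X) _)
  (g := fun X => lift_st (@hmul k (Words q) X _))) => [||x xX]; [lin | lin |].
have [px sx] := hX x xX.
by rewrite lift_st_bas !hmul_bas [hd_mul _ _]mr'_mulE word_st // tag_st sx.
Qed.

Lemma mul_lift_str (X : Wd) w : (forall x, x \in msupp X -> pword x) ->
  @hmul k (MR' q) (fbas w) (lift_st X) =
  lift_st (@hmul k (Words q) (fbas (word w)) (lift (fun x => fbas (map (addn (tag w)) x)) X)).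
Proof.
move=> hX; have ls := lift_st_linear.
apply: (supp_ext (f := fun X => @hmul k (MR' q) _ (lift_st X))
  (g := fun X => lift_st (@hmul k (Words q) _ (lift _ X)))) => [||x xX]; [lin | lin |].
by rewrite lift_st_bas lift_bas !hmul_bas [hd_mul _ _]mr'_mulE word_st //; exact: hX.
Qed.

(** Both bracketings standardize the shuffle of w, of w' shifted by |w| and of w''
    shifted by |w| + |w'|. *)
Lemma mr'_mulA : associative (@hmul k (MR' q)).
Proof.
move=> x y z; on_basis x; move=> a; on_basis y; move=> b; on_basis z; move=> c.
rewrite !hmul_bas [hd_mul b c]mr'_mulE [hd_mul a b]mr'_mulE.
rewrite (mul_lift_stl _ (@qshuffle_pword a b)) mul_lift_str; last by move=> x /qshuffle_pword[].
rewrite qshuffle_map qshuffleA -map_comp.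
congr (lift_st (@hmul k (Words q) _ (qsh _ _))).
by apply: eq_map => i /=; rewrite addnA.
Qed.

Lemma mr'_mul1 : left_id (hd_one (MR' q)) (@hmul k (MR' q)) /\
  right_id (hd_one (MR' q)) (@hmul k (MR' q)).
Proof.
have w0 : word (st [::]) = [::] by apply/eqP; rewrite -size_eq0 size_word.
split=> x; on_basis x; move=> a; rewrite hmul_bas [hd_mul _ _]mr'_mulE w0.
  rewrite qshuffle0l lift_st_bas (_ : map _ _ = word a) ?st_word //.
  by rewrite -[RHS]map_id; exact: eq_map.
by rewrite [map _ [::]]/= qshuffle0r lift_st_bas st_word.
Qed.

Lemma mr'_mul_homog (a b : perms) :
  homog (tag a + tag b) (mr'_mul q a b : hd_mod (MR' q)).
Proof.
rewrite mr'_mulE /lift_st /lift; apply: homog_sum => x /qshuffle_pword[_ sx] _.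
by apply/homogZ/homog_fbas; rewrite /= sx.
Qed.

Lemma tag0_st w : tag w = 0%N <-> w = st [::].
Proof.
split=> [w0|->//]; rewrite -[LHS]st_word.
by have /size0nil -> : size (word w) = 0%N by rewrite size_word.
Qed.

Lemma mr'_hcopE w : @hcop k (MR' q) (fbas w) =
  \sum_(i < (tag w).+1) fbas (st (take i (word w)), st (drop i (word w))).
Proof. exact: hcop_bas. Qed.

Lemma mr'_pointed : pointed (st [::] : hd_bas (MR' q)).
Proof.
split=> //; first exact: tag0_st.
by rewrite /= /mr'_cop big_ord_recl big_ord0 addr0 take0 drop0 st_word.
Qed.

Lemma hcop_lift_st (X : Wd) :
  @hcop k (MR' q) (lift_st X) = tmap lift_st lift_st (@hcop k (Words q) X).
Proof.
have ls := lift_st_linear; on_basis X; move=> u.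
rewrite lift_st_bas !hcop_bas /= lin_sum; last lin.
apply: eq_bigr => i _; rewrite tmap_bas !lift_st_bas tens_bas /=.
by rewrite st_word_take st_word_drop.
Qed.

Lemma tmul_sum (H : hopf_data k) (I J : finType) (F : I -> hd_bas H * hd_bas H) (G : J -> _) :
  tmul q (H := H) (\sum_i fbas (F i)) (\sum_j fbas (G j))
  = \sum_i \sum_j q ^+ (hd_deg (F i).2 * hd_deg (G j).1)
      *: tens (hd_mul (F i).1 (G j).1) (hd_mul (F i).2 (G j).2).
Proof.
rewrite (lin_sum _ _ _ (tmul_linl _ _)); apply: eq_bigr => i _.
by rewrite (lin_sum _ _ _ (tmul_linr _ _)); apply: eq_bigr => j _; rewrite tmul_bas.
Qed.

(** In both factors of the coproduct of a shuffle, the letters that come from the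
    first permutation remain smaller than those that come from the second, so the
    factors standardize to products of permutations. *)
Lemma mr'_copM (x y : hd_mod (MR' q)) : hcop (hmul x y) = tmul q (hcop x) (hcop y).
Proof.
on_basis x; move=> a; on_basis y; move=> b; rewrite hmul_bas [hd_mul _ _]mr'_mulE.
have ls := lift_st_linear; rewrite hcop_lift_st hcop_qshuffle !mr'_hcopE.
pose u := word a; pose v := map (addn (tag a)) (word b).
have term i j : tmap lift_st lift_st (q ^+ (size (drop i u) * size (take j v))
      *: tens (qsh (take i u) (take j v)) (qsh (drop i u) (drop j v)))
    = q ^+ (size (drop i (word a)) * size (take j (word b)))
      *: tens (mr'_mul q (st (take i (word a))) (st (take j (word b))))
              (mr'_mul q (st (drop i (word a))) (st (drop j (word b)))).
  rewrite tmapZ (tmap_tens _ _ ls ls).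
  have uu : uniq u := pword_uniq (pword_word a).
  have uv : uniq v by rewrite map_inj_uniq ?(pword_uniq (pword_word b)) //; exact: addnI.
  have sub x y : subseq x u -> subseq y v -> allrel ltn x y.
    move=> xu yv; apply/allrelP => c d cx dy.
    by apply: (allrelP (word_allrel a b)); [exact: mem_subseq xu _ cx | exact: mem_subseq yv _ dy].
  have [suv1 suv2] := (sub _ _ (take_subseq u i) (take_subseq v j),
                       sub _ _ (drop_subseq u i) (drop_subseq v j)).
  rewrite (lift_st_qshuffle (take_uniq i uu) (take_uniq j uv) suv1).
  rewrite (lift_st_qshuffle (drop_uniq i uu) (drop_uniq j uv) suv2).
  have tv : take j v = map (addn (tag a)) (take j (word b)) by rewrite /v map_take.
  have dv : drop j v = map (addn (tag a)) (drop j (word b)) by rewrite /v map_drop.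
  by rewrite tv dv (size_map (addn _)) !(st_addn (tag a)).
have size_v : size v = size (word b) by rewrite (size_map (addn _)).
have -> : @hcop k (Words q) (fbas u) = \sum_(i < (tag a).+1) fbas (take i u, drop i u).
  by rewrite hcop_bas -(size_word a).
have -> : @hcop k (Words q) (fbas v) = \sum_(i < (tag b).+1) fbas (take i v, drop i v).
  by rewrite hcop_bas -(size_word b) -size_v.
rewrite !tmul_sum.
rewrite tmap_sum; apply: eq_bigr => i _.
by rewrite tmap_sum; apply: eq_bigr => j _; exact: term.
Qed.

(** Both sides are the sum over all pairs of cuts j <= i. *)
Lemma mr'_copA (x : hd_mod (MR' q)) :
  tmap (@hcop k (MR' q)) id (hcop x) = tassoc (tmap id (@hcop k (MR' q)) (hcop x)).
Proof.
on_basis x; move=> w; rewrite hcop_bas /= /mr'_cop; set n := tag w.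
pose F (j i : nat) := fbas (st (take j (word w)), st (drop j (take i (word w))),
  st (drop i (word w))) : fmod k (perms * perms * perms)%type.
transitivity (\sum_(i < n.+1) \sum_(j < n.+1 | (j <= i)%N) F j i).
  rewrite tmap_sum; apply: eq_bigr => i _.
  rewrite tmap_bas hcop_bas /= /mr'_cop tag_st size_takel ?size_word -1?ltnS //.
  rewrite (big_ord_widen n.+1 (fun j => fbas (st (take j _), st (drop j _)))) //.
  rewrite (lin_sum _ _ _ (tens_linl _)); apply: eq_big => [j|j ji]; rewrite ?ltnS // tens_bas.
  by rewrite st_word_take st_word_drop take_takel // -ltnS.
rewrite (exchange_big_dep xpredT) //=.
rewrite tmap_sum (lin_sum _ _ _ (@tassoc_linear _ _ _ _)).
apply: eq_bigr => j _; rewrite tmap_bas hcop_bas /= /mr'_cop tag_st size_drop size_word.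
rewrite (lin_sum _ _ _ (tens_linr _)) (lin_sum _ _ _ (@tassoc_linear _ _ _ _)).
transitivity (\sum_(j <= i < n.+1) F j i).
  by rewrite big_geq_mkord.
have jn : (j <= n)%N by rewrite -ltnS.
rewrite -[X in \sum_(X <= _ < _) _]add0n big_addn (subSn jn) big_mkord.
apply: eq_bigr => i _; rewrite tens_bas tassoc_bas /F /= st_word_take st_word_drop.
by rewrite drop_drop take_drop.
Qed.

Lemma mr'_cop_homog n (x : hd_mod (MR' q)) : homog n x -> thomog n (hcop x).
Proof.
move=> hx p; rewrite -mcoeff_neq0; apply: contraNeq => pn; apply/eqP.
rewrite [hcop x](linear_lift _ (@hcop_linear _ _)) /lift fcoef_sum big1_seq // => w /andP[_ wx].
rewrite fcoefZ hcop_bas /= /mr'_cop fcoef_sum big1 ?mulr0 // => i _.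
rewrite fcoefU; case: (_ =P p) pn => // <-.
by rewrite /= -size_cat cat_take_drop size_word (_ : tag w = n) ?eqxx //; exact: hx.
Qed.

Lemma mr'_counit : @is_counit k (MR' q) (coefl (st [::] : hd_bas (MR' q))).
Proof.
apply: coef_counit => [|w|w]; first exact: mr'_pointed.
- rewrite -hcop_bas mr'_hcopE lift_sum big_ord_recl big1 ?addr0 => [|i _].
    by rewrite lift_bas take0 drop0 eqxx scale1r st_word.
  rewrite lift_bas; case: eqP => [/tag0_st/eqP|]; last by rewrite scale0r.
  by rewrite tag_st size_takel ?size_word // lift0 ltn_ord.
- rewrite -hcop_bas mr'_hcopE lift_sum big_ord_recr big1 => [|i _].
    rewrite [LHS]add0r lift_bas drop_oversize ?take_oversize ?size_word //.
    by rewrite eqxx scale1r st_word.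
  rewrite lift_bas; case: eqP => [/tag0_st/eqP|]; last by rewrite scale0r.
  by rewrite tag_st size_drop size_word subn_eq0 leqNgt /= ltn_ord.
Qed.

Theorem mr'_qhopf : is_graded_qhopf q (MR' q).
Proof.
have [? ?] := pointed_connected mr'_pointed.
split; last exact: mr'_copM.
- split=> //; [exact: mr'_mulA | exact: mr'_mul1 | exact: (homog_hmul (H := MR' q) mr'_mul_homog)].
- split; [exact: mr'_cop_homog | exact: mr'_copA | by eexists; exact: mr'_counit].
Qed.

End ShufflesOfPermutations.

(** * Duality between MR and MR' *)

Section Filtering.
Implicit Types (u v : seq nat) (w : perms) (i : nat).
Local Open Scope nat_scope.

Lemma filter_iota i n : i <= n ->
  filter (ltn^~ i) (iota 0 n) = iota 0 i /\ filter (leq i) (iota 0 n) = iota i (n - i).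
Proof.
move=> le_in; rewrite -{1 2}(subnKC le_in) iotaD !filter_cat add0n.
have lt_i : all (ltn^~ i) (iota 0 i) by apply/allP => x; rewrite mem_iota.
have ge_i : all (leq i) (iota i (n - i)) by apply/allP => x; rewrite mem_iota => /andP[].
have filter0 p q s : (forall x : nat, q x = ~~ p x) -> all p s -> filter q s = [::] :> seq nat.
  move=> qp ps; apply/eqP; rewrite -[_ == _]negbK -has_filter -all_predC.
  by rewrite (eq_all (a2 := p)) // => x /=; rewrite qp negbK.
rewrite (all_filterP lt_i) (all_filterP ge_i) (filter0 (leq i) (ltn^~ i)) //; last first.
  by move=> x; rewrite /= ltnNge.
by rewrite (filter0 (ltn^~ i) (leq i)) ?cats0 // => x; rewrite /= leqNgt.
Qed.

Lemma pword_filter_lt u i : pword u -> i <= size u ->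
  pword (filter (ltn^~ i) u) /\ size (filter (ltn^~ i) u) = i.
Proof.
move=> pu iu; have := perm_filter (ltn^~ i) pu; rewrite (filter_iota iu).1 => pf.
have sf : size (filter (ltn^~ i) u) = i by rewrite (perm_size pf) size_iota.
by rewrite /pword sf.
Qed.

Lemma pword_filter_ge u i : pword u -> i <= size u ->
  exists2 s, pword s /\ size s = size u - i & filter (leq i) u = map (addn i) s.
Proof.
move=> pu iu; pose s := map (subn^~ i) (filter (leq i) u).
have fE : filter (leq i) u = map (addn i) s.
  rewrite -map_comp -[LHS]map_id; apply/eq_in_map => x; rewrite mem_filter => /andP[ix _].
  by rewrite /= subnKC.
have := perm_filter (leq i) pu; rewrite (filter_iota iu).2 fE -[X in iota X]addn0 iotaDl.
move=> /(perm_map_inj (@addnI i)) ps.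
have ss : size s = size u - i by rewrite (perm_size ps) size_iota.
by exists s => //; rewrite /pword ss.
Qed.

Lemma predC_ltn i : predC (ltn^~ i) =1 leq i.
Proof. by move=> x; rewrite /= -leqNgt. Qed.

(** This is why theta, which weights w by its number of inversions, absorbs the
    coefficients of the coproduct of MR. *)
Lemma winv_split i u :
  winv u = inv_across (ltn^~ i) u + winv (filter (ltn^~ i) u) + winv (filter (leq i) u).
Proof.
rewrite /inv_across; elim: u => //= a u IH.
have -> : count (ltn^~ a) u =
    count (ltn^~ a) (filter (ltn^~ i) u) + count (ltn^~ a) (filter (leq i) u).
  rewrite -count_cat; apply: seq.permP; rewrite perm_sym -(eq_filter (predC_ltn i)).
  by rewrite perm_filterC.
rewrite [i <= a]leqNgt IH; case: (ltnP a i) => /= ai.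
  have -> : count (ltn^~ a) (filter (leq i) u) = 0.
    apply/eqP; rewrite -leqn0 leqNgt -has_count; apply/hasPn => b.
    by rewrite mem_filter => /andP[ib _] /=; rewrite -leqNgt ltnW // (leq_trans ai).
  by rewrite addn0 count_pred0 add0n !addnA; congr (_ + _ + _); exact: addnC.
have -> : count (ltn^~ a) (filter (ltn^~ i) u) = count (ltn^~ i) u.
  rewrite count_filter; apply: eq_count => b /=; case: (ltnP b i) => bi; rewrite ?andbF ?andbT //.
  by rewrite (leq_trans bi ai).
by rewrite -!addnA; congr (_ + _); rewrite addnCA; congr (_ + _); exact: addnCA.
Qed.

End Filtering.

Section Duality.
Variables (k : comPzRingType) (q : k).
Implicit Types (u v : seq nat) (w : perms) (i : nat).

Lemma lift_st_coef (X : hd_mod (Words q)) w : (forall x, x \in msupp X -> pword x) ->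
  (lift_st X)@_w = X@_(word w).
Proof.
move=> hX; have ls := @lift_st_linear k q.
apply: (supp_ext (V := k^o) (f := fun X : hd_mod (Words q) => (lift_st X)@_w)
  (g := fun X => X@_(word w))) => [||x xX]; [lin | lin |].
by rewrite lift_st_bas !fcoefU st_eq_word // hX.
Qed.

Lemma word_lt w : all (ltn^~ (tag w)) (word w).
Proof. by apply/allP => x; rewrite (mem_pword _ (pword_word w)) size_word. Qed.

(** Only the cut at height |w| can contribute to the coefficient of w (x) w' in the
    coproduct of u, and w, w' determine at most one shuffle equal to u. *)
Lemma mr'_mul_coef w w' (u : perms) : (mr'_mul q w w')@_u = (mr_cop q u)@_(w, w').
Proof.
rewrite mr'_mulE lift_st_coef; last by move=> x /qshuffle_pword[].
rewrite (@qshuffle_coef _ _ (ltn^~ (tag w))) ?word_lt //; last first.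
  by apply/allP => _ /mapP[x _ ->] /=; rewrite -leqNgt leq_addr.
rewrite (eq_filter (predC_ltn _)) /mr_cop fcoef_sum.
have pu := pword_word u.
case: (leqP (tag w) (tag u)) => [wu|uw]; last first.
  case: eqP => [fw|_] /=.
    have : (size (filter (ltn^~ (tag w)) (word u)) <= tag u)%N.
      by rewrite -(size_word u) size_filter count_size.
    by rewrite fw size_word leqNgt uw.
  rewrite big1 // => i _; rewrite fcoefZ fcoefU xpair_eqE.
  have iu : (i <= size (word u))%N by rewrite size_word -ltnS.
  have [_ sf] := pword_filter_lt pu iu.
  case: eqP => [E|]; rewrite ?mulr0 //.
  have : tag w = i by rewrite -E tag_st.
  by move=> wi; move: iu; rewrite size_word leqNgt -wi uw.
rewrite (bigD1 (Ordinal (wu : (tag w < (tag u).+1)%N))) //= [X in _ + X]big1 ?addr0; last first.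
  move=> i iw; rewrite fcoefZ fcoefU xpair_eqE.
  have iu : (i <= size (word u))%N by rewrite size_word -ltnS.
  have [_ sf] := pword_filter_lt pu iu.
  case: eqP => [E|]; rewrite ?mulr0 //; case/eqP: iw; apply: val_inj.
  by rewrite /= -E tag_st.
have wu' : (tag w <= size (word u))%N by rewrite size_word.
have [p1 s1] := pword_filter_lt pu wu'.
have [s [ps ss] fs] := pword_filter_ge pu wu'.
rewrite fcoefZ fcoefU xpair_eqE st_eq_word // fs st_addn st_eq_word //.
rewrite (inj_eq (inj_map (@addnI _))) inv_belowE.
by case: ifP; rewrite ?mulr1 ?mulr0.
Qed.

(** Words u, v that cover the alphabet, of total length its size, form together a
    permutation. So the only pair that can contribute to the coefficient of w is the
    pair of the two factors of w cut after |a| letters. *)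
Lemma mr_mul_coef a b (w : perms) : (mr_mul k a b)@_w = (mr'_cop k w)@_(a, b).
Proof.
rewrite /mr'_cop /mr_mul !fcoef_sum.
have cutE : forall i : 'I_(tag w).+1, tag a = i ->
    (st (drop i (word w)) = b) -> tag w = (tag a + tag b)%N.
  move=> i ai bE; rewrite -bE tag_st size_drop size_word ai subnKC // -ltnS.
  exact: ltn_ord.
have tag_take (i : 'I_(tag w).+1) : tag (st (take i (word w))) = i.
  by rewrite tag_st size_takel // size_word -ltnS.
case: (tag w =P (tag a + tag b)%N) => [wab|nwab]; last first.
  rewrite [RHS]big1 => [|i _]; last first.
    rewrite fcoefU xpair_eqE; case: eqP => // aE; case: eqP => // bE.
    by case: nwab; apply: (cutE i) => //; rewrite -aE tag_take.
  rewrite big1 // => u _; rewrite fcoef_sum big1 // => v _.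
  rewrite fcoefU; case: eqP => // E; case: nwab; rewrite -E tag_st size_cat !size_map.
  by rewrite !size_tuple.
have aw : (tag a < (tag w).+1)%N by rewrite ltnS wab leq_addr.
rewrite [RHS](bigD1 (Ordinal aw)) //= [X in _ = _ + X]big1 ?addr0; last first.
  move=> i iw; rewrite fcoefU xpair_eqE; case: eqP => // aE; case/eqP: iw.
  by apply: val_inj; rewrite /= -aE tag_take.
rewrite fcoefU xpair_eqE.
pose W := [seq cast_ord wab (tagged w j) | j <- enum 'I_(tag w)].
have WE : map val W = word w by rewrite -map_comp.
have sW : size W = (tag a + tag b)%N by rewrite size_map size_enum_ord wab.
have su : size (take (tag a) W) == tag a by rewrite size_takel // sW leq_addr.
have sv : size (drop (tag a) W) == tag b by rewrite size_drop sW addKn.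
pose C (u : (tag a).-tuple 'I_(tag a + tag b)) (v : (tag b).-tuple 'I_(tag a + tag b)) :=
  [&& [forall x, (x \in u) || (x \in v)], st (map val u) == a & st (map val v) == b].
transitivity (\sum_u \sum_(v | C u v) (st (map val u ++ map val v) == w)%:R : k).
  by apply: eq_bigr => u _; rewrite fcoef_sum; apply: eq_bigr => v _; rewrite fcoefU.
rewrite pair_big_dep /=; pose p0 := (Tuple su, Tuple sv).
have p0E : map val p0.1 = take (tag a) (word w) /\ map val p0.2 = drop (tag a) (word w).
  by rewrite -WE -map_take -map_drop.
have cover p : C p.1 p.2 -> st (map val p.1 ++ map val p.2) = w -> p = p0.
  case: p => u v /= /and3P[/forallP uv _ _] uvw.
  have suv : size (u ++ v) = (tag a + tag b)%N by rewrite size_cat !size_tuple.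
  have uuv : uniq (u ++ v).
    apply: leq_size_uniq (enum_uniq 'I_(tag a + tag b)) _ _; last by rewrite suv size_enum_ord.
    by move=> x _; rewrite mem_cat.
  have pv : perm_eq (u ++ v) (enum 'I_(tag a + tag b)).
    by apply: uniq_perm; rewrite ?enum_uniq // => x; rewrite mem_cat uv mem_enum.
  have puv : pword (map val (u ++ v)).
    by rewrite /pword size_map suv -val_enum_ord; exact: perm_map.
  move: uvw; rewrite -map_cat => /eqP; rewrite st_eq_word // -WE => /eqP/(inj_map val_inj) uvW.
  have tu : take (tag a) (u ++ v) = u by rewrite take_size_cat ?size_tuple.
  have dv : drop (tag a) (u ++ v) = v by rewrite drop_size_cat ?size_tuple.
  by congr (_, _); apply: val_inj; rewrite /= -uvW ?tu ?dv.
have st0 : st (map val p0.1 ++ map val p0.2) = w.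
  by case: p0E => -> ->; rewrite cat_take_drop st_word.
have C0 : C p0.1 p0.2 = (st (take (tag a) (word w)) == a) && (st (drop (tag a) (word w)) == b).
  rewrite /C; case: p0E => -> ->; rewrite andb_idl // => _; apply/forallP => x.
  suff : x \in W by rewrite -{1}(cat_take_drop (tag a) W) mem_cat.
  apply/mapP; exists ((tagged w)^-1 (cast_ord (esym wab) x))%g; first by rewrite mem_enum.
  by rewrite permKV cast_ordKV.
rewrite -C0; case: (boolP (C p0.1 p0.2)) => [Cp|nCp].
  rewrite (bigD1 p0) //= st0 eqxx big1 ?addr0 // => p /andP[Cpp pp].
  by case: eqP => // /(cover _ Cpp) E; rewrite E eqxx in pp.
rewrite big1 // => p Cpp; case: eqP => // /(cover _ Cpp) E.
by rewrite E in Cpp; rewrite Cpp in nCp.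
Qed.

End Duality.

Section GradedDuality.
Variables (k : comPzRingType) (q : k).
Implicit Types (w : perms).

Lemma pairing_deltar (B : choiceType) (x : fmod k B) b :
  pairing (fun b b' : B => (b == b')%:R) x (fbas b) = x@_b.
Proof. by on_basis_scalar x; move=> b'; rewrite pairing_bas fcoefU. Qed.

Lemma pairing_deltal (B : choiceType) (x : fmod k B) b :
  pairing (fun b b' : B => (b == b')%:R) (fbas b) x = x@_b.
Proof. by on_basis_scalar x; move=> b'; rewrite pairing_bas fcoefU eq_sym. Qed.

(** The component of degree n has the finite basis S_n, on which the values of phi
    are the coefficients of the element that represents phi. *)
Lemma delta_perfect (f : perms -> perms -> k) n (phi : {linear fmod k perms -> k^o}) :
  f =2 (fun w w' => (w == w')%:R) ->
  exists! x : hd_mod (MR q), homog n x /\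
    forall y : hd_mod (MR q), homog n y -> pairing f x y = phi y.
Proof.
move=> fE; pose x : hd_mod (MR q) :=
  \sum_(s : 'S_n) phi (fbas (mkperms s)) *: fbas (mkperms s).
have coefE z w : pairing f z (fbas w) = z@_w.
  on_basis_scalar z; move=> b; by rewrite pairing_bas fcoefU fE.
have xE w : tag w = n -> x@_w = phi (fbas w).
  case: w => m s /= mn; subst m; rewrite /x fcoef_sum.
  transitivity (\sum_(t : 'S_n) phi (fbas (mkperms t)) * (t == s)%:R).
    by apply: eq_bigr => t _; rewrite fcoefZ fcoefU eq_Tagged.
  rewrite (bigD1 s) //= eqxx mulr1 big1 ?addr0 // => t /negbTE ->; exact: mulr0.
exists x; split.
  split; first by apply: homog_sum => s _ _; apply/homogZ/homog_fbas.
  move=> y hy; apply: (supp_ext (V := k^o)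
    (f := fun y : hd_mod (MR q) => pairing f x y) (g := phi)).
  - lin.
  - exact: linearP.
  by move=> w /hy wn; rewrite coefE xE.
move=> x' [/homogP hx' x'E]; apply: coefP => w.
have [wn|nwn] := eqVneq (tag w) n; last first.
  rewrite hx'; last exact/eqP.
  rewrite /x fcoef_sum big1 // => s _; rewrite fcoefZ fcoefU.
  by case: eqP => [ws|]; [case/eqP: nwn; rewrite -ws | rewrite mulr0].
by rewrite xE // -x'E ?coefE //; apply: homog_fbas.
Qed.

Theorem mr_graded_dual : is_graded_dual (H := MR' q) (K := MR q) (@mr_form k).
Proof.
have pr2E (z : fmod k (perms * perms)%type) a b :
    pairing (fun a c : perms * perms => mr_form k a.1 c.1 * mr_form k a.2 c.2) (fbas (a, b)) z
    = z@_(a, b).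
  on_basis_scalar z; move=> p; rewrite pairing_bas fcoefU /mr_form /= -natrM mulnb.
  by case: p => c d; rewrite xpair_eqE [a == c]eq_sym [b == d]eq_sym.
have pr2E' (z : fmod k (perms * perms)%type) a b :
    pairing (fun a c : perms * perms => mr_form k a.1 c.1 * mr_form k a.2 c.2) z (fbas (a, b))
    = z@_(a, b).
  on_basis_scalar z; move=> p; rewrite pairing_bas fcoefU /mr_form /= -natrM mulnb.
  by case: p => c d; rewrite xpair_eqE.
split=> [n|m n x y mn hx hy|x x' y|x y y'].
- split=> phi; first exact: delta_perfect.
  have [y [[hy yE] uy]] := @delta_perfect (fun w w' => mr_form k w' w) n phi
    (fun w w' => congr1 (fun b : bool => b%:R) (eq_sym _ _)).
  have sym x z : pairing (@mr_form k) x z = pairing (fun w w' => mr_form k w' w) z x.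
    on_basis_scalar x; move=> a; on_basis_scalar z; move=> b.
    by rewrite !pairing_bas.
  exists y; split; first by split=> // x hx; rewrite sym yE.
  by move=> y' [hy' y'E]; apply: uy; split=> // x hx; rewrite -sym y'E.
- change (pairing (@mr_form k) x y = 0 :> k^o).
  rewrite (linear_lift y (pairing_linr (@mr_form k) x)) /lift big1_seq // => w /andP[_ /hy wn].
  rewrite pairing_deltar.
  by move/homogP: hx => ->; rewrite ?scaler0 // => wm; case: mn; rewrite -wm -wn.
- change (pairing (@mr_form k) (hmul x x') y = pairing (fun a c : perms * perms =>
    mr_form k a.1 c.1 * mr_form k a.2 c.2) (tens x x') (@hcop k (MR q) y)).
  on_basis_scalar x; move=> a; on_basis_scalar x'; move=> b; on_basis_scalar y; move=> c.
  by rewrite hmul_bas tens_bas hcop_bas pairing_deltar pr2E mr'_mul_coef.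
- change (pairing (@mr_form k) x (@hmul k (MR q) y y') = pairing (fun a c : perms * perms =>
    mr_form k a.1 c.1 * mr_form k a.2 c.2) (hcop x) (tens y y')).
  on_basis_scalar x; move=> c; on_basis_scalar y; move=> a; on_basis_scalar y'; move=> b.
  by rewrite hmul_bas tens_bas hcop_bas pairing_deltal pr2E' mr_mul_coef.
Qed.

End GradedDuality.

(** * Inverse permutations and the isomorphism theta *)

Section InversePermutations.
Implicit Types (u v s : seq nat) (w : perms) (i : nat).
Local Open Scope nat_scope.

Lemma pinvK : involutive pinv.
Proof. by case=> n s; rewrite /pinv /mkperms /= invgK. Qed.

Lemma nth_word_pinv w : map (nth 0 (word (pinv w))) (word w) = iota 0 (tag w).
Proof.
rewrite -val_enum_ord /word -map_comp; apply/eq_map => i /=.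
by rewrite (nth_word (w := pinv w)) /= permK.
Qed.

Lemma plen_pinv w : plen (pinv w) = plen w.
Proof.
pose f (p : 'I_(tag w) * 'I_(tag w)) := (tagged w p.2, tagged w p.1).
have fI : injective f by move=> [a b] [c d] [] /perm_inj -> /perm_inj ->.
rewrite /plen -sum1_card -[RHS]sum1_card (reindex_inj fI).
by apply: eq_bigl => p; rewrite !inE /= !permK andbC.
Qed.

(** Sorting the positions of u by their letters inverts its standardization; this
    identifies an inverse without computing it. *)
Lemma word_pinv_st u s : uniq u -> pword s -> size s = size u ->
  sorted ltn (map (nth 0 u) s) -> word (pinv (st u)) = s.
Proof.
move=> uu ps su sorted_us; set v := word (st u).
have sv : size v = size u by rewrite size_word.
have pv : pword v := pword_word _.
have lt_size x : x \in s -> x < size v by rewrite (mem_pword _ ps) su sv.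
have vE x : x < size u -> nth 0 v x = count (ltn^~ (nth 0 u x)) u.
  by move=> xu; rewrite /v word_st_uniq // (nth_map 0).
have iota_v t : pword t -> size t = size u -> perm_eq (map (nth 0 v) t) (iota 0 (size u)).
  rewrite /pword => pt tu; have := perm_map (nth 0 v) pt; rewrite tu -{1}sv -/(mkseq _ _).
  by rewrite mkseq_nth => /perm_trans; apply; rewrite -sv.
have sorted_vs : sorted ltn (map (nth 0 v) s).
  move: sorted_us; rewrite !(sorted_pairwise ltn_trans) !pairwise_map.
  apply: (@sub_in_pairwise _ (mem s)) => [x y xs ys /= xy|]; last exact/allP.
  have xu : x < size u by rewrite -sv lt_size.
  have yu : y < size u by rewrite -sv lt_size.
  by rewrite !vE // (count_lt_mono (mem_nth 0 xu) (mem_nth 0 yu)).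
have vs : map (nth 0 v) s = iota 0 (size u).
  apply: (irr_sorted_eq ltn_trans ltnn) => //; first exact: iota_ltn_sorted.
  exact: perm_mem (iota_v s ps su).
have vi : map (nth 0 v) (word (pinv (st u))) = iota 0 (size u).
  by have := nth_word_pinv (pinv (st u)); rewrite pinvK.
apply: (@eq_from_nth _ 0) => [|i]; first by rewrite size_word su.
rewrite size_word => iu.
have iu' : i < size u := iu.
have : nth 0 (map (nth 0 v) (word (pinv (st u)))) i = nth 0 (map (nth 0 v) s) i by rewrite vs vi.
rewrite !(nth_map 0) ?size_word ?su // => /eqP; rewrite nth_uniq ?(pword_uniq pv) //.
- by move/eqP.
- by rewrite sv -[X in _ < X](size_word (pinv (st u))) -mem_pword ?mem_nth ?size_word ?pword_word.
- by rewrite lt_size // mem_nth // su.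
Qed.

Lemma sorted_nth_pinv w s : subseq s (word w) -> sorted ltn (map (nth 0 (word (pinv w))) s).
Proof.
move=> /(map_subseq (nth 0 (word (pinv w)))); rewrite nth_word_pinv => sub.
exact: (subseq_sorted ltn_trans sub (iota_ltn_sorted 0 _)).
Qed.

(** The first i letters of the inverse of w are the positions of the letters
    below i in w. *)
Lemma st_take_pinv i w : i <= tag w ->
  st (take i (word (pinv w))) = pinv (st (filter (ltn^~ i) (word w))).
Proof.
move=> iw; have iw' : i <= size (word w) by rewrite size_word.
have [ps ss] := pword_filter_lt (pword_word w) iw'.
rewrite -[LHS]pinvK; congr pinv; apply: word_inj; rewrite (word_st ps).
apply: word_pinv_st => //.
- by rewrite take_uniq // (pword_uniq (pword_word _)).
- by rewrite ss size_takel // size_word.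
rewrite (_ : map _ _ = map (nth 0 (word (pinv w))) (filter (ltn^~ i) (word w))).
  by apply: sorted_nth_pinv; exact: filter_subseq.
by apply/eq_in_map => x; rewrite mem_filter => /andP[xi _]; rewrite nth_take.
Qed.

Lemma st_drop_pinv i w : i <= tag w ->
  st (drop i (word (pinv w))) = pinv (st (filter (leq i) (word w))).
Proof.
move=> iw; have iw' : i <= size (word w) by rewrite size_word.
have [s [ps ss] fs] := pword_filter_ge (pword_word w) iw'.
rewrite -[LHS]pinvK fs st_addn; congr pinv; apply: word_inj; rewrite (word_st ps).
apply: word_pinv_st => //.
- by rewrite drop_uniq // (pword_uniq (pword_word _)).
- by rewrite ss size_drop !size_word.
rewrite (_ : map _ _ = map (nth 0 (word (pinv w))) (filter (leq i) (word w))).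
  by apply: sorted_nth_pinv; exact: filter_subseq.
by rewrite fs -map_comp; apply/eq_map => x; rewrite /= nth_drop.
Qed.

Lemma plen_split i w : i <= tag w ->
  plen w = inv_below i w + plen (st (filter (ltn^~ i) (word w)))
           + plen (st (filter (leq i) (word w))).
Proof.
move=> iw; have iw' : i <= size (word w) by rewrite size_word.
have [pf _] := pword_filter_lt (pword_word w) iw'.
have [s [ps _] fs] := pword_filter_ge (pword_word w) iw'.
rewrite !plenE (winv_split i) -inv_belowE (word_st pf) fs st_addn (word_st ps).
by rewrite (winv_map (phi := addn i)) // => x y; rewrite ltn_add2l.
Qed.

End InversePermutations.

Section Theta.
Variables (k : comPzRingType) (q : k).
Implicit Types (w : perms).

Local Notation theta := (theta q).

Lemma theta_linear : linear theta. Proof. exact: lift_linear. Qed.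
Lemma theta_bas w : theta (fbas w) = q ^+ plen w *: fbas (pinv w).
Proof. exact: lift_bas. Qed.

Lemma theta_coef x w : (theta x)@_w = q ^+ plen w * x@_(pinv w).
Proof.
have lt := theta_linear; on_basis_scalar x; move=> b.
rewrite theta_bas fcoefZ !fcoefU (can2_eq pinvK pinvK).
by case: eqP => [->|]; rewrite ?plen_pinv ?mulr0.
Qed.

Lemma tmap_theta_coef z a b : (tmap theta theta z)@_(a, b) =
  q ^+ (plen a + plen b) * z@_(pinv a, pinv b).
Proof.
on_basis_scalar z; move=> [c d].
rewrite tmap_bas tens_coef !theta_coef /= !fcoefU xpair_eqE exprD mulrACA -natrM mulnb.
by [].
Qed.

(** By plen_split, the inversions of w are shared out between the coefficient of the
    i-th term of its coproduct and the weights of theta on the two factors. *)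
Lemma theta_cop w : @hcop k (MR' q) (theta (fbas w)) = tmap theta theta (mr_cop q w).
Proof.
rewrite theta_bas (linZ _ _ (@hcop_linear _ _)) mr'_hcopE scaler_sumr tmap_sum.
apply: eq_bigr => i _; have iw : (i <= tag w)%N by rewrite -ltnS.
rewrite tmapZ tmap_bas !theta_bas (linZ _ _ (tens_linl _)) (linZ _ _ (tens_linr _)) tens_bas.
rewrite !scalerA -!exprD (st_take_pinv iw) (st_drop_pinv iw) (plen_split iw).
by rewrite addnA.
Qed.

(** Since theta is self-adjoint, its compatibility with products follows from
    that with coproducts by duality. *)
Lemma theta_mul a b :
  theta (mr_mul k a b) = @hmul k (MR' q) (theta (fbas a)) (theta (fbas b)).
Proof.
apply: coefP => u; rewrite theta_coef mr_mul_coef.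
have -> : q ^+ plen u * (mr'_cop k (pinv u))@_(a, b) = (@hcop k (MR' q) (theta (fbas u)))@_(a, b).
  by rewrite theta_bas (linZ _ _ (@hcop_linear _ _)) fcoefZ hcop_bas.
rewrite theta_cop tmap_theta_coef -mr'_mul_coef !theta_bas.
rewrite (linZ _ _ (hmul_linl _)) (linZ _ _ (hmul_linr _)) scalerA -exprD fcoefZ.
by rewrite hmul_bas.
Qed.

Lemma mr_mul_homog (a b : perms) :
  homog (tag a + tag b) (mr_mul k a b : hd_mod (MR q)).
Proof.
apply: homog_sum => u _ _; apply: homog_sum => v _ _; apply: homog_fbas.
by rewrite /= size_cat !size_map !size_tuple.
Qed.

Lemma mr_cop_homog n (x : hd_mod (MR q)) : homog n x -> thomog n (hcop x).
Proof.
move=> hx p; rewrite -mcoeff_neq0; apply: contraNeq => pn; apply/eqP.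
rewrite [hcop x](linear_lift _ (@hcop_linear _ _)) /lift fcoef_sum big1_seq // => w /andP[_ wx].
rewrite fcoefZ hcop_bas /= /mr_cop fcoef_sum big1 ?mulr0 // => i _.
rewrite fcoefZ fcoefU; case: (_ =P p) pn => [<-|]; last by rewrite mulr0.
rewrite /= -(eq_filter (predC_ltn i)) !size_filter count_predC size_word.
by case/eqP; exact: hx.
Qed.

Lemma mr_pointed : pointed (st [::] : hd_bas (MR q)).
Proof.
split=> //; first exact: tag0_st.
have w0 : word (st [::]) = [::] by apply/eqP; rewrite -size_eq0 size_word.
rewrite /= /mr_cop big_ord_recl big_ord0 addr0 inv_belowE w0.
by rewrite scale1r.
Qed.

Lemma theta_hom : is_qhopf_hom (H := MR q) (K := MR' q) theta.
Proof.
apply: (basis_qhopf_hom mr_pointed (mr'_pointed q) theta_linear) => [|a b|b|b].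
- rewrite theta_bas plenE.
  have w0 : word (st [::]) = [::] by apply/eqP; rewrite -size_eq0 size_word.
  by rewrite w0 scale1r; congr fbas; apply/tag0_st.
- exact: theta_mul.
- by rewrite theta_bas; apply/homogZ/homog_fbas.
- exact: theta_cop.
Qed.

Hypothesis q_inv : exists r : k, r * q = 1.

Lemma theta_iso_inv : exists theta', [/\ linear theta', cancel theta theta' & cancel theta' theta].
Proof.
have [r rq] := q_inv.
have ex n : r ^+ n * q ^+ n = 1 by rewrite -exprMn rq expr1n.
have lt := theta_linear.
exists (lift (fun w => r ^+ plen w *: fbas (pinv w))); split; first exact: lift_linear.
  move=> x; on_basis x; move=> w.
  by rewrite theta_bas (linZ _ _ (lift_linear _)) lift_bas scalerA plen_pinv pinvK mulrC ex scale1r.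
move=> x; on_basis x; move=> w.
by rewrite lift_bas (linZ _ _ lt) theta_bas scalerA plen_pinv pinvK ex scale1r.
Qed.

Theorem theta_iso : is_qhopf_iso (H := MR q) (K := MR' q) theta.
Proof.
by split; [exact: theta_hom | have [t [_ tK Kt]] := theta_iso_inv; exists t].
Qed.

Theorem mr_qhopf : is_graded_qhopf q (MR q).
Proof.
have [t [lt tK Kt]] := theta_iso_inv.
apply: (transport_qhopf mr_pointed (mr'_pointed q) theta_hom lt tK Kt).
- exact: mr_mul_homog.
- exact: mr_cop_homog.
- exact: mr'_qhopf.
Qed.

End Theta.

(** * P-partitions *)

Section PPartitions.
Local Open Scope nat_scope.
Implicit Types (u v x y : seq nat) (w : perms) (a b : comp).

Definition lexlt (p r : nat * nat) : bool :=
  (p.1 < r.1) || ((p.1 == r.1) && (p.2 < r.2)).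

Lemma lexlt_trans : transitive lexlt.
Proof.
move=> [b b'] [a a'] [c c']; rewrite /lexlt /=.
case: (ltngtP a b) => [ab|//|->] /=; last by case: (ltngtP b c) => //= _; apply: ltn_trans.
move=> _; case: (ltngtP b c) => [bc|//|<-]; first by rewrite (ltn_trans ab bc).
by rewrite ab.
Qed.

(** For a word u without repeated letters, v is a P-partition for u: it weakly
    increases, and strictly at the descents of u. The lexicographic order expresses
    both conditions at once. *)
Definition ppart v u : bool := sorted lexlt (zip v u).

Lemma ppartP v u : size v = size u ->
  reflect (forall i, i.+1 < size u ->
             lexlt (nth 0 v i, nth 0 u i) (nth 0 v i.+1, nth 0 u i.+1))
          (ppart v u).
Proof.
move=> vu; apply: (iffP (sortedP (0, 0))) => H i; have := H i;
by rewrite size_zip vu minnn !nth_zip.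
Qed.

Lemma ppart_mapl (f : nat -> nat) v u : {mono f : i j / i < j} ->
  ppart (map f v) u = ppart v u.
Proof.
move=> mo; have inj := mono_inj_nat mo.
rewrite /ppart; have -> : zip (map f v) u = map (fun p => (f p.1, p.2)) (zip v u).
  by elim: v u => [|c v IH] [|d u] //=; rewrite IH.
rewrite sorted_map; apply: eq_sorted => p r.
by rewrite /relpre /lexlt /= mo (inj_eq inj).
Qed.

Lemma ppart_mapr (f : nat -> nat) v u : size v = size u ->
  {in u &, {mono f : i j / i < j}} -> ppart v (map f u) = ppart v u.
Proof.
move=> vu mo; apply/ppartP/ppartP; rewrite ?size_map // => H i iu.
  by have := H i iu; rewrite /lexlt /= !(nth_map 0) ?(ltnW iu) // mo ?mem_nth // ltnW.
by have := H i iu; rewrite /lexlt /= !(nth_map 0) ?(ltnW iu) // mo ?mem_nth // ltnW.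
Qed.

Lemma ppart_st v u : size v = size u -> uniq u -> ppart v (word (st u)) = ppart v u.
Proof. by move=> vu uu; rewrite word_st_uniq // ppart_mapr //; exact: count_lt_mono. Qed.

Lemma ppart_sorted v u : size v = size u -> ppart v u -> sorted leq v.
Proof.
move=> vu /ppartP vuP; apply/(sortedP 0) => i iv.
have := vuP vu i; rewrite -vu => /(_ iv) /orP[/ltnW //|/andP[/eqP /= -> _]]; exact: leqnn.
Qed.

Lemma ppart_cat m v v' u u' : size v = size u -> all (ltn^~ m) v ->
  ppart (v ++ map (addn m) v') (u ++ u') = ppart v u && ppart v' u'.
Proof.
move=> vu vm; rewrite -[ppart v' u'](@ppart_mapl (addn m)) => [|? ?]; last by rewrite ltn_add2l.
rewrite /ppart zip_cat // !(sorted_pairwise lexlt_trans) pairwise_cat; apply: andb_idl => _.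
apply/allrelP => p r pv rv; have {pv} : p.1 \in v.
  by rewrite -(unzip1_zip (eq_leq vu)); exact: map_f.
move=> /(allP vm) /= pm.
have /mapP[c _ rc] : r.1 \in map (addn m) v'.
  move: rv; elim: (map _ v') (u') => [|c s IH] [|d t] //=; rewrite !inE.
  by case/predU1P => [-> //=|/IH ->]; rewrite ?eqxx ?orbT.
by rewrite /lexlt rc (leq_trans pm) // leq_addr.
Qed.

Lemma all_pos_cut a i : all (leq 1) (take i (val a)) && all (leq 1) (drop i (val a)).
Proof. by rewrite -all_cat cat_take_drop; case: a. Qed.

Lemma val_ccat a b : val (ccat a b) = val a ++ val b.
Proof. by rewrite mkcompK // all_cat; case: a b => [? ->] [? ->]. Qed.

Lemma cdeg_ccat a b : cdeg (ccat a b) = cdeg a + cdeg b.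
Proof. by rewrite /cdeg val_ccat sumn_cat. Qed.

Lemma size_packed a : size (packed a) = cdeg a.
Proof. by rewrite size_rle // size_iota. Qed.

Lemma packed_lt a : all (ltn^~ (size (val a))) (packed a).
Proof. by apply/allP => i /rle_sub; rewrite mem_iota. Qed.

Lemma packed_ccat a b : packed (ccat a b) = packed a ++ map (addn (size (val a))) (packed b).
Proof.
rewrite /packed val_ccat size_cat iotaD add0n /rle zip_cat ?size_iota // map_cat flatten_cat.
congr (_ ++ _); rewrite map_flatten -map_comp -[X in iota X]addn0 iotaDl.
move: (size (val a)) (val b) => m s; elim: s {1 2}0 => //= n s IH j.
by rewrite map_nseq IH.
Qed.

(** Packed words turn membership in a descent set into a comparison of neighbouring
    letters, and so refinement into a condition on P-partitions. *)
Lemma mem_cdes_packed a i : 0 < i < cdeg a ->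
  (i \in cdes a) = (nth 0 (packed a) i.-1 < nth 0 (packed a) i).
Proof.
suff gen s j : all (leq 1) s -> 0 < i < sumn s ->
    (i \in [seq sumn (take m s) | m <- iota 1 (size s).-1]) =
    (nth 0 (rle s (iota j (size s))) i.-1 < nth 0 (rle s (iota j (size s))) i).
  exact: gen (valP a).
elim: s j i => [|n s IH] j i /=; first by case: i.
case/andP=> n0 ps /andP[i0 isn].
have cutsE : [seq sumn (take m (n :: s)) | m <- iota 1 (size s)] =
    if s is [::] then [::] else n :: map (addn n) [seq sumn (take m s) | m <- iota 1 (size s).-1].
  case: s {IH ps isn} => // c s; rewrite [iota _ _]/= map_cons; congr (_ :: _).
    by rewrite /= addn0.
  by rewrite (iotaDl 1 1) -!map_comp.
rewrite /rle cutsE /= -/(rle _ _) !nth_cat size_nseq.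
have i1n : (i.-1 < n) = (i <= n) by case: i i0 {isn}.
case: s IH ps isn cutsE => [|c s] IH ps isn _.
  by rewrite addn0 in isn; rewrite i1n isn (ltnW isn) !nth_nseq i1n isn (ltnW isn) ltnn.
rewrite i1n inE; case: (ltngtP i n) => [lt_in|lt_ni|->] /=.
- rewrite !nth_nseq i1n lt_in (ltnW lt_in) ltnn; apply/negbTE/mapP => -[m _ im].
  by move: lt_in; rewrite im ltnNge leq_addr.
- have -> : i.-1 - n = (i - n).-1 by rewrite -subn1 subnAC subn1.
  rewrite -IH //; last by rewrite subn_gt0 lt_ni ltn_subLR // ltnW.
  by rewrite -{1}(subnKC (ltnW lt_ni)) mem_map //; exact: addnI.
- rewrite subnn nth_nseq; case: n n0 {i1n isn} => //= n _; rewrite ltnSn.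
  by case/andP: ps => c0 _; case: c c0 {IH} => //= c _; rewrite ltnSn.
Qed.

Lemma cdeg_pcomp w : cdeg (pcomp w) = tag w.
Proof. exact: cdeg_comp_of_des. Qed.

(** The packed word of b weakly increases and w has no repeated letters, so the
    lexicographic condition only bites where w descends: there the packed word must
    step up, which means that b cuts at that place. *)
Lemma crefines_ppart w b :
  crefines (pcomp w) b = (cdeg b == tag w) && ppart (packed b) (word w).
Proof.
rewrite /crefines cdeg_pcomp eq_sym; case: eqP => //= bw.
have pw : size (packed b) = size (word w) by rewrite size_packed size_word.
have sp := (packed_content b).1; have uw := pword_uniq (pword_word w).
have step i : i.+1 < tag w ->
    lexlt (nth 0 (packed b) i, nth 0 (word w) i) (nth 0 (packed b) i.+1, nth 0 (word w) i.+1)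
    = (nth 0 (word w) i.+1 < nth 0 (word w) i) ==> (i.+1 \in cdes b).
  move=> iw; rewrite mem_cdes_packed ?bw ?iw // /lexlt /=.
  have := sortedP 0 sp i; rewrite size_packed bw => /(_ iw).
  rewrite leq_eqVlt => /orP[/eqP->|->]; last by rewrite implybT.
  rewrite ltnn eqxx /= implybF -leqNgt ltn_neqAle andb_idl // => _.
  by rewrite nth_uniq ?size_word ?(ltnW iw) // neq_ltn ltnSn.
apply/allP/(ppartP pw) => [H i|H i]; rewrite ?size_word.
  move=> iw; rewrite step //; apply/implyP => wi; apply: H.
  by rewrite cdes_comp_of_des mem_filter /= wi mem_iota; case: (tag w) iw.
rewrite cdes_comp_of_des mem_filter mem_iota /= => /andP[wi /andP[i0 iw]].
case: i i0 wi iw => // i _ /= wi iw.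
have {iw} iw : i.+1 < tag w by case: (tag w) iw => [|n]; rewrite ?add1n.
by have := H i; rewrite size_word => /(_ iw); rewrite step // wi.
Qed.

Lemma crefines_content w v : sorted leq v ->
  crefines (pcomp w) (content v) = (size v == tag w) && ppart v (word w).
Proof.
move=> sv; rewrite crefines_ppart cdeg_content //.
by have [phi mo vE] := sorted_packed sv; congr (_ && _); rewrite [in RHS]vE ppart_mapl.
Qed.

Lemma crefines_ccat w a b : cdeg a + cdeg b = tag w ->
  crefines (pcomp w) (ccat a b) =
  crefines (pcomp (st (take (cdeg a) (word w)))) a &&
  crefines (pcomp (st (drop (cdeg a) (word w)))) b.
Proof.
move=> abw; have uw := pword_uniq (pword_word w).
have st_a : size (take (cdeg a) (word w)) = cdeg a.
  by rewrite size_takel // size_word -abw leq_addr.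
have sd_b : size (drop (cdeg a) (word w)) = cdeg b by rewrite size_drop size_word -abw addKn.
rewrite !crefines_ppart !tag_st st_a sd_b cdeg_ccat abw !eqxx /=.
rewrite !ppart_st ?size_packed ?take_uniq ?drop_uniq //.
rewrite -[X in ppart _ X](cat_take_drop (cdeg a)) packed_ccat.
by rewrite ppart_cat ?packed_lt // size_packed.
Qed.

End PPartitions.

Section ShuffleOfPPartitions.
Variables (k : comPzRingType) (q : k).
Implicit Types (u v m y t d : seq nat) (p : option (nat * nat)).

Local Notation qsh := (qshuffle q).

Lemma nform_eq (f g : seq nat -> k) m :
  (forall y, perm_eq y m -> f y = g y) -> nform q f m = nform q g m.
Proof.
by move=> fg; apply: eq_big_seq => y; rewrite mem_permutations => /fg->.
Qed.

Lemma nformD (f g : seq nat -> k) m :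
  nform q (fun y => f y + g y) m = nform q f m + nform q g m.
Proof. by rewrite /nform -big_split; apply: eq_bigr => y _; rewrite mulrDr. Qed.

Lemma winv_insert a t d : all (fun c => a < c)%N t -> all (leq a) d ->
  winv (t ++ a :: d) = (size t + winv (t ++ d))%N.
Proof.
move=> + ad; elim: t => [|c t IH] /= => [_|/andP[ac /IH->]].
  rewrite (_ : count _ d = 0)%N //; apply/eqP; rewrite -leqn0 leqNgt -has_count.
  by apply/hasPn => c cd; rewrite -leqNgt (allP ad).
by rewrite !count_cat /= ac add1n addnS !addSn addnCA.
Qed.

Definition insert s a y : seq nat := take s y ++ a :: drop s y.

Lemma perm_insert s a y : perm_eq (insert s a y) (a :: y).
Proof. by rewrite /insert perm_catC /= perm_cons perm_catC cat_take_drop. Qed.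

Lemma nth_insert s a y : (s <= size y)%N -> nth 0%N (insert s a y) s = a.
Proof. by move=> sy; rewrite nth_cat size_takel // ltnn subnn. Qed.

Lemma take_insert s a y : (s <= size y)%N -> take s (insert s a y) = take s y.
Proof. by move=> sy; rewrite take_size_cat // size_takel. Qed.

Lemma drop_insert s a y : (s <= size y)%N -> drop s (insert s a y) = a :: drop s y.
Proof. by move=> sy; rewrite drop_size_cat // size_takel. Qed.

(** Moving the least letter x from position s to the front passes s larger letters,
    whence the factor q^s. *)
Lemma nform_insert (f : seq nat -> k) s x m : (s <= size m)%N -> all (leq x) m ->
  (forall y, perm_eq y (x :: m) -> f y != 0 ->
     nth 0%N y s = x /\ all (fun c => x < c)%N (take s y)) ->
  nform q f (x :: m) = q ^+ s * nform q (fun y => f (insert s x y)) m.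
Proof.
move=> sm xm fx; have size_perm y : perm_eq y m -> (s <= size y)%N by move=> /perm_size ->.
rewrite /nform (bigID (fun y => nth 0%N y s == x)) /= [X in _ + X]big1_seq ?addr0; last first.
  move=> y /andP[nx]; rewrite mem_permutations => yx.
  have [->|/(fx _ yx)[E _]] := eqVneq (f y) 0; first by rewrite mulr0.
  by rewrite E eqxx in nx.
rewrite -big_filter (perm_big (map (insert s x) (permutations m))) /=; last first.
  apply: uniq_perm.
  - by rewrite filter_uniq // permutations_uniq.
  - rewrite map_inj_in_uniq ?permutations_uniq // => y z; rewrite !mem_permutations.
    move=> /size_perm sy /size_perm sz E; rewrite -[y](cat_take_drop s) -[z](cat_take_drop s).
    have := drop_insert x sy; rewrite E drop_insert // => -[->].
    by rewrite -(take_insert x sy) E take_insert.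
  move=> y; rewrite mem_filter mem_permutations; apply/andP/mapP => [[/eqP ys yx]|[z]].
    have sy : (s < size y)%N by rewrite (perm_size yx).
    exists (take s y ++ drop s.+1 y).
      by rewrite mem_permutations -(perm_cons x) -(permPr yx) -{3}(cat_take_drop s y)
        (drop_nth 0%N sy) ys perm_sym -cat1s perm_catCA.
    rewrite /insert take_size_cat ?size_takel ?(ltnW sy) //.
    by rewrite drop_size_cat ?size_takel ?(ltnW sy) // -{1}(cat_take_drop s y) (drop_nth 0%N sy) ys.
  rewrite mem_permutations => zm ->; rewrite nth_insert ?size_perm // eqxx; split=> //.
  by rewrite (permPl (perm_insert s x z)) perm_cons.
rewrite big_map mulr_sumr; apply: eq_big_seq => y; rewrite mem_permutations => ym.
have [->|fy] := eqVneq (f (insert s x y)) 0; first by rewrite !mulr0.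
have ix : perm_eq (insert s x y) (x :: m) by rewrite (permPl (perm_insert s x y)) perm_cons.
have [_] := fx _ ix fy; rewrite take_insert ?size_perm // => lt_x.
rewrite /insert winv_insert //; last first.
  by apply/allP => c /mem_drop; rewrite (perm_mem ym); exact: allP xm c.
by rewrite cat_take_drop size_takel ?size_perm // exprD mulrA.
Qed.

(** The bound p stands for the last pair removed, in inductions that remove the pairs
    of a P-partition one by one; it is None at the start. *)
Definition above p (r : nat * nat) : bool := if p is Some p' then lexlt p' r else true.
Definition lexpath p (s : seq (nat * nat)) : bool :=
  if s is r :: s' then above p r && path lexlt r s' else true.

Arguments lexpath : simpl never.

Lemma lexpath_cons p r s : lexpath p (r :: s) = above p r && lexpath (Some r) s.
Proof. by case: s. Qed.

Lemma above_trans p r r' : above p r -> lexlt r r' -> above p r'.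
Proof. by case: p => //= p; exact: lexlt_trans. Qed.

Lemma lexpath_sorted p v u : size v = size u -> lexpath p (zip v u) -> sorted leq v.
Proof.
move=> vu H; apply: (ppart_sorted vu); rewrite /ppart; move: H.
by case: (zip v u) => //= r s /andP[].
Qed.

(** The word y is the concatenation of a P-partition for u and one for v. *)
Definition split_ppart p u v y : bool :=
  [&& size y == (size u + size v)%N, lexpath p (zip (take (size u) y) u)
    & lexpath p (zip (drop (size u) y) v)].

Section HeadCases.
Variables (p : option (nat * nat)) (a b x : nat) (u v m : seq nat).
Hypotheses (ab : (a < b)%N) (xm : all (leq x) m) (ms : size m = (size u + size v).+1).

(** The least value x is attached to the first letter a of u. The bound (x, a) then
    holds for the second part as well, whose values are at least x and whose first
    letter b exceeds a. *)
Lemma split_ppart_headl y : perm_eq y m ->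
  split_ppart p (a :: u) (b :: v) (x :: y) =
  above p (x, a) && split_ppart (Some (x, a)) u (b :: v) y.
Proof.
move=> ym; have sy : size y = (size u + size v).+1 by rewrite (perm_size ym).
rewrite /split_ppart /= lexpath_cons addSn eqSS -!andbA; case: eqP => _; last by rewrite andbF.
case: (boolP (above p (x, a))) => //= pxa; congr (_ && _).
case E: (drop (size u) y) => [//|j y2] /=.
have xj : (x <= j)%N.
  by apply: (allP xm); rewrite -(perm_mem ym) (@mem_drop (size u)) // E mem_head.
have xaj : lexlt (x, a) (j, b) by rewrite /lexlt /= ab andbT orbC -leq_eqVlt.
by rewrite !lexpath_cons (above_trans pxa xaj) /= xaj.
Qed.

(** The least value x is attached to the first letter b of v. As a < b, the bound
    (x, b) forces the first value of the first part to exceed x. *)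
Lemma split_ppart_headr y : perm_eq y m ->
  (head 0%N (insert (size u).+1 x y) != x) &&
    split_ppart p (a :: u) (b :: v) (insert (size u).+1 x y) =
  above p (x, b) && split_ppart (Some (x, b)) (a :: u) v y.
Proof.
move=> ym; have sy : size y = (size u + size v).+1 by rewrite (perm_size ym).
have su : ((size u).+1 <= size y)%N by rewrite sy ltnS leq_addr.
rewrite /split_ppart [size (a :: u)]/= take_insert // drop_insert //.
rewrite (perm_size (perm_insert _ _ _)) /=.
rewrite addnS eqSS; case: (size y =P _) => _; last by rewrite !andbF.
case: y ym su sy => [//|i y] ym _ _.
rewrite /= !lexpath_cons.
have : (x <= i)%N by apply: (allP xm); rewrite -(perm_mem ym) mem_head.
have -> : above (Some (x, b)) (i, a) = (x < i)%N.
  by rewrite /above /lexlt /= [(b < a)%N]ltnNge (ltnW ab) andbF orbF.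
case: (ltngtP x i) => //= [xi _|-> _]; last by rewrite andbF.
case: (boolP (above p (x, b))) => /= [pxb|]; last by rewrite andbF.
by rewrite (above_trans pxb) // /lexlt /= xi.
Qed.

Lemma split_ppart_min y : perm_eq y (x :: m) -> head 0%N y != x ->
  split_ppart p (a :: u) (b :: v) y ->
  nth 0%N y (size u).+1 = x /\ all (fun c => x < c)%N (take (size u).+1 y).
Proof.
move=> yxm yx /and3P[/eqP sy pI pJ].
have ge_x c : c \in y -> (x <= c)%N.
  by rewrite (perm_mem yxm) inE => /predU1P[->//|]; exact: (allP xm).
have sI : size (take (size (a :: u)) y) = size (a :: u) by rewrite size_takel // sy leq_addr.
have sJ : size (drop (size (a :: u)) y) = size (b :: v) by rewrite size_drop sy addKn.
have {pI} sortedI := lexpath_sorted sI pI; have {pJ} sortedJ := lexpath_sorted sJ pJ.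
have xI : x \notin take (size u).+1 y.
  apply: contra yx => xI; move: xI sortedI.
  case: y ge_x {yxm sy sI sJ sortedJ} => // c y ge_x /= xI cI.
  rewrite eqn_leq ge_x ?mem_head // andbT.
  move: xI; rewrite inE => /predU1P[->//|]; exact: (allP (order_path_min leq_trans cI)).
have xJ : x \in drop (size u).+1 y.
  have : x \in y by rewrite (perm_mem yxm) mem_head.
  by rewrite -{1}(cat_take_drop (size u).+1 y) mem_cat (negbTE xI).
split; last first.
  apply/allP => c cI; rewrite ltn_neqAle (ge_x c (mem_take cI)) andbT.
  by apply: contraNneq xI => ->.
rewrite -[(size u).+1]addn0 -nth_drop; move: xJ sortedJ.
have : {subset drop (size u).+1 y <= y} by move=> c; exact: mem_drop.
case: (drop _ _) => // c J /(_ c (mem_head _ _)) /ge_x xc xJ cJ; apply/eqP.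
rewrite /= eqn_leq xc andbT.
move: xJ; rewrite inE => /predU1P[->//|]; exact: (allP (order_path_min leq_trans cJ)).
Qed.

End HeadCases.

(** Shuffling the words u and v matches merging P-partitions: a P-partition m for
    a word of the shuffle is the merge of one for u and one for v, where equal
    values are taken from u first because its letters are smaller, and the
    q-weight of the shuffle counts the transpositions which sort the concatenation
    of the two. The proof removes the least value of m. *)
Lemma lexpath_shuffle u v : allrel ltn u v -> forall p m, sorted leq m ->
  size m = (size u + size v)%N ->
  lift (V := k^o) (fun x => (lexpath p (zip m x))%:R) (qsh u v)
  = nform q (fun y => (split_ppart p u v y)%:R) m.
Proof.
move: u v; apply: qshuffle_ind => [v _ p m sm mv|u _ p m sm mu|a u b v IHu IHv auv p m sm ms].
- rewrite qshuffle0l lift_bas nform_sorted // => [|y].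
    by rewrite /split_ppart mv take0 drop0 eqxx.
  rewrite /split_ppart take0 drop0 /=; case: eqP => //= yv nsy.
  by case: (boolP (lexpath _ _)) => // /(lexpath_sorted yv) sy; rewrite sy in nsy.
- rewrite qshuffle0r lift_bas nform_sorted // => [|y].
    rewrite /split_ppart mu addn0 eqxx take_oversize ?mu ?addn0 //.
    by rewrite drop_oversize ?andbT // mu addn0.
  rewrite /split_ppart addn0; case: eqP => //= yu nsy.
  rewrite take_oversize ?yu // drop_oversize ?yu // andbT.
  by case: (boolP (lexpath _ _)) => // /(lexpath_sorted yu) sy; rewrite sy in nsy.
have ab : (a < b)%N by move: auv => /= /andP[/andP[]].
have a_v : allrel ltn (a :: u) v by move: auv; rewrite allrel_consr => /andP[].
have u_bv : allrel ltn u (b :: v) by move: auv; rewrite allrel_consl => /andP[].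
case: m sm ms => [//|x m] sm' [ms]; have sm : sorted leq m := path_sorted sm'.
have xm : all (leq x) m by exact: order_path_min leq_trans sm'.
have ms1 : size m = (size u + size (b :: v))%N by rewrite /= ms.
have ms2 : size m = (size (a :: u) + size v)%N by rewrite ms /= addnS.
rewrite qshuffle_cons (linD _ _ (lift_linear _)) (linZ _ _ (lift_linear _)) !lift_lcons.
have liftE c X : lift (V := k^o) (fun z => (lexpath p (zip (x :: m) (c :: z)))%:R) X =
    (above p (x, c))%:R *: lift (V := k^o) (fun z => (lexpath (Some (x, c)) (zip m z))%:R) X.
  on_basis_scalar X; move=> z; rewrite !lift_bas [zip _ _]/= lexpath_cons.
  by rewrite -mulnb natrM.
rewrite !liftE IHu // IHv //.
pose f c y := (if c then head 0%N y == x else head 0%N y != x)%:R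
    * (split_ppart p (a :: u) (b :: v) y)%:R : k.
have -> : nform q (fun y => (split_ppart p (a :: u) (b :: v) y)%:R : k) (x :: m) =
    nform q (f true) (x :: m) + nform q (f false) (x :: m).
  rewrite -nformD; apply: nform_eq => y _; rewrite /f.
  by case: (head 0%N y == x); rewrite ?mul1r ?mul0r ?addr0 ?add0r.
have nformZ (c : k) g : nform q (fun y => c * g y) m = c * nform q g m.
  by rewrite /nform mulr_sumr; apply: eq_bigr => y _; rewrite mulrCA.
have su : ((size u).+1 <= size m)%N by rewrite ms addnS ltnS leq_addr.
have -> : nform q (f true) (x :: m) =
    (above p (x, a))%:R * nform q (fun y => (split_ppart (Some (x, a)) u (b :: v) y)%:R) m.
  rewrite (nform_insert (s := 0)) // => [|y _]; last first.
    by rewrite /f take0 nth0; case: (head 0%N y =P x) => // _; rewrite mul0r eqxx.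
  rewrite mul1r -nformZ; apply: nform_eq => y ym; rewrite /f /insert take0 drop0 /=.
  by rewrite !eqxx mul1r (split_ppart_headl p ab xm _ ym) ?ms ?addnS // -natrM mulnb.
have -> : nform q (f false) (x :: m) = q ^+ (size u).+1 *
    ((above p (x, b))%:R * nform q (fun y => (split_ppart (Some (x, b)) (a :: u) v y)%:R) m).
  rewrite (nform_insert (s := (size u).+1)) // => [|y yxm]; last first.
    rewrite /f -natrM mulnb; case: (boolP (_ && _)) => [/andP[yx ys] _|]; last by rewrite eqxx.
    exact: split_ppart_min yxm yx ys.
  congr (_ * _); rewrite -nformZ; apply: nform_eq => y ym; rewrite /f -!natrM !mulnb.
  by rewrite -(split_ppart_headr p ab xm _ ym) ?ms ?addnS //; case: (_ == x).
by [].
Qed.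

End ShuffleOfPPartitions.

(** * The projection onto quasisymmetric functions *)

Section ToQSym.
Variables (k : comPzRingType) (q : k).
Implicit Types (u v m y : seq nat) (w : perms) (a b c : comp).

Local Notation qsh := (qshuffle q).

Lemma qs_F_coef a b : (qs_F q a)@_b = (crefines a b)%:R.
Proof.
rewrite /qs_F fcoef_sum.
transitivity (\sum_(c <- comps (cdeg a) | crefines a c) (c == b)%:R : k).
  by apply: eq_bigr => c _; rewrite fcoefU.
rewrite -big_filter; case: (boolP (crefines a b)) => ab; last first.
  rewrite big1_seq // => c; rewrite mem_filter => /andP[_ /andP[ac _]].
  by case: eqP => // cb; rewrite -cb ac in ab.
have bF : b \in [seq c <- comps (cdeg a) | crefines a c].
  by rewrite mem_filter ab mem_comps eq_sym; case/andP: ab.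
rewrite (bigD1_seq b) ?filter_uniq ?comps_uniq //= eqxx big1 ?addr0 // => c /negbTE-> //.
Qed.

Lemma pi'_linear : linear (pi' q). Proof. exact: lift_linear. Qed.
Lemma pi'_bas w : pi' q (fbas w) = qs_F q (pcomp w). Proof. exact: lift_bas. Qed.
Lemma pi'_coef w b : (pi' q (fbas w))@_b = (crefines (pcomp w) b)%:R.
Proof. by rewrite pi'_bas qs_F_coef. Qed.

(** The monomials of F_c(w) are the P-partitions for w. *)
Lemma qs_eval_F w y :
  qs_eval (qs_F q (pcomp w)) y = ((size y == tag w) && ppart y (word w))%:R.
Proof.
case: (boolP (sorted leq y)) => sy.
  by rewrite qs_eval_sorted // qs_F_coef crefines_content.
rewrite /qs_eval big1_seq => [|a _]; last by rewrite Mseries_unsorted // mulr0.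
case: eqP => //= yw; case: (boolP (ppart _ _)) => // /ppart_sorted H.
by rewrite H ?size_word in sy.
Qed.

Lemma ncmul_F w w' y :
  ncmul (qs_eval (qs_F q (pcomp w))) (qs_eval (qs_F q (pcomp w'))) y =
  (split_ppart None (word w) (map (addn (tag w)) (word w')) y)%:R.
Proof.
have sorted_lexpath s : lexpath None s = sorted lexlt s by case: s.
rewrite /split_ppart !sorted_lexpath (size_map (addn _)) !size_word -!/(ppart _ _).
rewrite ncmulE; case: (leqP (tag w) (size y)) => [wy|yw]; last first.
  rewrite big_nat big1 => [|i /andP[_ iy]].
    by case: eqP => // E; move: yw; rewrite E ltnNge leq_addr.
  rewrite !qs_eval_F size_takel //; case: eqP => [E|]; last by rewrite mul0r.
  by move: yw; rewrite -E ltnNge -ltnS iy.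
rewrite (bigD1_seq (tag w)) ?iota_uniq ?mem_index_iota //= big1_seq ?addr0; last first.
  move=> i /andP[iw]; rewrite mem_index_iota ltnS => /= iy.
  by rewrite !qs_eval_F size_takel // (negbTE iw) mul0r.
rewrite !qs_eval_F size_takel // eqxx /= size_drop -natrM mulnb.
rewrite -[X in X == (_ + _)%N](subnKC wy) eqn_add2l.
case: (size y - tag w =P tag w')%N => yw' /=; last by rewrite andbF.
rewrite ppart_mapr ?size_drop ?size_word // => i j _ _; exact: ltn_add2l.
Qed.

(** The product of F_c(w) and F_c(w') in A_q enumerates concatenated pairs of
    P-partitions, which lexpath_shuffle sorts. *)
Lemma pi'_mul w w' : pi' q (mr'_mul q w w') =
  @hmul k (QSym q) (pi' q (fbas w)) (pi' q (fbas w')).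
Proof.
apply: coefP => b; have [sb <-] := packed_content b; set m := packed b.
have lp := pi'_linear; have ls := @lift_st_linear k q.
have -> : (@hmul k (QSym q) (pi' q (fbas w)) (pi' q (fbas w')))@_(content m) =
    nform q (fun y => (split_ppart None (word w) (map (addn (tag w)) (word w')) y)%:R) m.
  rewrite -(nform_qs_eval q _ sb).
  have /(Aq_eqP q)/(_ _ sb) -> := qs_evalM (pi' q (fbas w)) (pi' q (fbas w')).
  by apply: nform_eq => y _; rewrite !pi'_bas ncmul_F.
rewrite mr'_mulE.
pose n := (tag w + tag w')%N.
have -> : (pi' q (lift_st (qsh (word w) (map (addn (tag w)) (word w')))))@_(content m) =
    (size m == n)%:R *: lift (V := k^o) (fun x => (lexpath None (zip m x))%:R)
      (qsh (word w) (map (addn (tag w)) (word w'))).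
  move: (@qshuffle_pword k q w w'); move: (qsh _ _) => X hX.
  apply: (supp_ext (V := k^o) (f := fun X => (pi' q (lift_st X))@_(content m))
    (g := fun X => (size m == n)%:R *: lift (V := k^o) _ X)) => [||x xX]; [lin | lin |].
  have [px sx] := hX x xX.
  rewrite lift_st_bas pi'_coef lift_bas crefines_content // tag_st sx -/n word_st //.
  by rewrite -mulnb natrM; congr (_ * (nat_of_bool _)%:R); case: (zip _ _).
case: (size m =P n) => mn.
  rewrite scale1r lexpath_shuffle ?word_allrel // mn size_word (size_map (addn _)) size_word.
  by [].
rewrite scale0r /nform big1_seq // => y; rewrite mem_permutations => /andP[_ /perm_size ym].
rewrite /split_ppart ym size_word (size_map (addn _)) size_word.
by rewrite (introF eqP mn) mulr0.
Qed.

Lemma pi'_homog w : homog (tag w) (pi' q (fbas w)).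
Proof.
apply/homogP => b bw; rewrite pi'_coef crefines_ppart.
by case: eqP => // E; case: bw; rewrite -E.
Qed.

Lemma qs_cop_coef (x : hd_mod (QSym q)) a b : (hcop x)@_(a, b) = x@_(ccat a b).
Proof.
on_basis_scalar x; move=> c; rewrite hcop_bas fcoefU fcoef_sum.
have vE i : val (mkcomp (take i (val c))) = take i (val c) /\
            val (mkcomp (drop i (val c))) = drop i (val c).
  by have /andP[t d] := all_pos_cut c i; rewrite !mkcompK.
have cutE i : (i <= size (val c))%N ->
    ((mkcomp (take i (val c)), mkcomp (drop i (val c))) == (a, b))
    = (i == size (val a)) && (c == ccat a b).
  move=> ic; have [t d] := vE i; apply/eqP/andP => [[<- <-]|[/eqP-> /eqP->]].
    rewrite t size_takel //; split=> //; apply/eqP/val_inj.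
    by rewrite val_ccat t d cat_take_drop.
  rewrite val_ccat take_size_cat // drop_size_cat //.
  by congr (_, _); apply: val_inj; rewrite mkcompK //; apply: valP.
transitivity (\sum_(i < (size (val c)).+1) ((i == size (val a) :> nat) && (c == ccat a b))%:R : k).
  by apply: eq_bigr => i _; rewrite fcoefU cutE // -ltnS.
have [cab|] := boolP (c == ccat a b); last first.
  by move=> _; rewrite big1 // => i _; rewrite andbF.
have sa : (size (val a) < (size (val c)).+1)%N.
  by rewrite (eqP cab) val_ccat size_cat ltnS leq_addr.
rewrite (bigD1 (Ordinal sa)) //= eqxx big1 ?addr0 // => i.
by rewrite -val_eqE /= => /negbTE ->.
Qed.

(** Cutting a P-partition after |a| letters: the coefficientwise form of both the
    compatibility of pi' with coproducts and that of iota with products. *)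
Lemma crefines_ccat_sum w a b : (crefines (pcomp w) (ccat a b))%:R =
  \sum_(i < (tag w).+1) (crefines (pcomp (st (take i (word w)))) a)%:R *
                         (crefines (pcomp (st (drop i (word w)))) b)%:R :> k.
Proof.
have cut i : (i < (tag w).+1)%N -> crefines (pcomp (st (take i (word w)))) a -> i = cdeg a.
  move=> iw; rewrite crefines_ppart tag_st size_takel ?size_word // => /andP[/eqP-> _] //.
have [abw|nabw] := eqVneq (cdeg a + cdeg b)%N (tag w); last first.
  rewrite crefines_ppart cdeg_ccat (negbTE nabw) big1 // => -[i iw] _ /=.
  case: (boolP (crefines _ a)) => [/(cut i iw) ia|]; last by rewrite mul0r.
  rewrite crefines_ppart tag_st size_drop size_word ia.
  case: eqP => [E|]; last by rewrite mulr0.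
  by case/eqP: nabw; rewrite E subnKC // -ia -ltnS.
have aw : (cdeg a < (tag w).+1)%N by rewrite -abw ltnS leq_addr.
rewrite crefines_ccat // -mulnb natrM (bigD1 (Ordinal aw)) //= big1 ?addr0 // => -[i iw] /=.
rewrite -val_eqE /= => ia; case: (boolP (crefines _ a)) => [/(cut i iw) E|]; last by rewrite mul0r.
by rewrite E eqxx in ia.
Qed.

Lemma pi'_cop w : @hcop k (QSym q) (pi' q (fbas w)) = tmap (pi' q) (pi' q) (mr'_cop k w).
Proof.
apply: coefP => -[a b]; rewrite qs_cop_coef pi'_coef crefines_ccat_sum tmap_sum fcoef_sum.
by apply: eq_bigr => i _; rewrite tmap_bas tens_coef !pi'_coef.
Qed.

Lemma cdeg0 a : cdeg a = 0%N <-> a = mkcomp [::].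
Proof.
split=> [a0|->]; last by rewrite /cdeg mkcompK.
by apply: cdes_cdeg_inj; rewrite /cdes /cdeg mkcompK //; case: a a0 => -[|[|n] s].
Qed.

Lemma qs_pointed : pointed (mkcomp [::] : hd_bas (QSym q)).
Proof.
split=> //; first exact: cdeg0.
by rewrite /= /qs_cop mkcompK // big_ord_recl big_ord0 addr0.
Qed.

Lemma qs_F0 w : tag w = 0%N -> qs_F q (pcomp w) = fbas (mkcomp [::]).
Proof.
move=> w0; apply: coefP => b; rewrite qs_F_coef crefines_ppart fcoefU w0 eq_sym.
have ppart0 : ppart (packed b) (word w).
  by rewrite /ppart (_ : word w = [::]); [case: (packed b) | apply: size0nil; rewrite size_word].
rewrite ppart0 andbT; congr (nat_of_bool _)%:R.
by apply/eqP/eqP => [/esym/cdeg0->|/esym/cdeg0->].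
Qed.

Theorem pi'_hom : is_qhopf_hom (H := MR' q) (K := QSym q) (pi' q).
Proof.
apply: (basis_qhopf_hom (mr'_pointed q) qs_pointed pi'_linear) => [|a b|b|b].
- by rewrite pi'_bas qs_F0.
- exact: pi'_mul.
- exact: pi'_homog.
- exact: pi'_cop.
Qed.

(** Every set of descents occurs: give the letter in position i the value n minus
    the number of prescribed descents up to i, and standardize. *)
Lemma pcomp_surj a : exists w, pcomp w = a.
Proof.
pose n := cdeg a; pose d i := count (leq^~ i) (cdes a).
pose u := [seq (size (cdes a) - d i)%N | i <- iota 0 n].
have su : size u = n by rewrite size_map size_iota.
exists (st u); rewrite -[RHS]comp_of_desK.
rewrite /pcomp tag_st su; apply: cdes_cdeg_inj; last by rewrite !cdeg_comp_of_des.
rewrite !cdes_comp_of_des.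
apply: eq_in_filter => i; rewrite mem_iota => /andP[i0 i_n].
have {}i_n : (i < n)%N by case: (n) i_n => [|m] /=; rewrite add1n // ltnS leqNgt i0.
have i1n : (i.-1 < n)%N := leq_ltn_trans (leq_pred i) i_n.
rewrite word_st_lt ?su ?i_n ?andbT ?prednK // !(nth_map 0%N) ?size_iota // !nth_iota //.
rewrite ltn_sub2lE ?count_size //.
have -> : d i = (d i.-1 + (i \in cdes a))%N.
  rewrite -(count_uniq_mem i) ?(sorted_uniq ltn_trans ltnn (cdes_sorted a)) //.
  rewrite -count_predUI [X in (_ + X)%N](eq_count (a2 := pred0)) ?count_pred0 ?addn0.
    by apply: eq_count => j /=; rewrite -[(j <= i.-1)%N]ltnS prednK // orbC -leq_eqVlt.
  by move=> j /=; case: eqP => [->|]; rewrite ?andbF // -[(i <= i.-1)%N]ltnS prednK // ltnn.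
by rewrite -[X in (X < _)%N]addn0 ltn_add2l /=; case: (i \in _).
Qed.

Theorem pi'_surj (y : hd_mod (QSym q)) : exists x : hd_mod (MR' q), pi' q x = y.
Proof.
have lp := pi'_linear.
have lin_im (c : k) (x y' : hd_mod (QSym q)) : (exists z, pi' q z = x) -> (exists z, pi' q z = y') ->
    exists z, pi' q z = c *: x + y'.
  by move=> [z <-] [t <-]; exists (c *: z + t); rewrite lp.
have sum_im (I : eqType) (r : seq I) (P : pred I) (c : I -> k) (F : I -> hd_mod (QSym q)) :
    (forall i, P i -> exists z, pi' q z = F i) ->
    exists z, pi' q z = \sum_(i <- r | P i) c i *: F i.
  move=> PF; elim: r => [|i r IH]; first by exists 0; rewrite big_nil (lin0 lp).
  by rewrite big_cons; case: ifP => // Pi; apply: lin_im => //; exact: PF.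
(* M_a is F_a minus the M_b for the proper refinements b of a, which have more
   descents. *)
suff M_im a : exists z, pi' q z = fbas a.
  rewrite -(lift_fbas y) /lift; apply: sum_im => a _; exact: M_im.
have [n] := ubnP (cdeg a - size (cdes a)); elim: n a => // n IH a an.
have [w wa] := pcomp_surj a.
have FE : fbas a = - 1 *: (\sum_(b <- comps (cdeg a) | crefines a b && (b != a)) 1 *: fbas b)
    + pi' q (fbas w) :> hd_mod (QSym q).
  have aa : crefines a a by rewrite /crefines eqxx; apply/allP.
  have aF : a \in [seq b <- comps (cdeg a) | crefines a b] by rewrite mem_filter aa mem_comps /=.
  have -> : pi' q (fbas w) =
      fbas a + \sum_(b <- comps (cdeg a) | crefines a b && (b != a)) 1 *: fbas b.
    rewrite pi'_bas wa /qs_F -big_filter (bigD1_seq a aF) ?filter_uniq ?comps_uniq //.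
    by rewrite big_filter_cond; congr (_ + _); apply: eq_bigr => b _; rewrite scale1r.
  by rewrite scaleN1r addrCA addNr addr0.
rewrite FE; apply: lin_im; last by exists (fbas w).
apply: sum_im => b /andP[/andP[/eqP ab /allP ab_sub] b_a]; apply: IH.
have uniq_cdes c : uniq (cdes c) := sorted_uniq ltn_trans ltnn (cdes_sorted c).
have b_n : (size (cdes b) <= cdeg b)%N.
  rewrite -[X in (_ <= X)%N](size_iota 0); apply: uniq_leq_size => // i /mem_cdes/andP[_ ib].
  by rewrite mem_iota.
have lt_ab : (size (cdes a) < size (cdes b))%N.
  rewrite ltnNge; apply: contra b_a => size_ba; apply/eqP/esym.
  apply: cdes_cdeg_inj => //; apply: (irr_sorted_eq ltn_trans ltnn); try exact: cdes_sorted.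
  by have [] := uniq_min_size (uniq_cdes a) ab_sub size_ba.
rewrite -ab; rewrite ltnS in an; apply: leq_trans an.
rewrite ltn_sub2l // ab; exact: leq_trans lt_ab b_n.
Qed.

End ToQSym.

(** * The embedding of noncommutative symmetric functions *)

Section FromNSym.
Variables (k : comPzRingType) (q : k).
Hypothesis q_inv : exists r : k, r * q = 1.
Implicit Types (w : perms) (a b : comp).

Lemma iota_linear : linear (iota_q q). Proof. exact: lift_linear. Qed.
Lemma iota_bas a : iota_q q (fbas a) = D_below q a. Proof. exact: lift_bas. Qed.

Lemma iota_coef a w : (iota_q q (fbas a))@_w = (crefines (pcomp w) a)%:R.
Proof.
rewrite iota_bas /D_below fcoef_sum.
have [wa|nwa] := eqVneq (tag w) (cdeg a); last first.
  rewrite /crefines cdeg_pcomp (negbTE nwa) big1 // => s _; rewrite fcoefU.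
  by case: eqP => // sw; case/eqP: nwa; rewrite -sw.
case: w wa => n s /= sn; subst n.
transitivity (\sum_(t : 'S_(cdeg a) | crefines (pcomp (mkperms t)) a) (t == s)%:R : k).
  by apply: eq_bigr => t _; rewrite fcoefU eq_Tagged.
case: (boolP (crefines _ a)) => sa; last first.
  by rewrite big1 // => t ta; case: eqP => // ts; rewrite -ts ta in sa.
by rewrite (bigD1 s) //= eqxx big1 ?addr0 // => t /andP[_ /negbTE ->].
Qed.

(** For basis elements w and H_a, both sides test whether a refines c(w). *)
Lemma pi'_iota (x : hd_mod (MR' q)) (y : hd_mod (NSym q)) :
  qs_ns_pairing q (pi' q x) y = mr_pairing q x (iota_q q y).
Proof.
have lp := @pi'_linear k q; have li := iota_linear.
rewrite /qs_ns_pairing /mr_pairing; on_basis_scalar x; move=> w; on_basis_scalar y; move=> a.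
by rewrite pairing_deltar pairing_deltal pi'_coef iota_coef.
Qed.

(** The transpose of a surjective map is injective. *)
Lemma iota_inj : injective (iota_q q).
Proof.
move=> x y xy; apply: coefP => a; have [z za] := pi'_surj (fbas a : hd_mod (QSym q)).
have coefE (t : hd_mod (NSym q)) : t@_a = mr_pairing q z (iota_q q t).
  by rewrite -pi'_iota za /qs_ns_pairing pairing_deltal.
by rewrite !coefE xy.
Qed.

Lemma mr_mul_cut (x y : hd_mod (MR q)) w : (hmul x y)@_w =
  \sum_(i < (tag w).+1) x@_(st (take i (word w))) * y@_(st (drop i (word w))).
Proof.
have lsum (F : 'I_(tag w).+1 -> hd_mod (MR q) -> k) :
    (forall i, linear (F i : _ -> k^o)) -> linear ((fun x => \sum_i F i x) : _ -> k^o).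
  move=> lF c z t; rewrite scaler_sumr -big_split; apply: eq_bigr => i _; exact: lF.
move: x; apply: (bas_ext (V := k^o) (f := fun x : hd_mod (MR q) => (hmul x y)@_w)
  (g := fun x => \sum_i x@_ _ * y@_ _)) => [||a]; [lin | by apply: lsum => i; lin |].
move: y; apply: (bas_ext (V := k^o) (f := fun y : hd_mod (MR q) => (hmul _ y)@_w)
  (g := fun y => \sum_i _ * y@_ _)) => [||b]; [lin | by apply: lsum => i; lin |].
rewrite hmul_bas mr_mul_coef /mr'_cop fcoef_sum; apply: eq_bigr => i _.
by rewrite !fcoefU xpair_eqE -natrM mulnb eq_sym [b == _]eq_sym.
Qed.

Lemma iota_mul a b : iota_q q (fbas (ccat a b)) =
  @hmul k (MR q) (iota_q q (fbas a)) (iota_q q (fbas b)).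
Proof.
apply: coefP => w; rewrite mr_mul_cut iota_coef crefines_ccat_sum.
by apply: eq_bigr => i _; rewrite !iota_coef.
Qed.

Lemma iota_homog a : homog (cdeg a) (iota_q q (fbas a)).
Proof.
apply/homogP => w wa; rewrite iota_coef /crefines cdeg_pcomp.
by case: eqP => // E; case: wa; rewrite -E.
Qed.

Lemma val_ns_H n : val (ns_H n) = if n == 0%N then [::] else [:: n].
Proof. by rewrite mkcompK //; case: n. Qed.

Lemma iota_H n : iota_q q (fbas (ns_H n)) = fbas (st (iota 0 n)).
Proof.
have wi : word (st (iota 0 n)) = iota 0 n by apply: word_st; rewrite size_iota.
have pE : packed (ns_H n) = nseq n 0%N.
  by rewrite /packed val_ns_H; case: n {wi} => //= n; rewrite /rle /= cats0.
have dE : cdeg (ns_H n) = n by rewrite /cdeg val_ns_H; case: n {wi pE} => //= n; rewrite addn0.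
apply: coefP => w; rewrite iota_coef fcoefU crefines_ppart dE pE; congr (nat_of_bool _)%:R.
have ppartE u : size u = n -> ppart (nseq n 0%N) u = sorted ltn u.
  move=> <- {wi pE dE}; case: u => //= c u; elim: u c => //= d u IH c.
  by rewrite /ppart /= in IH *; rewrite -IH.
apply/andP/eqP => [[/eqP nw]|<-]; last first.
  by rewrite tag_st size_iota eqxx ppartE wi ?size_iota // iota_ltn_sorted.
rewrite ppartE ?size_word // => sw; apply: word_inj; rewrite wi; symmetry.
apply: (irr_sorted_eq ltn_trans ltnn) => //; first exact: iota_ltn_sorted.
by move=> i; rewrite (mem_pword _ (pword_word w)) size_word mem_iota -nw.
Qed.

Lemma ns_pointed : pointed (mkcomp [::] : hd_bas (NSym q)).
Proof. by split=> //; [exact: cdeg0 | rewrite /= /ns_cop mkcompK]. Qed.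

Lemma mr_cop_id n : @hcop k (MR q) (fbas (st (iota 0 n))) =
  \sum_(i < n.+1) fbas (st (iota 0 i), st (iota 0 (n - i))).
Proof.
have wi : word (st (iota 0 n)) = iota 0 n by apply: word_st; rewrite size_iota.
rewrite hcop_bas /= /mr_cop tag_st size_iota; apply: eq_bigr => i _.
have i_n : (i <= n)%N by rewrite -ltnS.
rewrite inv_belowE wi (filter_iota i_n).1 (filter_iota i_n).2.
have -> : st (iota i (n - i)) = st (iota 0 (n - i)) by rewrite -{1}[i : nat]addn0 iotaDl st_addn.
rewrite (_ : inv_across _ _ = 0%N) ?expr0 ?scale1r //; apply/eqP.
have := winv_split i (iota 0 n); rewrite winv_sorted ?iota_sorted //.
by move/esym/eqP; rewrite !addn_eq0 => /andP[/andP[]].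
Qed.

Lemma comp_ind (P : comp -> Prop) : P (mkcomp [::]) ->
  (forall n a, (0 < n)%N -> P a -> P (ccat (ns_H n) a)) -> forall a, P a.
Proof.
move=> P0 PS [s ps]; elim: s ps => [|n s IH] ps.
  by rewrite (_ : exist _ _ _ = mkcomp [::]) //; apply: val_inj; rewrite mkcompK.
case/andP: (ps) => n0 ps'; have := PS n (exist _ s ps') n0 (IH ps').
rewrite (_ : exist _ (n :: s) _ = ccat (ns_H n) (exist _ s ps')) //.
by apply: val_inj; rewrite val_ccat val_ns_H /= (gtn_eqF n0).
Qed.

Lemma val_ccat_H n a : (0 < n)%N -> val (ccat (ns_H n) a) = n :: val a.
Proof. by move=> n0; rewrite val_ccat val_ns_H (gtn_eqF n0). Qed.

(** Both coproducts are multiplicative for the twisted product, that of NSym by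
    definition; so the generators H_n are enough. *)
Lemma iota_cop a : @hcop k (MR q) (iota_q q (fbas a)) = tmap (iota_q q) (iota_q q) (ns_cop q a).
Proof.
have li := iota_linear.
have iM (x y : hd_mod (NSym q)) :
    iota_q q (hmul x y) = @hmul k (MR q) (iota_q q x) (iota_q q y).
  by on_basis x; move=> b; on_basis y; move=> c; rewrite hmul_bas iota_mul.
elim/comp_ind: a => [|n a n0 IH].
  rewrite /ns_cop mkcompK //= tmap_bas /=.
  rewrite (_ : mkcomp [::] = ns_H 0) // iota_H mr_cop_id big_ord_recl big_ord0 tens_bas.
  exact: addr0.
have -> : ns_cop q (ccat (ns_H n) a) =
    tmul q (H := NSym q) (\sum_(i < n.+1) fbas (ns_H i, ns_H (n - i))) (ns_cop q a).
  by rewrite /ns_cop val_ccat_H.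
have [_ _ mrM] := mr_qhopf q_inv.
rewrite iota_mul mrM IH (@tmap_tmul k q (NSym q) (MR q) _ _ _ li iM iota_homog).
congr (tmul q _ _); rewrite iota_H mr_cop_id tmap_sum; apply: eq_bigr => i _.
by rewrite tmap_bas !iota_H tens_bas.
Qed.

Theorem iota_hom : is_qhopf_hom (H := NSym q) (K := MR q) (iota_q q).
Proof.
apply: (basis_qhopf_hom ns_pointed (mr_pointed q) iota_linear) => [|a b|a|a].
- by rewrite (_ : mkcomp [::] = ns_H 0) // iota_H.
- exact: iota_mul.
- exact: iota_homog.
- exact: iota_cop.
Qed.

(** Both sides are algebra morphisms, and H_n goes to the identity permutation,
    which theta fixes, and then to F_(n) = h_n. *)
Lemma pi'_theta_iota (x : hd_mod (NSym q)) : pi' q (theta q (iota_q q x)) = forgetful q x.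
Proof.
have lp := @pi'_linear k q; have li := iota_linear; have lt := @theta_linear k q.
have lf : linear (forgetful q) by exact: lift_linear.
have forget_bas a : forgetful q (fbas a) =
    foldr (fun n x => hmul (qs_h q n) x) (hd_one (QSym q)) (val a) by exact: lift_bas.
have [_ [_ pM] _ _ _] := pi'_hom q; have [_ [_ tM] _ _ _] := theta_hom q.
have theta_id n : theta q (fbas (st (iota 0 n))) = fbas (st (iota 0 n)).
  have wi : word (st (iota 0 n)) = iota 0 n by apply: word_st; rewrite size_iota.
  rewrite theta_bas plenE wi winv_sorted ?iota_sorted // scale1r; congr fbas.
  apply: word_inj; rewrite wi; apply: word_pinv_st; rewrite ?iota_uniq ?size_iota //.
    by rewrite /pword size_iota.
  rewrite (_ : map _ _ = iota 0 n) ?iota_ltn_sorted //.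
  by rewrite -[RHS](mkseq_nth 0%N) size_iota.
have pi_H n : pi' q (theta q (iota_q q (fbas (ns_H n)))) = qs_h q n.
  have wi : word (st (iota 0 n)) = iota 0 n by apply: word_st; rewrite size_iota.
  rewrite iota_H theta_id pi'_bas /qs_F cdeg_pcomp tag_st size_iota /qs_h.
  rewrite big_seq_cond [RHS]big_seq; apply: eq_bigl => b; apply: andb_idr.
  rewrite mem_comps => /eqP bn; rewrite crefines_ppart tag_st size_iota bn eqxx wi /=.
  apply/ppartP => [|i]; first by rewrite size_packed size_iota.
  rewrite size_iota => i_n; have sp := (packed_content b).1.
  have := sortedP 0%N sp i; rewrite size_packed bn => /(_ i_n); rewrite /lexlt /=.
  by rewrite !nth_iota ?(ltnW i_n) // ltnSn andbT orbC -leq_eqVlt.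
on_basis x; move=> a; rewrite forget_bas; elim/comp_ind: a => [|n a n0 IH].
  by rewrite (_ : mkcomp [::] = ns_H 0) // iota_H theta_id pi'_bas qs_F0 // val_ns_H.
by rewrite val_ccat_H // iota_mul tM pM pi_H IH.
Qed.

End FromNSym.

Theorem theorem3p1 (k : comPzRingType) (q : k)
    (q_inv : exists r : k, r * q = 1) :
  [/\ is_graded_qhopf q (MR q), is_graded_qhopf q (MR' q)
    & is_graded_dual (H := MR' q) (K := MR q) (@mr_form k)] /\
  is_qhopf_iso (H := MR q) (K := MR' q) (theta q) /\
  [/\ is_qhopf_hom (H := MR' q) (K := QSym q) (pi' q) /\
        (forall y : hd_mod (QSym q), exists x : hd_mod (MR' q), pi' q x = y),
      is_qhopf_hom (H := NSym q) (K := MR q) (iota_q q) /\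
        injective (iota_q q)
    & forall (w : perms) (x : hd_mod (NSym q)),
        qs_ns_pairing q (pi' q (fbas w)) x = mr_pairing q (fbas w) (iota_q q x)] /\
  (forall x : hd_mod (NSym q), pi' q (theta q (iota_q q x)) = forgetful q x).
Proof.
split; first by split; [exact: mr_qhopf | exact: mr'_qhopf | exact: mr_graded_dual].
split; first exact: theta_iso.
split; last exact: pi'_theta_iota.
split; first by split; [exact: pi'_hom | exact: pi'_surj].
  by split; [exact: iota_hom | exact: iota_inj].
by move=> w x; apply: pi'_iota.
Qed.
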